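(* Let $\tilde P_0\supset\tilde P_1\supset\cdots\supset\tilde P_8$ be the $\mathrm{U}$-Bott chain starting with $\tilde P_0=\mathrm{U}_{16n}$ and $\bar P_0\supset\bar P_1\supset\cdots\supset\bar P_8$ the $\mathrm{Sp}$-Bott chain starting with $\bar P_0=\mathrm{Sp}_{16n}$, constructed with the same base points $J_0=I,J_1,\dots,J_8$. Let $\bar\tau:\mathrm{Sp}_{16n}\to\mathrm{Sp}_{16n}$, $\bar\tau(X)=A_{16n}XA_{16n}^{-1}$, where $A_r=\begin{pmatrix} iI_r & 0 \\ 0 & -iI_r\end{pmatrix}\in\mathrm{Sp}_r\subset\mathrm{U}_{2r}$. (1) For every $k\in\{0,1,\dots,8\}$ the space $\bar P_k$ is $\bar\tau$-invariant and $$\tilde P_k=(\bar P_k^{\bar\tau})_{J_k},$$ the connected component containing $J_k$ of the fixed point set of $\bar\tau$ in $\bar P_k$; in particular $\tilde P_k\subset\bar P_k$. (2) These vertical inclusions $\tilde P_k\subset\bar P_k$ and the horizontal inclusions $\tilde P_{k+1}\subset\tilde P_k$, $\bar P_{k+1}\subset\bar P_k$ of the two Bott chains form a commutative ladder diagram, i.e. for every $k\in\{0,\dots,7\}$ the compositions $\tilde P_{k+1}\subset\tilde P_k\subset\bar P_k$ and $\tilde P_{k+1}\subset\bar P_{k+1}\subset\bar P_k$ coincide. (3) For every $\ell\in\{0,1,\dots,7\}$ the square formed by the canonical maps $\tilde\jmath_{\ell+1}:\tilde P_{\ell+1}\to\Omega(\tilde P_\ell;J_\ell,-J_\ell)$ and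 $\bar\jmath_{\ell+1}:\bar P_{\ell+1}\to\Omega(\bar P_\ell;J_\ell,-J_\ell)$ and the inclusions $\tilde P_{\ell+1}\subset\bar P_{\ell+1}$, $\Omega(\tilde P_\ell;J_\ell,-J_\ell)\subset\Omega(\bar P_\ell;J_\ell,-J_\ell)$ commutes, i.e. $\bar\jmath_{\ell+1}|_{\tilde P_{\ell+1}}$ equals $\tilde\jmath_{\ell+1}$ followed by the inclusion of path spaces.
   Context: Notation. For a map $\sigma:A\to A$, $A^\sigma$ is its fixed point set; for $a$ in a space $A$, $A_a$ is the connected component of $A$ containing $a$. Groups. $\mathrm{Sp}_r$ is identified with the subgroup of $\mathrm{U}_{2r}$ of all unitary matrices of the form $\begin{pmatrix} A & -\overline{B} \\ B & \overline{A}\end{pmatrix}$ with $A,B$ complex $r\times r$ matrices; $\mathrm{U}_r\subset\mathrm{Sp}_r$ is the subgroup of those with $B=0$, $A\in\mathrm{U}_r$. $\mathrm{Sp}_r$ and $\mathrm{U}_r$ carry the metrics induced from the bi-invariant metric $\langle X,Y\rangle=-\frac12\mathrm{tr}(XY)$ on $\mathrm{U}_{2r}$; on $\mathrm{U}_r$ this is $\langle X,Y\rangle=-\mathrm{tr}(XY)$, $X,Y\in\mathfrak u_r$. The fixed point set of the involution $X\mapsto A_rXA_r^{-1}$ of $\mathrm{Sp}_r$ is $\mathrm{U}_r$. Centrioles. For a compact connected Riemannian symmetric space $P$ let $s_x$ be the geodesic symmetry at $x$. For $o\in P$, a pole of $(P,o)$ is a point $p\ne o$ with $s_p=s_o$.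 If $p$ is a pole, the centrosome $C_p(P,o)$ is the set of midpoints of geodesics in $P$ from $o$ to $p$; its connected components are the centrioles of $(P,o)$ relative to $p$. A centriole containing a midpoint of a shortest geodesic segment from $o$ to $p$ is called an s-centriole (it then consists only of midpoints of such shortest segments). Base points. $n\ge1$ is an integer, $P_0=\mathrm{SO}_{16n}$, $J_0=I$. $P_1$ is one of the two connected components of $\{J\in\mathrm{SO}_{16n}: J^2=-I\}$; inductively, having picked $J_k\in P_k$ ($1\le k\le 7$), $P_{k+1}$ is the top-dimensional connected component of $\{J\in P_k: JJ_k=-J_kJ\}$ (for $k=7$: any one of the two components). Finally $J_8\in P_8$. So $J_0,\dots,J_8\in\mathrm{SO}_{16n}\subset\mathrm{U}_{16n}\subset\mathrm{Sp}_{16n}$. $\mathrm{U}$-Bott chain. $\tilde P_0=\mathrm{U}_{16n}$ with metric $-\mathrm{tr}(XY)$; for $0\le k\le7$, $\tilde P_{k+1}$ is the top-dimensional s-centriole of $(\tilde P_k,J_k)$ relative to the pole $-J_k$ (one has $J_k\in P_k\subset\tilde P_k$). $\mathrm{Sp}$-Bott chain. $\bar P_0=\mathrm{Sp}_{16n}$ with the metric above; for $0\le k\le 7$, $\bar P_{k+1}$ is the s-centriole of $(\bar P_k,J_k)$ relative to the pole $-J_k$ which contains $J_{k+1}$. Up to diffeomorphism $\bar P_1,\dots,\bar P_8$ are $\mathrm{Sp}_{16n}/\mathrm{U}_{16n}$, $\mathrm{U}_{16n}/\mathrm{O}_{16n}$, $\mathrm{G}_{8n}(\mathbb R^{16n})$,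 $\mathrm{SO}_{8n}$, $\mathrm{SO}_{8n}/\mathrm{U}_{4n}$, $\mathrm{U}_{4n}/\mathrm{Sp}_{2n}$, $\mathrm{G}_n(\mathbb H^{2n})$, $\mathrm{Sp}_n$. All spaces carry submanifold metrics. Path spaces. $\Omega(M;p,q)$ is the space of piecewise smooth paths $\gamma:[0,1]\to M$ from $p$ to $q$. If $Q$ is an s-centriole of $(P,o)$ relative to the pole $p$, the canonical map $Q\to\Omega(P;o,p)$ sends $x\in Q$ to the unique shortest geodesic segment $[0,1]\to P$ from $o$ to $p$ with midpoint $x$. The maps $\tilde\jmath_{\ell+1}$, $\bar\jmath_{\ell+1}$ are these canonical maps for $\tilde P_{\ell+1}\subset\tilde P_\ell$ and $\bar P_{\ell+1}\subset\bar P_\ell$. *)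

(* Defs.v *)
From mathcomp Require Import all_boot all_order all_algebra.
From mathcomp Require Import all_classical all_reals all_analysis.
From mathcomp Require Import complex.
Set Implicit Arguments.
Unset Strict Implicit.
Unset Printing Implicit Defensive.
Import Order.TTheory GRing.Theory Num.Theory.
Import numFieldNormedType.Exports.
Local Open Scope classical_set_scope.
Local Open Scope ring_scope.

(* Naming the closed field (instead of writing R[i] in types) lets matrices
   over it inherit the product topology given by the complex modulus. *)
Definition Cplx (R : realType) : numClosedFieldType := R[i].

(* All spaces below are subsets of the complex (r + r) x (r + r) matrices. *)
Section Groups.
Variables (R : realType) (r : nat).
Local Notation C := (Cplx R).
Local Notation M := ('M[C]_(r + r)).

Definition Sp_set : set M :=
  [set X | X \is unitarymx /\
     exists A B : 'M[C]_r,
       X = block_mx A (- map_mx Num.conj B) B (map_mx Num.conj A)].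

Definition U_set : set M :=
  [set X | Sp_set X /\
     exists A : 'M[C]_r,
       A \is unitarymx /\ X = block_mx A 0 0 (map_mx Num.conj A)].

(* SO_r inside U_r inside Sp_r: a real A is its own conjugate. *)
Definition SO_set : set M :=
  [set X | exists A : 'M[R]_r, [/\ A *m A^T = 1%:M, \det A = 1 &
     X = block_mx (map_mx (real_complex R) A) 0
                  0 (map_mx (real_complex R) A)]].

Definition A_mx : M := block_mx ('i%:M) 0 0 (- ('i%:M)).

Definition tau (X : M) : M := A_mx *m X *m invmx A_mx.

End Groups.

Definition fixed_set (T : Type) (s : T -> T) (A : set T) : set T :=
  [set x | A x /\ s x = x].

Definition set_incl (T : Type) (A B : set T) (AB : A `<=` B) (x : A) : B :=
  SigSub (mem_set (AB (\val x) (set_mem (valP x)))).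

Definition is_component (T : topologicalType) (S Q : set T) : Prop :=
  exists2 x, S x & Q = connected_component S x.

(* Riemannian geometry of submanifolds P of the unitary group U_m, viewed in
   the real vector space of complex m x m matrices. *)
Section Geometry.
Variables (R : realType) (m : nat).
Local Notation C := (Cplx R).
Local Notation M := ('M[C]_m).

Definition smooth (g : R -> M) : Prop :=
  forall i j k t,
    derivable (derive1n k (fun s => complex.Re (g s i j))) t 1 /\
    derivable (derive1n k (fun s => complex.Im (g s i j))) t 1.

Definition velocity (g : R -> M) (t : R) : M :=
  \matrix_(i, j) Complex (derive1 (fun s => complex.Re (g s i j)) t)
                         (derive1 (fun s => complex.Im (g s i j)) t).

Definition acceleration (g : R -> M) : R -> M := velocity (velocity g).

(* If g is unitary and X = g x, Y = g y with x, y skew-Hermitian, then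
   inner X Y = - tr (x y) / 2: on U_m this Euclidean inner product restricts to
   the bi-invariant metric.  On U_r, embedded by A |-> diag(A, conj A), the
   restriction is - tr (x y). *)
Definition inner (X Y : M) : R :=
  complex.Re (\tr ((map_mx Num.conj X)^T *m Y)) / 2.

(* Curves defined near 0 only would give the same vectors, by
   reparametrisation. *)
Definition tangent (P : set M) (x : M) : set M :=
  [set v | exists g : R -> M,
     [/\ smooth g, (forall t, P (g t)), g 0 = x & velocity g 0 = v]].

Definition tangent_dim (P : set M) (x : M) (d : nat) : Prop :=
  exists b : 'I_d -> M,
    (forall c : 'I_d -> R,
       \sum_(i < d) real_complex R (c i) *: b i = 0 -> forall i, c i = 0) /\
    tangent P x =
      [set v | exists c : 'I_d -> R,
         v = \sum_(i < d) real_complex R (c i) *: b i].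

(* Dimension of a submanifold P. *)
Definition has_dim (P : set M) (d : nat) : Prop :=
  forall x, P x -> tangent_dim P x d.

(* [top_dim F Q]: Q has the largest dimension among the members of F. *)
Definition top_dim (F : set (set M)) (Q : set M) : Prop :=
  F Q /\ exists2 d, has_dim Q d &
    forall Q' d', F Q' -> has_dim Q' d' -> (d' <= d)%N.

(* The covariant derivative of g' in P, for the submanifold metric, is the
   orthogonal projection of g'' onto the tangent space of P. *)
Definition geodesic (P : set M) (D : set R) (g : R -> M) : Prop :=
  smooth g /\ forall t, D t ->
    P (g t) /\ forall v, tangent P (g t) v -> inner (acceleration g t) v = 0.

Definition unit_itv := {t : R | 0 <= t <= 1}.

Definition itv0 : unit_itv :=
  exist (fun t : R => 0 <= t <= 1) 0 (introT andP (conj (lexx 0) ler01)).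

Definition path01 := unit_itv -> M.

(* Only the values of [extend c] on [0, 1] are meaningful. *)
Definition extend (c : path01) (t : R) : M := c (insubd itv0 t).

Definition midpoint (c : path01) : M := extend c (2^-1).

Definition length (c : path01) : R :=
  \int[lebesgue_measure]_(t in `[0, 1])
     Num.sqrt (inner (velocity (extend c) t) (velocity (extend c) t)).

Definition piecewise_smooth (c : path01) : Prop :=
  exists2 s : seq R, itv_partition 0 1 s &
    forall i, (i < size s)%N ->
      exists2 g : R -> M, smooth g &
        forall t : unit_itv, nth 0 (0 :: s) i <= \val t <= nth 0 s i ->
          c t = g (\val t).

Definition Omega (P : set M) (p q : M) : set path01 :=
  [set c | [/\ piecewise_smooth c, (forall t, P (c t)),
               extend c 0 = p & extend c 1 = q]].

Definition geodesic_segment (P : set M) (p q : M) : set path01 :=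
  [set c | [/\ extend c 0 = p, extend c 1 = q &
     exists2 g, geodesic P `[0, 1] g & forall t, c t = g (\val t)]].

Definition shortest_segment (P : set M) (p q : M) : set path01 :=
  [set c | geodesic_segment P p q c /\
     forall c', geodesic_segment P p q c' -> length c <= length c'].

(* In a complete connected P every point lies on a geodesic through x, so this
   determines s on P. *)
Definition geodesic_symmetry (P : set M) (x : M) (s : M -> M) : Prop :=
  forall g, geodesic P setT g -> g 0 = x -> forall t, s (g t) = g (- t).

Definition pole (P : set M) (o p : M) : Prop :=
  [/\ P p, p <> o & exists s : M -> M,
     geodesic_symmetry P o s /\ geodesic_symmetry P p s].

Definition centrosome (P : set M) (o p : M) : set M :=
  [set midpoint c | c in geodesic_segment P o p].

Definition centriole (P : set M) (o p : M) : set (set M) :=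
  [set Q | pole P o p /\ is_component (centrosome P o p) Q].

Definition s_centriole (P : set M) (o p : M) : set (set M) :=
  [set Q | centriole P o p Q /\
     exists2 c, shortest_segment P o p c & Q (midpoint c)].

Definition is_canonical_map (Q P : set M) (o p : M) (j : Q -> Omega P o p) :
  Prop :=
  forall (x : Q) (c : path01),
    shortest_segment P o p c /\ midpoint c = \val x <-> c = \val (j x).

End Geometry.

Section BottChains.
Variables (R : realType) (r : nat).
Local Notation M := ('M[Cplx R]_(r + r)).

Definition base_points (P : nat -> set M) (J : nat -> M) : Prop :=
  let anti k := [set X | P k X /\ X *m J k = - (J k *m X)] in
  [/\ P 0%N = @SO_set R r /\ J 0%N = 1%:M,
      is_component [set X | @SO_set R r X /\ X *m X = - 1%:M] (P 1%N),
      forall k, (1 <= k <= 6)%N -> top_dim (is_component (anti k)) (P k.+1),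
      is_component (anti 7%N) (P 8%N) &
      forall k, (1 <= k <= 8)%N -> P k (J k)].

Definition U_Bott_chain (J : nat -> M) (P : nat -> set M) : Prop :=
  P 0%N = @U_set R r /\
  forall k, (k <= 7)%N ->
    top_dim (s_centriole (P k) (J k) (- J k)) (P k.+1).

Definition Sp_Bott_chain (J : nat -> M) (P : nat -> set M) : Prop :=
  P 0%N = @Sp_set R r /\
  forall k, (k <= 7)%N ->
    s_centriole (P k) (J k) (- J k) (P k.+1) /\ P k.+1 (J k.+1).

End BottChains.

(* Main.v *)
(** [Sp_r] consists of the unitary matrices [X] with [X K = K conj(X)], and [U_r]
    of those commuting with [A_r].  A geodesic issuing from [o] is
    [t |-> o exp(t a)]; if it ends at [- o], the eigenvalues of [a] are odd
    multiples of [i pi], and it is shortest exactly when they are all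
    [+ i pi] or [- i pi], in which case it is [cos (pi t) o + sin (pi t) x]
    with midpoint [x].  So the centrosome is cut out by [x o^-1 x = - o], the
    canonical maps do not depend on the ambient space, and by induction the
    [k]-th spaces of both chains are components of
    [{X | X^2 = - 1, X anticommutes with J_1, ..., J_(k-1)}] in [Sp] and [U].

    What remains is that the top-dimensional component on the [U] side is the one
    containing [J_k].  Regarding [U_r] as [r x r] matrices, let [w] be the product
    of [J_1, ..., J_(k-1), x].  The complexified tangent space at [x] is the
    image of an averaging projection, whose trace gives the dimension
    [(r^2 - |tr w|^2) / 2^k].  The trace of [w] takes discrete values, hence is
    constant on components.  Conversely two points with equal trace are
    connected: contract the eigenvalues of [J^-1 x] different from [-1] to [1],
    and then rotate the remaining reflection away, using the averaging projection
    on its support to find the generator of a rotation.  Since [tr w = 0] at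
    [x = J_k], the component of [J_k] is the unique one of top dimension. *)

Require Import Defs.
From mathcomp Require Import all_boot all_order all_algebra.
From mathcomp Require Import all_classical all_reals all_analysis.
From mathcomp Require Import complex spectral zify ring lra.
Set Implicit Arguments.
Unset Strict Implicit.
Unset Printing Implicit Defensive.
Import Order.TTheory GRing.Theory Num.Theory.
Import numFieldNormedType.Exports.
Local Open Scope classical_set_scope.
Local Open Scope ring_scope.

(** No manifold structure is ever built. Of a member [P] of a chain only [saturated] is used: [P]
    lies in a [cliffset], and every connected subset of that [cliffset] meeting [P] lies in [P].
    This suffices because all curves needed are explicit and stay in the [cliffset]. That geodesics
    are exponentials rests on an orthogonality argument: the left-translated velocity has a
    derivative that is again tangent, so the geodesic equation makes this derivative orthogonal to
    itself. Commutation, anticommutation and conjugation relations all pass to exponentials through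
    one lemma, [dgmx_intertwine]. The two chains differ in one respect that shapes the second half.
    The [Sp] chain prescribes that [J k.+1] lies in the next space; the [U] chain prescribes only a
    dimension, and membership of [J k.+1] has to be derived from it. Since tangent spaces are real
    and the trace count is complex, skew-Hermitian matrices serve as a real form to pass between
    them. In the connecting argument, equality of traces says that [w] has trace zero on the support
    of the reflection; the averaging operator there has the squared rank as its trace, so it is
    nonzero. *)

Section ComplexScalars.
Variable R : realType.
Local Notation C := (Cplx R).
Implicit Types z w : C.

Lemma complexP z w : complex.Re z = complex.Re w ->
  complex.Im z = complex.Im w -> z = w.
Proof. by case: z => a b; case: w => c d /= -> ->. Qed.

Lemma ReD z w : complex.Re (z + w) = complex.Re z + complex.Re w.
Proof. by case: z; case: w. Qed.

Lemma ImD z w : complex.Im (z + w) = complex.Im z + complex.Im w.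
Proof. by case: z; case: w. Qed.

Lemma ReN z : complex.Re (- z) = - complex.Re z.
Proof. by case: z. Qed.

Lemma ImN z : complex.Im (- z) = - complex.Im z.
Proof. by case: z. Qed.

Lemma ReM z w : complex.Re (z * w) =
  complex.Re z * complex.Re w - complex.Im z * complex.Im w.
Proof. by case: z; case: w. Qed.

Lemma ImM z w : complex.Im (z * w) =
  complex.Re z * complex.Im w + complex.Im z * complex.Re w.
Proof. by case: z; case: w. Qed.

Lemma ReJ z : complex.Re (Num.conj z) = complex.Re z.
Proof. by case: z. Qed.

Lemma ImJ z : complex.Im (Num.conj z) = - complex.Im z.
Proof. by case: z. Qed.

Lemma Re_sum I (r : seq I) (p : pred I) (F : I -> C) :
  complex.Re (\sum_(i <- r | p i) F i) = \sum_(i <- r | p i) complex.Re (F i).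
Proof. by elim/big_rec2: _ => // i x y _ <-; rewrite ReD. Qed.

Lemma Im_sum I (r : seq I) (p : pred I) (F : I -> C) :
  complex.Im (\sum_(i <- r | p i) F i) = \sum_(i <- r | p i) complex.Im (F i).
Proof. by elim/big_rec2: _ => // i x y _ <-; rewrite ImD. Qed.

End ComplexScalars.

(** * Conjugate transposes and unitary matrices *)

Section Adjoint.
Variable C : numClosedFieldType.

Definition adjmx m n (A : 'M[C]_(m, n)) : 'M[C]_(n, m) := (map_mx Num.conj A)^T.

Lemma adjmxE m n (A : 'M[C]_(m, n)) i j : adjmx A i j = Num.conj (A j i).
Proof. by rewrite !mxE. Qed.

Lemma adjmxK m n (A : 'M[C]_(m, n)) : adjmx (adjmx A) = A.
Proof. by apply/matrixP => i j; rewrite !adjmxE conjCK. Qed.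

Lemma adjmxM m n p (A : 'M[C]_(m, n)) (B : 'M[C]_(n, p)) :
  adjmx (A *m B) = adjmx B *m adjmx A.
Proof. by rewrite /adjmx map_mxM trmx_mul. Qed.

Lemma adjmxD m n (A B : 'M[C]_(m, n)) : adjmx (A + B) = adjmx A + adjmx B.
Proof. by apply/matrixP => i j; rewrite !(mxE, adjmxE) rmorphD. Qed.

Lemma adjmxN m n (A : 'M[C]_(m, n)) : adjmx (- A) = - adjmx A.
Proof. by apply/matrixP => i j; rewrite !(mxE, adjmxE) rmorphN. Qed.

Lemma adjmxZ m n a (A : 'M[C]_(m, n)) : adjmx (a *: A) = Num.conj a *: adjmx A.
Proof. by apply/matrixP => i j; rewrite !(mxE, adjmxE) rmorphM. Qed.

Lemma adjmx1 m : adjmx (1%:M : 'M[C]_m) = 1%:M.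
Proof.
by apply/matrixP => i j; rewrite adjmxE !mxE eq_sym; case: eqP => _;
  rewrite ?rmorph1 ?rmorph0.
Qed.

Lemma mxtrace_adj m (A : 'M[C]_m) : \tr (adjmx A) = Num.conj (\tr A).
Proof. by rewrite /mxtrace rmorph_sum; apply: eq_bigr => i _;
  rewrite adjmxE. Qed.

Lemma unitaryP m (A : 'M[C]_m) : (A \is unitarymx) <-> (A *m adjmx A = 1%:M).
Proof. by split; [move/unitarymxP | move=> H; apply/unitarymxP];
  rewrite -?map_trmx. Qed.

Lemma unitaryP' m (A : 'M[C]_m) : (A \is unitarymx) <-> (adjmx A *m A = 1%:M).
Proof. by rewrite unitaryP; split; exact: mulmx1C. Qed.

Lemma mulmxAadj m (A B : 'M[C]_m) : A \is unitarymx -> A *m (adjmx A *m B) = B.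
Proof. by move/unitaryP => H; rewrite mulmxA H mul1mx. Qed.

Lemma mulmxadjA m (A B : 'M[C]_m) : A \is unitarymx -> adjmx A *m (A *m B) = B.
Proof. by move/unitaryP' => H; rewrite mulmxA H mul1mx. Qed.

Lemma unitary_adj m (A : 'M[C]_m) : A \is unitarymx -> adjmx A \is unitarymx.
Proof. by move/unitaryP' => H; apply/unitaryP; rewrite adjmxK. Qed.

Lemma unitary_conj m (A : 'M[C]_m) :
  A \is unitarymx -> map_mx Num.conj A \is unitarymx.
Proof. by move/unitaryP => H; apply/unitaryP;
 rewrite /adjmx map_trmx -map_mxM H map_mx1. Qed.

Lemma unitary1 m : (1%:M : 'M[C]_m) \is unitarymx.
Proof. by apply/unitaryP; rewrite adjmx1 mul1mx. Qed.

Lemma conj_mxK m n (A : 'M[C]_(m, n)) : map_mx Num.conj (map_mx Num.conj A) = A.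
Proof. by apply/matrixP => i j; rewrite !mxE conjCK. Qed.

Lemma conj_mxM m n p (A : 'M[C]_(m, n)) (B : 'M[C]_(n, p)) :
  map_mx Num.conj (A *m B) = map_mx Num.conj A *m map_mx Num.conj B.
Proof. exact: map_mxM. Qed.

Lemma conj_mxD m n (A B : 'M[C]_(m, n)) :
  map_mx Num.conj (A + B) = map_mx Num.conj A + map_mx Num.conj B.
Proof. exact: map_mxD. Qed.

Lemma conj_mxZ m n a (A : 'M[C]_(m, n)) :
  map_mx Num.conj (a *: A) = Num.conj a *: map_mx Num.conj A.
Proof. exact: map_mxZ. Qed.

End Adjoint.

(** * Real derivatives of complex and matrix curves *)

Section Calculus.
Variable R : realType.
Local Notation C := (Cplx R).

(** Componentwise, to match [smooth] and [velocity], which mention only real and imaginary parts;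
    relational, so that derivatives can be composed before their values are simplified. *)
Definition cderiv (f : R -> C) (t : R) (v : C) : Prop :=
  is_derive t (1 : R) (fun s => complex.Re (f s)) (complex.Re v) /\
  is_derive t (1 : R) (fun s => complex.Im (f s)) (complex.Im v).

Lemma cderiv_cst (c : C) t : cderiv (fun=> c) t 0.
Proof. by split; exact: is_derive_cst. Qed.

Lemma cderivD f g t v w : cderiv f t v -> cderiv g t w ->
  cderiv (fun s => f s + g s) t (v + w).
Proof.
move=> [f1 f2] [g1 g2]; split.
- under eq_fun do rewrite ReD; rewrite ReD; exact: is_deriveD.
- under eq_fun do rewrite ImD; rewrite ImD; exact: is_deriveD.
Qed.

Lemma cderivN f t v : cderiv f t v -> cderiv (fun s => - f s) t (- v).
Proof.
move=> [f1 f2]; split.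
- under eq_fun do rewrite ReN; rewrite ReN; exact: is_deriveN.
- under eq_fun do rewrite ImN; rewrite ImN; exact: is_deriveN.
Qed.

Lemma cderivM f g t v w : cderiv f t v -> cderiv g t w ->
  cderiv (fun s => f s * g s) t (v * g t + f t * w).
Proof.
move=> [f1 f2] [g1 g2]; split.
- under eq_fun do rewrite ReM.
  have -> : complex.Re (v * g t + f t * w) =
    (complex.Re (f t) * complex.Re w + complex.Re (g t) * complex.Re v)
    - (complex.Im (f t) * complex.Im w + complex.Im (g t) * complex.Im v).
    by rewrite ReD !ReM; ring.
  by apply: is_deriveB; exact: is_deriveM.
- under eq_fun do rewrite ImM.
  have -> : complex.Im (v * g t + f t * w) =
    (complex.Re (f t) * complex.Im w + complex.Im (g t) * complex.Re v)
    + (complex.Im (f t) * complex.Re w + complex.Re (g t) * complex.Im v).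
    by rewrite ImD !ImM; ring.
  by apply: is_deriveD; exact: is_deriveM.
Qed.

Lemma cderivJ f t v : cderiv f t v ->
  cderiv (fun s => Num.conj (f s)) t (Num.conj v).
Proof.
move=> [f1 f2]; split.
- under eq_fun do rewrite ReJ; rewrite ReJ; exact: f1.
- under eq_fun do rewrite ImJ; rewrite ImJ; exact: is_deriveN.
Qed.

Lemma cderiv_sum n (F : 'I_n -> R -> C) t (V : 'I_n -> C) :
  (forall i, cderiv (F i) t (V i)) ->
  cderiv (fun s => \sum_i F i s) t (\sum_i V i).
Proof.
elim: n F V => [|n IH] F V H.
  under eq_fun do rewrite big_ord0; rewrite big_ord0; exact: cderiv_cst.
under eq_fun do rewrite big_ord_recl; rewrite big_ord_recl.
by apply: cderivD => //; apply: IH => i; exact: H.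
Qed.

Lemma cderiv_unique f t v w : cderiv f t v -> cderiv f t w -> v = w.
Proof.
move=> [f1 f2] [g1 g2]; apply: complexP.
- by rewrite -(@derive_val _ _ _ _ _ _ _ f1) -(@derive_val _ _ _ _ _ _ _ g1).
- by rewrite -(@derive_val _ _ _ _ _ _ _ f2) -(@derive_val _ _ _ _ _ _ _ g2).
Qed.

Lemma cderiv_near f g t v : (\near t, f t = g t) ->
  cderiv f t v -> cderiv g t v.
Proof.
move=> fg [f1 f2]; split.
- apply: near_eq_is_derive f1.
  by near=> s; congr complex.Re; near: s.
- apply: near_eq_is_derive f2.
  by near=> s; congr complex.Im; near: s.
Unshelve. all: by end_near. Qed.

(** The mean value theorem asks for the derivative inside the interval only. This matters because a
    curve constrained on [[0, 1]] satisfies differentiated relations at interior times alone. *)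
Lemma real_cst01 (f df : R -> R) :
  (forall t, is_derive t (1 : R) f (df t)) ->
  (forall t, 0 < t < 1 -> df t = 0) ->
  forall t, 0 <= t <= 1 -> f t = f 0.
Proof.
move=> fd d0 t /andP[t0 t1].
have [->//|tn0] := eqVneq t 0.
have tp : 0 < t by rewrite lt_neqAle eq_sym tn0.
have fc : {within `[0, t], continuous f}.
  apply: derivable_within_continuous => x _.
  by have := fd x; case.
have [x xI E] := MVT tp (fun x _ => fd x) fc.
move: E; rewrite d0 ?mul0r; first by move/eqP; rewrite subr_eq0 => /eqP.
move: xI; rewrite in_itv /= => /andP[-> xt]; exact: lt_le_trans xt t1.
Qed.

Lemma cderiv_cst01 (f df : R -> C) : (forall t, cderiv f t (df t)) ->
  (forall t, 0 < t < 1 -> df t = 0) ->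
  forall t, 0 <= t <= 1 -> f t = f 0.
Proof.
move=> fd d0 t tI; apply: complexP.
- apply: (@real_cst01 (fun s => complex.Re (f s))
    (fun s => complex.Re (df s))) => // [s|s sI]; first by have [] := fd s.
  by rewrite d0.
- apply: (@real_cst01 (fun s => complex.Im (f s))
    (fun s => complex.Im (df s))) => // [s|s sI]; first by have [] := fd s.
  by rewrite d0.
Qed.

Variable m : nat.
Local Notation M := ('M[C]_m).

Definition mderiv (g : R -> M) (t : R) (V : M) : Prop :=
  forall i j, cderiv (fun s => g s i j) t (V i j).

Lemma mderiv_cst (A : M) t : mderiv (fun=> A) t 0.
Proof. by move=> i j; rewrite mxE; exact: cderiv_cst. Qed.

Lemma mderivN f t V : mderiv f t V -> mderiv (fun s => - f s) t (- V).
Proof.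
by move=> H i j; under eq_fun do rewrite mxE; rewrite mxE; exact: cderivN.
Qed.

Lemma mderivM f g t V W : mderiv f t V -> mderiv g t W ->
  mderiv (fun s => f s *m g s) t (V *m g t + f t *m W).
Proof.
move=> H K i j; under eq_fun do rewrite mxE; rewrite !mxE -big_split /=.
by apply: cderiv_sum => k; exact: cderivM.
Qed.

Lemma mderivJ f t V : mderiv f t V ->
  mderiv (fun s => map_mx Num.conj (f s)) t (map_mx Num.conj V).
Proof.
by move=> H i j; under eq_fun do rewrite mxE; rewrite mxE; exact: cderivJ.
Qed.

Lemma mderiv_adj f t V : mderiv f t V ->
  mderiv (fun s => adjmx (f s)) t (adjmx V).
Proof.
by move=> H i j; under eq_fun do rewrite adjmxE; rewrite adjmxE; exact: cderivJ.
Qed.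

Lemma mderiv_unique f t V W : mderiv f t V -> mderiv f t W -> V = W.
Proof. by move=> H K; apply/matrixP => i j; exact: (cderiv_unique (H i j)). Qed.

Lemma mderiv_near f g t V : (\near t, f t = g t) -> mderiv f t V ->
  mderiv g t V.
Proof.
move=> fg H i j; apply: cderiv_near (H i j).
by near=> s; congr (fun_of_matrix _ i j); near: s.
Unshelve. all: by end_near. Qed.

Lemma mderiv_cst01 (f df : R -> M) : (forall t, mderiv f t (df t)) ->
  (forall t, 0 < t < 1 -> df t = 0) ->
  forall t, 0 <= t <= 1 -> f t = f 0.
Proof.
move=> fd d0 t tI; apply/matrixP => i j.
apply: (@cderiv_cst01 (fun s => f s i j) (fun s => df s i j)) => // [s|s sI].
  exact: fd.
by rewrite d0 // mxE.
Qed.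

Lemma near01 (t : R) (Q : R -> Prop) : 0 < t < 1 ->
  (forall s, 0 <= s <= 1 -> Q s) -> \near t, Q t.
Proof.
move=> /andP[t0 t1] H; near=> s; apply: H; apply/andP; split; apply: ltW.
- by near: s; exact: lt_nbhsr.
- by near: s; exact: lt_nbhsl.
Unshelve. all: by end_near. Qed.

Lemma derivable_derive1 (f : R -> R) t :
  derivable f t 1 -> is_derive t (1 : R) f (derive1 f t).
Proof. by move=> H; rewrite derive1E; exact: derivableP. Qed.

Lemma smooth_velocity (g : R -> M) t : smooth g -> mderiv g t (velocity g t).
Proof.
move=> sg i j; rewrite mxE; have [d1 d2] := sg i j 0%N t.
split; [exact: derivable_derive1 d1 | exact: derivable_derive1 d2].
Qed.

Lemma smooth_acceleration (g : R -> M) t :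
  smooth g -> mderiv (velocity g) t (acceleration g t).
Proof.
move=> sg i j; rewrite mxE; have [d1 d2] := sg i j 1%N t.
have E1 : (fun s => complex.Re (velocity g s i j)) =
  derive1 (fun s => complex.Re (g s i j)).
  by apply/funext => s; rewrite mxE.
have E2 : (fun s => complex.Im (velocity g s i j)) =
  derive1 (fun s => complex.Im (g s i j)).
  by apply/funext => s; rewrite mxE.
split; rewrite ?E1 ?E2.
- exact: derivable_derive1 d1.
- exact: derivable_derive1 d2.
Qed.

Lemma velocityE (g : R -> M) t V : mderiv g t V -> velocity g t = V.
Proof.
move=> H; apply/matrixP => i j; rewrite mxE; have [d1 d2] := H i j.
by apply: complexP; rewrite [LHS]derive1E derive_val.
Qed.

End Calculus.

(** * Functional calculus of normal matrices *)

Section SpectralCalculus.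
Variable C : numClosedFieldType.
Variable m : nat.
Implicit Types (V A b : 'M[C]_m) (f g : 'I_m -> C).

(** The functional calculus [V^* diag(f) V]; as an entrywise sum it can be differentiated and
    conjugated term by term. *)
Definition dgmx V f : 'M[C]_m :=
  \matrix_(i, j) \sum_k Num.conj (V k i) * f k * V k j.

Lemma dgmxE V f i j : dgmx V f i j = \sum_k Num.conj (V k i) * f k * V k j.
Proof. by rewrite mxE. Qed.

Lemma dgmx_diag V f : dgmx V f = adjmx V *m diag_mx (\row_j f j) *m V.
Proof.
apply/matrixP => i j; rewrite dgmxE mxE; apply: eq_bigr => k _.
by rewrite mul_mx_diag !mxE.
Qed.

Lemma dgmxD V f g : dgmx V f + dgmx V g = dgmx V (fun k => f k + g k).
Proof.
apply/matrixP => i j; rewrite mxE !dgmxE -big_split /=.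
by apply: eq_bigr => k _; ring.
Qed.

Lemma dgmxZ V c f : c *: dgmx V f = dgmx V (fun k => c * f k).
Proof.
apply/matrixP => i j; rewrite mxE !dgmxE mulr_sumr.
by apply: eq_bigr => k _; ring.
Qed.

Lemma dgmxN V f : - dgmx V f = dgmx V (fun k => - f k).
Proof. by rewrite -scaleN1r dgmxZ; congr dgmx; apply/funext => k; ring. Qed.

Lemma dgmxM V f g : V \is unitarymx ->
  dgmx V f *m dgmx V g = dgmx V (fun k => f k * g k).
Proof.
move=> Vu; rewrite !dgmx_diag -!mulmxA; congr (_ *m _).
rewrite mulmxAadj // !mulmxA mulmx_diag; congr (diag_mx _ *m _).
by apply/rowP => k; rewrite !mxE.
Qed.

Lemma dgmx1 V : V \is unitarymx -> dgmx V (fun=> 1) = 1%:M.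
Proof.
move=> /unitaryP' Vu; rewrite dgmx_diag.
have -> : (\row_j (fun=> 1 : C) j) = const_mx 1 :> 'rV[C]_m.
  by apply/rowP => k; rewrite !mxE.
by rewrite diag_const_mx mulmx1.
Qed.

Lemma adj_dgmx V f : adjmx (dgmx V f) = dgmx V (fun k => Num.conj (f k)).
Proof.
apply/matrixP => i j; rewrite adjmxE !dgmxE rmorph_sum; apply: eq_bigr => k _.
by rewrite /= !rmorphM /= conjCK; ring.
Qed.

Lemma conj_dgmx V f :
  map_mx Num.conj (dgmx V f) =
    dgmx (map_mx Num.conj V) (fun k => Num.conj (f k)).
Proof.
apply/matrixP => i j; rewrite mxE !dgmxE rmorph_sum; apply: eq_bigr => k _.
by rewrite /= !rmorphM !mxE.
Qed.

Lemma trace_dgmx V f : V \is unitarymx -> \tr (dgmx V f) = \sum_k f k.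
Proof.
move=> /unitaryP Vu;
  rewrite dgmx_diag mxtrace_mulC mulmxA Vu mul1mx mxtrace_diag.
by apply: eq_bigr => k _; rewrite mxE.
Qed.

Lemma dgmx_inj V f g : V \is unitarymx -> dgmx V f = dgmx V g -> f = g.
Proof.
move=> Vu /(congr1 (fun X => V *m X *m adjmx V)); rewrite !dgmx_diag -!mulmxA.
rewrite !mulmxAadj // (unitaryP V).1 // !mulmx1 => /matrixP E.
by apply/funext => k; have := E k k; rewrite !mxE eqxx !mulr1n.
Qed.

Lemma dgmx_unitary V f : V \is unitarymx ->
  (forall k, f k * Num.conj (f k) = 1) -> dgmx V f \is unitarymx.
Proof.
move=> Vu H; apply/unitaryP; rewrite adj_dgmx dgmxM //.
by rewrite (_ : (fun k => _) = fun=> 1) ?dgmx1 //; apply/funext => k.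
Qed.

(* [V b V'^*] is supported on the entries [(k, l)] with [f k = f' l]. *)
Lemma dgmx_intertwine V V' f f' g g' b :
  V \is unitarymx -> V' \is unitarymx ->
  dgmx V f *m b = b *m dgmx V' f' ->
  (forall k l, f k = f' l -> g k = g' l) ->
  dgmx V g *m b = b *m dgmx V' g'.
Proof.
move=> Vu V'u E H; have [b' bE] : exists b', b = adjmx V *m b' *m V'.
  exists (V *m b *m adjmx V').
  by rewrite -!mulmxA (unitaryP' V').1 // mulmx1 mulmxadjA.
have key h h' : (dgmx V h *m b = b *m dgmx V' h') <->
    (forall k l, h k * b' k l = b' k l * h' l).
  have -> : dgmx V h *m b = adjmx V *m (diag_mx (\row_j h j) *m b') *m V'.
    by rewrite dgmx_diag bE -!mulmxA mulmxAadj.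
  have -> : b *m dgmx V' h' = adjmx V *m (b' *m diag_mx (\row_j h' j)) *m V'.
    by rewrite dgmx_diag bE -!mulmxA mulmxAadj.
  have aux (X : 'M[C]_m) k l : (diag_mx (\row_j h j) *m X) k l = h k * X k l.
    by rewrite mul_diag_mx !mxE.
  have aux' (X : 'M[C]_m) k l : (X *m diag_mx (\row_j h' j)) k l = X k l * h' l.
    by rewrite mul_mx_diag !mxE.
  split=> [/(congr1 (fun X => V *m X *m adjmx V'))|K].
    rewrite -!mulmxA (unitaryP V').1 // !mulmx1 !mulmxAadj // => /matrixP K k l.
    by have := K k l; rewrite aux aux'.
  by congr (_ *m _ *m _); apply/matrixP => k l; rewrite aux aux'.
apply/key => k l; move/key/(_ k l): E => E.
have [->|bn0] := eqVneq (b' k l) 0; first by rewrite mulr0 mul0r.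
by rewrite mulrC (H k l) //; apply: (mulfI bn0); rewrite -E mulrC.
Qed.

Lemma normal_spectral A : A *m adjmx A = adjmx A *m A ->
  exists V l, V \is unitarymx /\ A = dgmx V l.
Proof.
move=> E; have An : A \is normalmx.
  by apply/normalmxP; move: E; rewrite /adjmx map_trmx.
exists (spectralmx A), (fun k => spectral_diag A 0 k).
split; first exact: spectral_unitarymx.
have := An => /orthomx_spectralP; rewrite invmx_unitary ?spectral_unitarymx //.
rewrite dgmx_diag /adjmx map_trmx => AE; rewrite {1}AE;
  congr (_ *m diag_mx _ *m _).
by apply/rowP => k; rewrite mxE.
Qed.

Lemma unitary_spectral A : A \is unitarymx ->
  exists V l, [/\ V \is unitarymx, A = dgmx V l &
    forall k, l k * Num.conj (l k) = 1].
Proof.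
move=> Au; have [|V [l [Vu AE]]] := @normal_spectral A.
  by rewrite (unitaryP A).1 // (unitaryP' A).1.
exists V, l; split=> // k; have := (unitaryP A).1 Au.
rewrite AE adj_dgmx dgmxM // -(dgmx1 Vu) => /dgmx_inj => /(_ Vu).
by move/(congr1 (fun h => h k)).
Qed.

End SpectralCalculus.

(** * The unit circle and a branch of the argument *)

Section ComplexExponential.
Variable R : realType.
Local Notation C := (Cplx R).

Definition expi (s : R) : C := Complex (cos s) (sin s).
Definition imag (s : R) : C := Complex 0 s.

Lemma expiD s t : expi (s + t) = expi s * expi t.
Proof. by apply: complexP; rewrite ?ReM ?ImM /= ?cosD ?sinD //; ring. Qed.

Lemma expi0 : expi 0 = 1.
Proof. by apply: complexP; rewrite /= ?cos0 ?sin0. Qed.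

Lemma conj_expi s : Num.conj (expi s) = expi (- s).
Proof. by apply: complexP; rewrite ?ReJ ?ImJ /= ?cosN ?sinN. Qed.

Lemma expi_norm s : expi s * Num.conj (expi s) = 1.
Proof. by rewrite conj_expi -expiD subrr expi0. Qed.

Lemma imagN s : imag (- s) = - imag s.
Proof. by apply: complexP; rewrite ?ReN ?ImN /= ?oppr0. Qed.

Lemma conj_imag s : Num.conj (imag s) = - imag s.
Proof. by apply: complexP; rewrite ?ReN ?ImN ?ReJ ?ImJ /= ?oppr0. Qed.

Lemma imag_inj : injective imag.
Proof. by move=> s t []. Qed.

Definition arg (z : C) : R :=
  if 0 <= complex.Im z then acos (complex.Re z) else - acos (complex.Re z).

Lemma norm1_ReIm (z : C) : z * Num.conj z = 1 ->
  complex.Re z ^+ 2 + complex.Im z ^+ 2 = 1.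
Proof.
by move=> /(congr1 (@complex.Re R)); rewrite ReM ReJ ImJ /= => <-; ring.
Qed.

Lemma expi_arg (z : C) : z * Num.conj z = 1 -> expi (arg z) = z.
Proof.
move=> /norm1_ReIm E.
have ReI : -1 <= complex.Re z <= 1.
  by rewrite -ler_norml -(@expr_le1 _ 2) // real_normK ?num_real //;
     rewrite -E lerDl sqr_ge0.
have sE : Num.sqrt (1 - complex.Re z ^+ 2) = `|complex.Im z|.
  by rewrite -E addrAC subrr add0r sqrtr_sqr.
apply: complexP; rewrite /= /arg; case: ifPn => Im0.
- by rewrite acosK // in_itv.
- by rewrite cosN acosK // in_itv.
- by rewrite sin_acos // sE ger0_norm.
- by rewrite sinN sin_acos // sE ltr0_norm ?opprK // ltNge.
Qed.

(** At -1 the rule fails: this point is its own conjugate and has angle [pi]. Hence the separate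
    treatment of that eigenvalue in [eigen_retract]. *)
Lemma arg_conj (z : C) : z * Num.conj z = 1 -> z != -1 ->
  arg (Num.conj z) = - arg z.
Proof.
move=> /norm1_ReIm E zn1; rewrite /arg ReJ ImJ oppr_ge0.
case: (ltrgtP (complex.Im z) 0) => Im0; rewrite ?opprK //.
have /eqP : complex.Re z ^+ 2 = 1 ^+ 2 by rewrite expr1n -E Im0 expr0n addr0.
rewrite eqf_sqr => /orP[/eqP ->|/eqP Re1]; first by rewrite acos1 oppr0.
case/eqP: zn1; apply: complexP; rewrite ?ReN ?ImN /= ?oppr0 //.
Qed.

End ComplexExponential.

(** * One-parameter groups and great-circle rotations *)

Section TrigonometricCurves.
Variable R : realType.
Local Notation C := (Cplx R).

(** Closed under differentiation and rich enough for the entries of [expcurve] and [rotation], so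
    smoothness of every order follows from one derivative formula. *)
Definition trigsum (f : R -> R) : Prop :=
  exists n (a b w : 'I_n -> R),
    f = fun t => \sum_k (a k * cos (w k * t) + b k * sin (w k * t)).

Lemma is_derive_cosM (w t : R) :
  is_derive t (1 : R) (fun s => cos (w * s)) (- (w * sin (w * t))).
Proof.
have H : is_derive t (1 : R) (fun s => w * s) w.
  by apply: is_derive_eq; rewrite scaler1.
have := is_derive1_comp (is_derive_cos (w * t)) H.
by move=> K; apply: is_derive_eq; rewrite mulrC mulrN.
Qed.

Lemma is_derive_sinM (w t : R) :
  is_derive t (1 : R) (fun s => sin (w * s)) (w * cos (w * t)).
Proof.
have H : is_derive t (1 : R) (fun s => w * s) w.
  by apply: is_derive_eq; rewrite scaler1.
have := is_derive1_comp (is_derive_sin (w * t)) H.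
by move=> K; apply: is_derive_eq; rewrite mulrC.
Qed.

Lemma is_derive_ord_sum n (F : 'I_n -> R -> R) t (d : 'I_n -> R) :
  (forall k, is_derive t (1 : R) (F k) (d k)) ->
  is_derive t (1 : R) (fun s => \sum_k F k s) (\sum_k d k).
Proof.
elim: n F d => [|n IH] F d H.
  under eq_fun do rewrite big_ord0; rewrite big_ord0; exact: is_derive_cst.
under eq_fun do rewrite big_ord_recl; rewrite big_ord_recl.
by apply: is_deriveD; apply: IH => k; exact: H.
Qed.

Lemma trigsum_derive n (a b w : 'I_n -> R) t :
  is_derive t (1 : R)
    (fun s => \sum_k (a k * cos (w k * s) + b k * sin (w k * s)))
    (\sum_k (b k * w k * cos (w k * t) + (- (a k * w k)) * sin (w k * t))).
Proof.
apply: is_derive_ord_sum => k.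
have -> : b k * w k * cos (w k * t) + - (a k * w k) * sin (w k * t) =
  a k * - (w k * sin (w k * t)) + b k * (w k * cos (w k * t)) by ring.
by apply: is_deriveD; apply: is_deriveZ; [exact: is_derive_cosM |
  exact: is_derive_sinM].
Qed.

Lemma trigsum_derive1n f k : trigsum f -> trigsum (derive1n k f).
Proof.
elim: k => [//|k IH] /IH [n [a [b [w E]]]].
exists n, (fun k => b k * w k), (fun k => - (a k * w k)), w.
rewrite /derive1n iterS -/(derive1n k f) E; apply/funext => t.
by rewrite derive1E (@derive_val _ _ _ _ _ _ _ (trigsum_derive a b w t)).
Qed.

Lemma trigsum_derivable f t : trigsum f -> derivable f t 1.
Proof.
by move=> [n [a [b [w ->]]]]; have [] := trigsum_derive a b w t.
Qed.

Variable m : nat.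
Local Notation M := ('M[C]_m).

Lemma trigsum_smooth (g : R -> M) :
  (forall i j, trigsum (fun s => complex.Re (g s i j)) /\
               trigsum (fun s => complex.Im (g s i j))) -> smooth g.
Proof.
move=> H i j k t; have [H1 H2] := H i j.
by split; apply: trigsum_derivable; apply: trigsum_derive1n.
Qed.

(** The one-parameter group [exp (t a)] of the skew-Hermitian
    [a = dgmx V (fun k => imag (th k))]. *)
Definition expcurve (V : M) (th : 'I_m -> R) (t : R) : M :=
  dgmx V (fun k => expi (th k * t)).

Lemma expcurve_smooth x V th : smooth (fun t => x *m expcurve V th t).
Proof.
apply: trigsum_smooth => i j.
have E t : (x *m expcurve V th t) i j =
    \sum_k ((x *m adjmx V) i k * V k j) * expi (th k * t).
  rewrite /expcurve dgmx_diag !mulmxA mxE; apply: eq_bigr => k _.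
  by rewrite mul_mx_diag !mxE mulrAC.
split.
  exists m, (fun k => complex.Re ((x *m adjmx V) i k * V k j)),
    (fun k => - complex.Im ((x *m adjmx V) i k * V k j)), th.
  apply/funext => t; rewrite E Re_sum; apply: eq_bigr => k _.
  by rewrite [LHS]ReM /= mulNr.
exists m, (fun k => complex.Im ((x *m adjmx V) i k * V k j)),
  (fun k => complex.Re ((x *m adjmx V) i k * V k j)), th.
apply/funext => t; rewrite E Im_sum; apply: eq_bigr => k _.
by rewrite [LHS]ImM /= addrC.
Qed.

Lemma cderiv_expi (w t : R) :
  cderiv (fun s => expi (w * s)) t (expi (w * t) * imag w).
Proof.
split; rewrite ?ReM ?ImM /=.
- rewrite mulr0 sub0r mulrC; exact: is_derive_cosM.
- rewrite mulr0 addr0 mulrC; exact: is_derive_sinM.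
Qed.

Lemma expcurve_deriv V th t : V \is unitarymx ->
  mderiv (expcurve V th) t (expcurve V th t *m dgmx V (fun k => imag (th k))).
Proof.
move=> Vu i j; rewrite /expcurve (dgmxM _ _ Vu).
rewrite [X in cderiv _ _ X]dgmxE.
under eq_fun do rewrite dgmxE.
apply: cderiv_sum => k.
have -> : Num.conj (V k i) * (expi (th k * t) * imag (th k)) * V k j =
  (0 * expi (th k * t) + Num.conj (V k i) * (expi (th k * t) * imag (th k)))
     * V k j + (Num.conj (V k i) * expi (th k * t)) * 0.
  by rewrite mul0r add0r mulr0 addr0.
apply: cderivM; last exact: cderiv_cst.
apply: cderivM; [exact: cderiv_cst | exact: cderiv_expi].
Qed.

Lemma expcurve_unitary V th t : V \is unitarymx ->
  expcurve V th t \is unitarymx.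
Proof. by move=> Vu; apply: dgmx_unitary => // k; exact: expi_norm. Qed.

Lemma expcurve0 V th : V \is unitarymx -> expcurve V th 0 = 1%:M.
Proof.
move=> Vu; rewrite -(dgmx1 Vu); congr dgmx.
by apply/funext => k; rewrite mulr0 expi0.
Qed.

Lemma expcurveD V th s t : V \is unitarymx ->
  expcurve V th (s + t) = expcurve V th s *m expcurve V th t.
Proof.
move=> Vu; rewrite /expcurve (dgmxM _ _ Vu); apply: (f_equal (dgmx V)).
by apply/funext => k; rewrite mulrDr expiD.
Qed.

Lemma skew_spectral (a : M) : adjmx a = - a ->
  exists V th, V \is unitarymx /\ a = dgmx V (fun k => imag (th k)).
Proof.
move=> sk; have [|V [l [Vu aE]]] := @normal_spectral _ _ a.
  by rewrite sk mulmxN mulNmx.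
exists V, (fun k => complex.Im (l k)); split; [exact: Vu|]; rewrite aE;
  apply: (f_equal (dgmx V)).
apply/funext => k; apply: complexP; last by [].
move: sk; rewrite aE adj_dgmx dgmxN => /(dgmx_inj Vu).
move/(congr1 (fun h => complex.Re (h k))); rewrite ReJ ReN => E /=; lra.
Qed.

(** The great circle through [o] and [x], parametrized so that [x] is reached at time 1/2 and [- o]
    at time 1. *)
Definition rotation (o x : M) (t : R) : M :=
  real_complex R (cos (pi * t)) *: o + real_complex R (sin (pi * t)) *: x.

Lemma trigsum_rotation (a b : R) :
  trigsum (fun t => cos (pi * t) * a + sin (pi * t) * b).
Proof.
exists 1%N, (fun=> a), (fun=> b), (fun=> pi).
by apply/funext => t; rewrite big_ord1 (mulrC a) (mulrC b).
Qed.

Lemma rotationE o x t i j : rotation o x t i j =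
  real_complex R (cos (pi * t)) * o i j + real_complex R (sin (pi * t)) * x i j.
Proof. by rewrite !mxE. Qed.

Lemma rotation_smooth o x : smooth (rotation o x).
Proof.
apply: trigsum_smooth => i j; split.
- have := trigsum_rotation (complex.Re (o i j)) (complex.Re (x i j)).
  congr trigsum; apply/funext => t.
  by rewrite rotationE ReD !ReM /= !mul0r !subr0.
- have := trigsum_rotation (complex.Im (o i j)) (complex.Im (x i j)).
  congr trigsum; apply/funext => t.
  by rewrite rotationE ImD !ImM /= !mul0r !addr0.
Qed.

Lemma rotation_deriv o x t :
  mderiv (rotation o x) t (real_complex R pi *: rotation x (- o) t).
Proof.
move=> i j; rewrite mxE rotationE !mxE; split.
- under eq_fun do rewrite rotationE ReD !ReM /= !mul0r !subr0.
  rewrite !(ReM, ReD, ReN, ImM, ImD) /= !mul0r !subr0.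
  have -> : pi * (cos (pi * t) * complex.Re (x i j) +
      sin (pi * t) * - complex.Re (o i j)) =
    complex.Re (o i j) * - (pi * sin (pi * t)) +
    complex.Re (x i j) * (pi * cos (pi * t)) by ring.
  under eq_fun do rewrite ![_ * complex.Re _]mulrC.
  by apply: is_deriveD; apply: is_deriveZ; [exact: is_derive_cosM |
    exact: is_derive_sinM].
- under eq_fun do rewrite rotationE ImD !ImM /= !mul0r !addr0.
  rewrite !(ReM, ReD, ImN, ImM, ImD) /= !mul0r !addr0.
  have -> : pi * (cos (pi * t) * complex.Im (x i j) +
      sin (pi * t) * - complex.Im (o i j)) =
    complex.Im (o i j) * - (pi * sin (pi * t)) +
    complex.Im (x i j) * (pi * cos (pi * t)) by ring.
  under eq_fun do rewrite ![_ * complex.Im _]mulrC.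
  by apply: is_deriveD; apply: is_deriveZ; [exact: is_derive_cosM |
    exact: is_derive_sinM].
Qed.

End TrigonometricCurves.

(** * Continuity and connectedness in spaces of matrices *)

Section MatrixContinuity.
Variable R : realType.
Local Notation C := (Cplx R).

Lemma continuous_complex (f : R -> C) :
  continuous (fun t => complex.Re (f t)) ->
  continuous (fun t => complex.Im (f t)) -> continuous f.
Proof.
move=> fr fi t; apply/cvgrPdist_lt => e e0.
(* In the order of the complex field a positive element has zero imaginary part. *)
have Ee : e = real_complex R (complex.Re e).
  by move: e0; rewrite ltcE => /andP[/eqP Im0 _]; apply: complexP.
have re0 : 0 < complex.Re e by move: e0; rewrite Ee ltcR.
have re20 : 0 < complex.Re e / 2 by rewrite divr_gt0.
have /cvgrPdist_lt /(_ _ re20) H1 := fr t.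
have /cvgrPdist_lt /(_ _ re20) H2 := fi t.
near=> s.
have A1 : `|complex.Re (f t - f s)| < complex.Re e / 2.
  by rewrite ReD ReN; near: s.
have A2 : `|complex.Im (f t - f s)| < complex.Re e / 2.
  by rewrite ImD ImN; near: s.
have -> : f t - f s = real_complex R (complex.Re (f t - f s)) +
  Complex 0 1 * real_complex R (complex.Im (f t - f s)) by exact: complexE.
apply: le_lt_trans (ler_normD _ _) _.
rewrite normrM !normc_def /= expr0n expr1n add0r sqrtr1 mul1r !addr0.
rewrite !sqrtr_sqr Ee -rmorphD ltcR [X in _ < X]splitr.
exact: ltrD.
Unshelve. all: by end_near. Qed.

Lemma continuous_Re : continuous (@complex.Re R : C -> R).
Proof.
move=> z A /nbhs_ballP[e /= e0 HA].
have e0' : 0 < (real_complex R e : C) by rewrite ltcR.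
have H : nbhs z (ball z (real_complex R e : C)) by exact: nbhsx_ballx.
apply: filterS H => w zw; apply: HA; rewrite /ball /= -ReN -ReD -ltcR.
exact: le_lt_trans (normc_ge_Re _) zw.
Qed.

Lemma continuous_mx (T : topologicalType) (U : topologicalType) m n
  (g : T -> 'M[U]_(m, n)) :
  (forall i j, continuous (fun t => g t i j)) -> continuous g.
Proof.
move=> H t A [P HP PA]; rewrite nbhs_filterE.
have : \forall s \near t, forall i j, P i j (g s i j).
  apply: filter_forall => i; apply: filter_forall => j.
  by have := H i j t; apply; exact: HP.
by apply: filterS => s Hs; apply: PA.
Qed.

Lemma mderiv_continuous m (g : R -> 'M[C]_m) :
  (forall t, exists V, mderiv g t V) -> continuous g.
Proof.
move=> H; apply: continuous_mx => i j; apply: continuous_complex => t.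
- have [V /(_ i j)[[d1 _] _]] := H t.
  exact/differentiable_continuous/derivable1_diffP.
- have [V /(_ i j)[_ [d1 _]]] := H t.
  exact/differentiable_continuous/derivable1_diffP.
Qed.

Lemma curve_connected m (g : R -> 'M[C]_m) :
  (forall t, exists V, mderiv g t V) -> connected (range g).
Proof.
move=> /mderiv_continuous gc; apply: connected_continuous_connected.
  by apply/connected_intervalP.
exact: continuous_subspaceT.
Qed.

End MatrixContinuity.

(** * Clifford-type sets of unitary matrices and their linearization *)

Section CliffordSets.
Variables (R : realType) (m : nat).
Local Notation C := (Cplx R).
Local Notation M := ('M[C]_m).
Variables (K : M) (Cs As : set M) (fl : bool).

(* [Sp_r] is the case [K = K_mx], [Cs = As = set0]; adding [A_mx] to [Cs] gives
   [U_r].  The [k]-th spaces of the chains are components of the sets where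
   moreover [As] consists of [J 1, ..., J (k - 1)], and [fl] is [0 < k]. *)
Definition cliffset : set M := [set X | [/\ X \is unitarymx,
  X *m K = K *m map_mx Num.conj X,
  (forall c, Cs c -> X *m c = c *m X),
  (forall b, As b -> X *m b = - (b *m X)) &
  (fl -> X *m X = - 1%:M)]].

(* Left translate by [x^-1] of the tangent space of [cliffset] at [x]. *)
Definition clifftan (x : M) : set M := [set a | [/\ adjmx a = - a,
  a *m K = K *m map_mx Num.conj a,
  (forall c, Cs c -> a *m c = c *m a),
  (forall b, As b -> a *m b = b *m a) &
  (fl -> a *m x = - (x *m a))]].

(** Satisfied by a whole [cliffset] as well as by each of its components, so the group at the start
    of a chain and the later spaces are handled alike. *)
Definition saturated (P : set M) : Prop := P `<=` cliffset /\
  forall x A, P x -> connected A -> A x -> A `<=` cliffset -> A `<=` P.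

(** Each relation for [a] intertwines its spectral decomposition with itself, its negative or its
    conjugate, and so passes to functions of the eigenvalues. Since [a] anticommutes with [x],
    moving [x] past the exponential inverts it, which preserves the square. *)
Lemma expcurve_cliffset x a V th t : cliffset x -> clifftan x a ->
  V \is unitarymx -> a = dgmx V (fun k => imag (th k)) ->
  cliffset (x *m expcurve V th t).
Proof.
move=> [xu xK xC xA xf] [_ aK aC aA af] Vu aE.
have comm b : a *m b = b *m a -> expcurve V th t *m b = b *m expcurve V th t.
  by rewrite aE => E; apply: (dgmx_intertwine Vu Vu E) => k l /imag_inj ->.
have Eu := expcurve_unitary th t Vu.
split.
- exact: mul_unitarymx.
- rewrite -mulmxA conj_mxM [RHS]mulmxA -xK -[RHS]mulmxA; congr (_ *m _).
  have V'u := unitary_conj Vu.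
  move: aK; rewrite /expcurve aE !conj_dgmx => E.
  apply: (dgmx_intertwine Vu V'u E) => k l.
  rewrite conj_imag -imagN => /imag_inj ->.
  by rewrite conj_expi mulNr.
- by move=> c cC; rewrite -mulmxA (comm _ (aC c cC)) !mulmxA xC.
- by move=> b bA; rewrite -mulmxA (comm _ (aA b bA)) !mulmxA xA // !mulNmx.
- move=> f.
  have E : expcurve V th t *m x = x *m adjmx (expcurve V th t).
    rewrite /expcurve adj_dgmx.
    have := af f; rewrite -mulmxN aE dgmxN => E.
    apply: (dgmx_intertwine Vu Vu E) => k l.
    rewrite -imagN => /imag_inj ->.
    by rewrite conj_expi mulNr.
  rewrite mulmxA -(mulmxA x) E -!mulmxA (unitaryP' (expcurve V th t)).1 //.
  by rewrite mulmx1 xf.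
Qed.

Lemma mderiv_eq (f h : R -> M) t V W : (\near t, f t = h t) ->
  mderiv f t V -> mderiv h t W -> V = W.
Proof. by move=> fh fV; apply: mderiv_unique; apply: mderiv_near fV. Qed.

Lemma mderivMl (A : M) (g : R -> M) t V : mderiv g t V ->
  mderiv (fun s => A *m g s) t (A *m V).
Proof.
move=> H; rewrite -[A *m V]add0r -(mul0mx _ (g t)).
exact: mderivM (mderiv_cst A t) H.
Qed.

Lemma mderivMr (A : M) (g : R -> M) t V : mderiv g t V ->
  mderiv (fun s => g s *m A) t (V *m A).
Proof.
move=> H; rewrite -[V *m A]addr0 -(mulmx0 _ (g t)).
exact: mderivM H (mderiv_cst A t).
Qed.

(** The equations of [cliffset] are differentiated at [t], and the unitary factor [g t] is
    cancelled. *)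
Lemma cliffset_velocity (g : R -> M) t v : (\near t, cliffset (g t)) ->
  mderiv g t v -> clifftan (g t) (adjmx (g t) *m v).
Proof.
move=> gZ gv; have [gu gK gC gA gf] := nbhs_singleton gZ.
set a := adjmx (g t) *m v.
have va : v = g t *m a by rewrite mulmxAadj.
clearbody a.
have canc (X Y : M) : g t *m X = g t *m Y -> X = Y.
  by move/(congr1 (mulmx (adjmx (g t)))); rewrite !mulmxadjA.
split.
- have U : \near t, adjmx (g t) *m g t = 1%:M.
    by apply: filterS gZ => s [/unitaryP' + _ _ _ _].
  have := mderiv_eq U (mderivM (mderiv_adj gv) gv) (mderiv_cst 1%:M t).
  move=> /eqP; rewrite addr_eq0 => /eqP.
  by rewrite va mulmxadjA // adjmxM -mulmxA (unitaryP' (g t)).1 // mulmx1.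
- apply: canc; rewrite !mulmxA -va gK -(mulmxA K) -conj_mxM -va.
  apply: mderiv_eq (mderivMr K gv) (mderivMl K (mderivJ gv)).
  by apply: filterS gZ => s [].
- move=> c cC; apply: canc; rewrite !mulmxA -va gC // -mulmxA -va.
  apply: mderiv_eq (mderivMr c gv) (mderivMl c gv).
  by apply: filterS gZ => s [_ _ + _ _]; exact.
- move=> b bA; apply: canc; rewrite !mulmxA -va gA // mulNmx -mulmxA -va.
  apply: mderiv_eq (mderivMr b gv) (mderivN (mderivMl b gv)).
  by apply: filterS gZ => s [_ _ _ + _]; exact.
- move=> f; apply: canc.
  have sq : \near t, g t *m g t = - 1%:M.
    by apply: filterS gZ => s [_ _ _ _ +]; exact.
  have := mderiv_eq sq (mderivM gv gv) (mderiv_cst (- 1%:M) t).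
  move=> /eqP; rewrite addr_eq0 => /eqP E.
  by rewrite mulmxA -va E mulmxN va.
Qed.

(** The tangent equations are linear with constant coefficients, except that the last one involves
    [g]; there the extra terms coming from [g' = g X] cancel. *)
Lemma clifftan_deriv (g X : R -> M) t X' :
  (\near t, cliffset (g t)) -> (\near t, clifftan (g t) (X t)) ->
  mderiv g t (g t *m X t) -> mderiv X t X' -> clifftan (g t) X'.
Proof.
move=> gZ XZ gv Xv; have [Xs XK XC XA Xf] := nbhs_singleton XZ.
split.
- apply: mderiv_eq (mderiv_adj Xv) (mderivN Xv).
  by apply: filterS XZ => s [].
- apply: mderiv_eq (mderivMr K Xv) (mderivMl K (mderivJ Xv)).
  by apply: filterS XZ => s [].
- move=> c cC; apply: mderiv_eq (mderivMr c Xv) (mderivMl c Xv).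
  by apply: filterS XZ => s [_ _ + _ _]; exact.
- move=> b bA; apply: mderiv_eq (mderivMr b Xv) (mderivMl b Xv).
  by apply: filterS XZ => s [_ _ _ + _]; exact.
- move=> f.
  have sq : \near t, X t *m g t = - (g t *m X t).
    by apply: filterS XZ => s [_ _ _ _ +]; exact.
  have := mderiv_eq sq (mderivM Xv gv) (mderivN (mderivM gv Xv)).
  rewrite opprD mulmxA (Xf f) mulNmx -(mulmxA (g t)) [LHS]addrC => E.
  exact: addrI E.
Qed.

End CliffordSets.

(** * Tangent spaces and geodesics *)

Section Geodesics.
Variables (R : realType) (m : nat).
Local Notation C := (Cplx R).
Local Notation M := ('M[C]_m).
Variables (K : M) (Cs As : set M) (fl : bool).
Local Notation Z := (cliffset K Cs As fl).
Local Notation T := (clifftan K Cs As fl).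
Variable P : set M.
Hypothesis satP : saturated K Cs As fl P.

Lemma saturated_curve (g : R -> M) t0 : (forall t, exists V, mderiv g t V) ->
  (forall t, Z (g t)) -> P (g t0) -> forall t, P (g t).
Proof.
move=> gd gZ Pg t.
by apply: (satP.2 _ _ Pg (curve_connected gd)) => [|y [s _ <-]|];
  [exists t0 | exact: gZ | exists t].
Qed.

Lemma mderiv_expcurve x V (th : 'I_m -> R) t : V \is unitarymx ->
  mderiv (fun s => x *m expcurve V th s) t
    (x *m (expcurve V th t *m dgmx V (fun k => imag (th k)))).
Proof. by move=> Vu; apply: mderivMl; exact: expcurve_deriv. Qed.

(** Differentiation gives the linearized equations; conversely each of their solutions is realized
    by an exponential curve, which saturation keeps in [P]. *)
Lemma tangentP x v : P x ->
  tangent P x v <-> exists2 a, T x a & v = x *m a.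
Proof.
move=> Px; split.
  move=> [g [gs gP g0 <-]].
  have gZ : \forall s \near (0 : R), Z (g s) by near=> s; exact: satP.1 (gP s).
  have H := cliffset_velocity gZ (smooth_velocity 0 gs).
  rewrite g0 in H; exists (adjmx x *m velocity g 0); first exact: H.
  by rewrite mulmxAadj //; have [] := satP.1 _ Px.
move=> [a aT ->]; have [|V [th [Vu aE]]] := @skew_spectral _ _ a.
  by case: aT.
have E0 : x *m expcurve V th 0 = x by rewrite expcurve0 // mulmx1.
exists (fun t => x *m expcurve V th t); split.
- exact: expcurve_smooth.
- apply: (saturated_curve (t0 := 0)) => [t|t|].
  + by eexists; exact: mderiv_expcurve.
  + exact: expcurve_cliffset (satP.1 _ Px) aT Vu aE.
  + by rewrite E0.
- exact: E0.
- rewrite (velocityE (mderiv_expcurve x th 0 Vu)) expcurve0 // mul1mx.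
  by rewrite aE.
Unshelve. all: by end_near. Qed.

Lemma Re_trace_adj (A : M) : complex.Re (\tr (adjmx A *m A)) =
  \sum_i \sum_j (complex.Re (A j i) ^+ 2 + complex.Im (A j i) ^+ 2).
Proof.
rewrite /mxtrace Re_sum; apply: eq_bigr => i _; rewrite mxE Re_sum.
by apply: eq_bigr => j _; rewrite adjmxE ReM ReJ ImJ mulNr opprK -!expr2.
Qed.

Lemma Re_trace_adj_eq0 (A : M) : complex.Re (\tr (adjmx A *m A)) = 0 -> A = 0.
Proof.
rewrite Re_trace_adj => /eqP; rewrite psumr_eq0 => [/allP H|i _]; last first.
  by apply: sumr_ge0 => j _; rewrite addr_ge0 ?sqr_ge0.
apply/matrixP => j i; rewrite mxE; have := H i (mem_index_enum _).
rewrite psumr_eq0 => [/allP /(_ j (mem_index_enum _))|k _]; last first.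
  by rewrite addr_ge0 ?sqr_ge0.
rewrite /= paddr_eq0 ?sqr_ge0 // !sqrf_eq0 => /andP[/eqP Re0 /eqP Im0].
exact: complexP.
Qed.

(** Put [X = g^* g'], so that [g^* g'' = X' + X^2]. Testing the geodesic equation against the
    tangent vector [g X'] leaves the squared norm of [X'], because the real part of the trace of
    [X^2 X'] vanishes. Hence [X] is constant. *)
Lemma geodesic_expcurve g : geodesic P `[0, 1] g ->
  exists V th, V \is unitarymx /\
    forall t, 0 <= t <= 1 -> g t = g 0 *m expcurve V th t.
Proof.
move=> [gs gP].
have gI (t : R) : 0 <= t <= 1 -> P (g t).
  by move=> tI; have [] := gP t; rewrite /= ?in_itv.
have gZ (t : R) : 0 < t < 1 -> \near t, Z (g t).
  by move=> tI; apply: near01 tI _ => s /gI; exact: satP.1.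
have gZ' (t : R) : 0 <= t <= 1 -> Z (g t) by move/gI; exact: satP.1.
pose v := velocity g.
have gv t : mderiv g t (v t) by exact: smooth_velocity.
pose X t := adjmx (g t) *m v t.
pose X' t := adjmx (v t) *m v t + adjmx (g t) *m acceleration g t.
have Xd t : mderiv X t (X' t).
  exact: mderivM (mderiv_adj (gv t)) (smooth_acceleration t gs).
have gX (t : R) : 0 < t < 1 -> v t = g t *m X t.
  by move=> /gZ /nbhs_singleton [gu _ _ _ _]; rewrite mulmxAadj.
have XT (t : R) : 0 < t < 1 -> T (g t) (X t).
  by move=> /gZ tZ; exact: cliffset_velocity tZ (gv t).
have X'E t : X' t = adjmx (v t) *m v t + adjmx (g t) *m acceleration g t by [].
clearbody X' X v.
have itv (t : R) : 0 < t < 1 -> 0 <= t <= 1.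
  by move=> /andP[t0 t1]; rewrite !ltW.
(* This makes [g X'] an admissible test vector for the geodesic equation. *)
have X'T (t : R) : 0 < t < 1 -> T (g t) (X' t).
  move=> tI; apply: (clifftan_deriv (gZ t tI)) (Xd t); last by rewrite -gX.
  have [t0 t1] := andP tI; near=> s; apply: XT; apply/andP; split.
    by near: s; exact: lt_nbhsr.
  by near: s; exact: lt_nbhsl.
have X'0 (t : R) : 0 < t < 1 -> X' t = 0.
  move=> tI; have [Xs _ _ _ _] := XT t tI; have [X's _ _ _ _] := X'T t tI.
  have Pt := gI t (itv t tI); have [gu _ _ _ _] := gZ' t (itv t tI).
  have [_ /(_ (g t *m X' t)) H] : P (g t) /\ forall w, tangent P (g t) w ->
      inner (acceleration g t) w = 0.
    by apply: gP; rewrite /= in_itv; exact: itv.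
  have /H : tangent P (g t) (g t *m X' t).
    by apply/(tangentP _ Pt); exists (X' t); first exact: X'T.
  have aE : acceleration g t = g t *m (X' t + X t *m X t).
    rewrite X'E gX // !adjmxM Xs -!mulmxA (mulmxadjA _ gu) mulNmx.
    by rewrite addrAC addNr add0r mulmxAadj.
  rewrite aE /inner -/(adjmx _) adjmxM -mulmxA mulmxadjA // adjmxD mulmxDl.
  have -> : adjmx (X t *m X t) = X t *m X t.
    by rewrite adjmxM Xs mulNmx mulmxN opprK.
  rewrite mxtraceD ReD.
  (* [X^2] is Hermitian and [X'] skew-Hermitian, so the trace of their product is imaginary. *)
  have -> : complex.Re (\tr (X t *m X t *m X' t)) = 0.
    have : \tr (adjmx (X t *m X t *m X' t)) = - \tr (X t *m X t *m X' t).
      rewrite !adjmxM X's Xs mulNmx mulmxN mulNmx opprK.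
      by rewrite (raddfN (@mxtrace _ _)) /= mxtrace_mulC.
    rewrite mxtrace_adj => /(congr1 (@complex.Re R)); rewrite ReJ ReN; lra.
  rewrite addr0 => /eqP; rewrite mulf_eq0 invr_eq0 pnatr_eq0 orbF => /eqP.
  exact: Re_trace_adj_eq0.
have Xc (t : R) : 0 <= t <= 1 -> X t = X 0 by exact: mderiv_cst01 Xd X'0 t.
(* Skewness of [X] is known at interior times only; constancy carries it from 1/2 to 0. *)
have half : 0 < (2^-1 : R) < 1.
  by rewrite invr_gt0 ltr0n invf_lt1 ?ltr0n ?ltr1n.
have [Xs _ _ _ _] := XT _ half; rewrite (Xc _ (itv _ half)) in Xs.
have [V [th [Vu XE]]] := skew_spectral Xs.
exists V, th; split=> // t tI.
have Eu s := expcurve_unitary th s Vu.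
(* The curve [g exp(t X)^*] is shown to be constant. *)
have hd s := mderivM (gv s) (mderiv_adj (expcurve_deriv th s Vu)).
have h0 (s : R) : 0 < s < 1 -> v s *m adjmx (expcurve V th s) +
    g s *m adjmx (expcurve V th s *m dgmx V (fun k => imag (th k))) = 0.
  move=> sI; rewrite gX // (Xc s (itv s sI)) -XE adjmxM Xs mulNmx mulmxN.
  by rewrite mulmxA subrr.
have := mderiv_cst01 hd h0 tI; rewrite expcurve0 // adjmx1 mulmx1 => <-.
by have /unitaryP' E := Eu t; rewrite -mulmxA E mulmx1.
Unshelve. all: by end_near. Qed.

End Geodesics.

(** * Geodesic segments from [o] to [- o] and their midpoints *)

Section Segments.
Variables (R : realType) (m : nat).
Local Notation C := (Cplx R).
Local Notation M := ('M[C]_m).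

Lemma extendE (c : path01 R m) (g : R -> M) t :
  (forall s, c s = g (\val s)) -> 0 <= t <= 1 -> extend c t = g t.
Proof. by move=> cE tI; rewrite /extend cE insubdK. Qed.

Lemma half01 : 0 <= (2^-1 : R) <= 1.
Proof. by rewrite invr_ge0 ler0n invf_le1 ?ltr0n ?ler1n. Qed.

(** The endpoints are left out because [extend] takes the value at 0 everywhere outside [[0, 1]], so
    its velocity at 0 and 1 need not be that of the path. *)
Lemma Rintegral_const01 (f : R -> R) q : (forall t, 0 < t < 1 -> f t = q) ->
  \int[lebesgue_measure]_(t in `[0, 1]) f t = q.
Proof.
move=> fq.
have fE : {in `](0 : R), (1 : R)[%classic, (cst q : R -> R) =1 f}.
  by move=> t; rewrite inE /= in_itv /= => /fq ->.
have mf : measurable_fun `](0 : R), (1 : R)[ f.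
  by apply: eq_measurable_fun fE _; exact: measurable_cst.
rewrite /Rintegral integral_itv_bndoo; last first.
  exact/measurable_realfun.measurable_EFinP.
rewrite (eq_integral (cst q%:E)); last by move=> x /fE <-.
rewrite integral_cst //= lebesgue_measure_itv /=.
by rewrite lte_fin ltr01 -EFinB subr0 mule1.
Qed.

Lemma length_const (c : path01 R m) (g : R -> M) q :
  (forall t, exists V, mderiv g t V) ->
  (forall s, c s = g (\val s)) ->
  (forall t, 0 < t < 1 -> inner (velocity g t) (velocity g t) = q) ->
  length c = Num.sqrt q.
Proof.
move=> gd cE gq; apply: Rintegral_const01 => t tI; congr Num.sqrt.
rewrite -(gq t tI); have [V gV] := gd t.
suff -> : velocity (extend c) t = velocity g t by [].
rewrite (velocityE gV); apply: velocityE; apply: mderiv_near gV.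
by apply: near01 tI _ => s sI; rewrite (extendE cE).
Qed.

Lemma inner_expcurve (o V : M) (th : 'I_m -> R) t :
  o \is unitarymx -> V \is unitarymx ->
  let g s := o *m expcurve V th s in
  inner (velocity g t) (velocity g t) = (\sum_k th k ^+ 2) / 2.
Proof.
move=> ou Vu /=; rewrite (velocityE (mderiv_expcurve o th t Vu)).
rewrite /inner -/(adjmx _); congr (_ / 2).
have Eu := expcurve_unitary th t Vu.
rewrite (mulmxA o) adjmxM -(mulmxA (adjmx _)) mulmxadjA;
  last exact: mul_unitarymx.
rewrite adj_dgmx (dgmxM _ _ Vu) (trace_dgmx _ Vu) Re_sum.
by apply: eq_bigr => k _; rewrite conj_imag ReM ReN ImN /=; ring.
Qed.

(** The cosine decreases strictly on [[0, pi]], so -1 is not attained earlier. This is the source of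
    the lower bound for lengths. *)
Lemma expi_eqN1 (w : R) : expi w = -1 -> pi ^+ 2 <= w ^+ 2.
Proof.
move=> /(congr1 (@complex.Re R)); rewrite ReN /= => cw.
have cw' : cos `|w| = -1 by rewrite cos_norm.
rewrite -[w ^+ 2]real_normK ?num_real // ler_sqr ?nnegrE ?pi_ge0 //.
rewrite leNgt; apply/negP => wp.
have := @ltr_cos R `|w| pi; rewrite !in_itv /= pi_ge0 lexx normr_ge0 (ltW wp).
by move=> /(_ isT isT); rewrite wp cospi cw' ltxx.
Qed.

Lemma rotation_unitary (o x : M) t : o \is unitarymx -> x \is unitarymx ->
  adjmx o *m x = - (adjmx x *m o) -> rotation o x t \is unitarymx.
Proof.
move=> ou xu oxN.
pose a : C := real_complex R (cos (pi * t)).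
pose b : C := real_complex R (sin (pi * t)).
have ab : a * a + b * b = 1.
  by rewrite -!rmorphM -rmorphD -!expr2 cos2Dsin2 rmorph1.
have ac : Num.conj a = a by apply: complexP; rewrite ?ReJ ?ImJ /= ?oppr0.
have bc : Num.conj b = b by apply: complexP; rewrite ?ReJ ?ImJ /= ?oppr0.
rewrite /rotation -/a -/b; clearbody a b.
apply/unitaryP'; rewrite adjmxD !adjmxZ ac bc mulmxDl !mulmxDr.
rewrite -!scalemxAl -!scalemxAr !scalerA (unitaryP' o).1 // (unitaryP' x).1 //.
by rewrite oxN scalerN (mulrC b a) addrA addrNK -scalerDl ab scale1r.
Qed.

Section Pole.
Variables (K : M) (Cs As : set M) (fl : bool) (P : set M).
Hypothesis satP : saturated K Cs As fl P.
Variable o : M.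
Hypothesis Po : P o.
Local Notation Z := (cliffset K Cs As fl).

Let ou : o \is unitarymx. Proof. by have [] := satP.1 _ Po. Qed.

Lemma segment_expcurve c : geodesic_segment P o (- o) c ->
  exists V th, [/\ V \is unitarymx,
    (forall t, c t = o *m expcurve V th (\val t)) &
    forall k, expi (th k) = -1].
Proof.
move=> [c0 c1 [g gg cE]].
have I0 : 0 <= (0 : R) <= 1 by rewrite lexx ler01.
have I1 : 0 <= (1 : R) <= 1 by rewrite lexx ler01.
have [V [th [Vu gE]]] := geodesic_expcurve satP gg.
have g0 : g 0 = o by rewrite -c0 (extendE cE).
exists V, th; split=> // [t|]; first by rewrite cE gE ?g0 //; exact: (valP t).
have : o *m expcurve V th 1 = - o by rewrite -g0 -gE // -(extendE cE) // c1 g0.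
move/(congr1 (mulmx (adjmx o))); rewrite mulmxadjA // mulmxN.
rewrite (unitaryP' o).1 // -(dgmx1 Vu) dgmxN => /(dgmx_inj Vu) E k.
by have := congr1 (fun h => h k) E; rewrite /= mulr1.
Qed.

Lemma expcurve1 V (th : 'I_m -> R) : V \is unitarymx ->
  (forall k, expi (th k) = -1) -> expcurve V th 1 = - 1%:M.
Proof.
move=> Vu H; rewrite -(dgmx1 Vu) dgmxN; apply: (f_equal (dgmx V)).
by apply/funext => k; rewrite mulr1 H.
Qed.

Lemma expcurve_half V (th : 'I_m -> R) : V \is unitarymx ->
  (forall k, expi (th k) = -1) ->
  let x := o *m expcurve V th 2^-1 in x *m adjmx o *m x = - o.
Proof.
move=> Vu H /=; rewrite -!mulmxA mulmxadjA // -expcurveD //.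
have -> : 2^-1 + 2^-1 = 1 :> R by lra.
by rewrite expcurve1 // mulmxN mulmx1.
Qed.

Definition rotation_path (x : M) : path01 R m := fun t => rotation o x (\val t).

Lemma rotation_half x : rotation o x 2^-1 = x.
Proof.
by rewrite /rotation cos_pihalf sin_pihalf rmorph0 scale0r rmorph1 scale1r add0r.
Qed.

Lemma rotation0 x : rotation o x 0 = o.
Proof.
by rewrite /rotation mulr0 cos0 sin0 rmorph0 scale0r rmorph1 scale1r addr0.
Qed.

Lemma rotation1 x : rotation o x 1 = - o.
Proof.
rewrite /rotation mulr1 cospi sinpi rmorph0 scale0r addr0.
by rewrite rmorphN rmorph1 scaleN1r.
Qed.

Lemma midpoint_rotation x : midpoint (rotation_path x) = x.
Proof.
by rewrite /midpoint (@extendE _ (rotation o x)) ?half01 // rotation_half.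
Qed.

Lemma pole_antisym x : x \is unitarymx -> x *m adjmx o *m x = - o ->
  adjmx o *m x = - (adjmx x *m o).
Proof.
move=> xu xox; have := congr1 (mulmx (adjmx x)) xox.
by rewrite -mulmxA mulmxadjA // mulmxN.
Qed.

Lemma rotation_cliffset x t : Z x -> x *m adjmx o *m x = - o ->
  Z (rotation o x t).
Proof.
move=> [xu xK xC xA xf] xox; have [_ oK oC oA of_] := satP.1 _ Po.
have oxN := pole_antisym xu xox.
pose a : C := real_complex R (cos (pi * t)).
pose b : C := real_complex R (sin (pi * t)).
have ab : a * a + b * b = 1.
  by rewrite -!rmorphM -rmorphD -!expr2 cos2Dsin2 rmorph1.
have ac : Num.conj a = a by apply: complexP; rewrite ?ReJ ?ImJ /= ?oppr0.
have bc : Num.conj b = b by apply: complexP; rewrite ?ReJ ?ImJ /= ?oppr0.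
split; first exact: rotation_unitary.
all: rewrite /rotation -/a -/b; clearbody a b.
- rewrite conj_mxD !conj_mxZ ac bc mulmxDl mulmxDr -!scalemxAl -!scalemxAr.
  by rewrite xK oK.
- move=> c cC; rewrite mulmxDl mulmxDr -!scalemxAl -!scalemxAr.
  by rewrite (xC c cC) (oC c cC).
- move=> c cC; rewrite mulmxDl mulmxDr -!scalemxAl -!scalemxAr.
  by rewrite (xA c cC) (oA c cC) !scalerN opprD.
- move=> f; rewrite mulmxDl !mulmxDr -!scalemxAl -!scalemxAr !scalerA.
  rewrite (xf f) (of_ f).
  have oN : adjmx o = - o.
    have := congr1 (mulmx (adjmx o)) (of_ f).
    by rewrite mulmxadjA // mulmxN mulmx1 => {2}->; rewrite opprK.
  have xN : adjmx x = - x.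
    have := congr1 (mulmx (adjmx x)) (xf f).
    by rewrite mulmxadjA // mulmxN mulmx1 => {2}->; rewrite opprK.
  move: oxN; rewrite oN xN !mulNmx opprK => oxN.
  have ox : o *m x = - (x *m o) by rewrite -oxN opprK.
  rewrite ox !scalerN (mulrC b a) addrA addrNK.
  by rewrite -opprD -scalerDl ab scale1r.
Qed.

Lemma rotation_sat x t : P x -> x *m adjmx o *m x = - o -> P (rotation o x t).
Proof.
move=> Px xox; apply: (saturated_curve satP (t0 := 2^-1)) => [s|s|].
- by eexists; exact: rotation_deriv.
- by apply: rotation_cliffset xox; exact: satP.1.
- by rewrite rotation_half.
Qed.

(** The acceleration is a real multiple of the position, and the position is orthogonal to tangent
    vectors because a skew-Hermitian matrix has imaginary trace. *)
Lemma rotation_segment x : P x -> x *m adjmx o *m x = - o ->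
  geodesic_segment P o (- o) (rotation_path x).
Proof.
move=> Px xox.
have I0 : 0 <= (0 : R) <= 1 by rewrite lexx ler01.
have I1 : 0 <= (1 : R) <= 1 by rewrite lexx ler01.
split; first by rewrite (@extendE _ (rotation o x)) // rotation0.
  by rewrite (@extendE _ (rotation o x)) // rotation1.
exists (rotation o x) => //; split; first exact: rotation_smooth.
move=> t _; have Pt := rotation_sat t Px xox; split=> // v.
move=> /(tangentP satP _ Pt) [a [aS _ _ _ _] ->].
have -> : acceleration (rotation o x) t =
    real_complex R (- (pi ^+ 2)) *: rotation o x t.
  have -> : acceleration (rotation o x) =
      velocity (fun s => real_complex R pi *: rotation x (- o) s).
    congr velocity; apply/funext => s; apply: velocityE.
    exact: rotation_deriv.
  apply: velocityE.
  under eq_fun do rewrite -mul_scalar_mx.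
  have -> : real_complex R (- pi ^+ 2) *: rotation o x t =
      (real_complex R pi)%:M *m
        (real_complex R pi *: rotation (- o) (- x) t).
    rewrite mul_scalar_mx scalerA -rmorphM -expr2 rmorphN scaleNr -scalerN.
    by congr (_ *: _); rewrite /rotation !scalerN -opprD.
  by apply: mderivMl; exact: rotation_deriv.
have [tu _ _ _ _] := satP.1 _ Pt.
rewrite /inner -/(adjmx _) adjmxZ -scalemxAl mulmxadjA // mxtraceZ.
have ra : complex.Re (\tr a) = 0.
  have := congr1 (fun X => complex.Re (\tr X)) aS.
  rewrite mxtrace_adj ReJ (raddfN (@mxtrace _ _)) /= ReN => E; lra.
by rewrite ReM ra ImJ /= oppr0 mul0r subr0 mulr0 mul0r.
Qed.

(** For an angle [w] equal to [pi] or [- pi], [expi (w * t)] is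
    [cos (pi t) + sin (pi t) * expi (w / 2)]. *)
Lemma expcurve_rotation V (th : 'I_m -> R) t : V \is unitarymx ->
  (forall k, th k ^+ 2 = pi ^+ 2) ->
  o *m expcurve V th t = rotation o (o *m expcurve V th 2^-1) t.
Proof.
move=> Vu H; rewrite /rotation -{2}(mulmx1 o) -(dgmx1 Vu) !scalemxAr -mulmxDr.
rewrite !dgmxZ dgmxD; congr (_ *m _); apply: (f_equal (dgmx V)).
apply/funext => k.
have [->|->] : th k = pi \/ th k = - pi.
  by have /eqP := H k; rewrite eqf_sqr => /orP[/eqP|/eqP]; [left | right].
- by apply: complexP;
    rewrite !(ReM, ImM, ReD, ImD) /= cos_pihalf sin_pihalf; ring.
- by apply: complexP; rewrite !(ReM, ImM, ReD, ImD) /= !mulNr !(cosN, sinN);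
    rewrite cos_pihalf sin_pihalf; ring.
Qed.

(** The squared length is half the sum of the squared angles, each at least [pi ^+ 2]. If the total
    is minimal, every angle is [pi] or [- pi], and the path is a rotation. *)
Lemma segment_length c : geodesic_segment P o (- o) c ->
  Num.sqrt (\sum_(k < m) pi ^+ 2 / 2) <= length c /\
  (length c <= Num.sqrt (\sum_(k < m) pi ^+ 2 / 2) ->
     c = rotation_path (midpoint c)).
Proof.
move=> /segment_expcurve [V [th [Vu cE thE]]].
have -> : length c = Num.sqrt (\sum_k th k ^+ 2 / 2).
  rewrite -mulr_suml.
  apply: (length_const (g := fun s => o *m expcurve V th s)) => // [t|t _].
    by eexists; exact: mderiv_expcurve.
  exact: inner_expcurve.
have thle k : pi ^+ 2 / 2 <= th k ^+ 2 / 2.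
  by rewrite ler_pM2r ?invr_gt0 ?ltr0n // expi_eqN1.
have th0 (k : 'I_m) : 0 <= th k ^+ 2 / 2 by rewrite mulr_ge0 ?sqr_ge0 ?invr_ge0.
split; first by rewrite ler_wsqrtr // ler_sum.
rewrite ler_sqrt; last first.
  by apply: sumr_ge0 => k _; rewrite mulr_ge0 ?sqr_ge0 ?invr_ge0.
move=> sle.
have thE' k : th k ^+ 2 = pi ^+ 2.
  have sE : \sum_k (th k ^+ 2 / 2 - pi ^+ 2 / 2) = 0.
    apply/eqP; rewrite big_split /= sumrN subr_eq0 eq_le sle /=.
    exact: ler_sum.
  have E : th k ^+ 2 / 2 - pi ^+ 2 / 2 = 0.
    by apply: (psumr_eq0P _ sE) => // i _; rewrite subr_ge0.
  lra.
apply/funext => t; rewrite cE expcurve_rotation //; congr rotation.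
by rewrite /midpoint (@extendE _ (fun s => o *m expcurve V th s)) ?half01.
Qed.

Lemma rotation_length x : P x -> x *m adjmx o *m x = - o ->
  length (rotation_path x) = Num.sqrt (\sum_(k < m) pi ^+ 2 / 2).
Proof.
move=> Px xox.
apply: (length_const (g := rotation o x)) => // [t|t _].
  by eexists; exact: rotation_deriv.
have xu : x \is unitarymx by have [] := satP.1 _ Px.
rewrite (velocityE (rotation_deriv o x t)) /inner -/(adjmx _) adjmxZ.
have oxN := pole_antisym xu xox.
have /unitaryP' wu : rotation x (- o) t \is unitarymx.
  apply: (rotation_unitary t xu).
    by apply/unitaryP; rewrite adjmxN mulNmx mulmxN opprK; apply/unitaryP.
  by rewrite adjmxN mulmxN mulNmx oxN opprK.
rewrite -scalemxAl -scalemxAr scalerA wu mxtraceZ mxtrace1 ReM.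
rewrite sumr_const card_ord -[RHS]mulr_natl mulrA; congr (_ / 2).
have -> : (m%:R : C) = real_complex R m%:R by rewrite rmorph_nat.
by rewrite ReM ImJ /=; ring.
Qed.

Lemma shortest_rotationP x c : P x -> x *m adjmx o *m x = - o ->
  shortest_segment P o (- o) c /\ midpoint c = x <-> c = rotation_path x.
Proof.
move=> Px xox; have rs := rotation_segment Px xox; split.
  move=> [[cs cmin] <-]; apply: (segment_length cs).2.
  by rewrite -(rotation_length Px xox); exact: cmin.
move=> ->; split; last exact: midpoint_rotation.
split=> [|c' c's]; first exact: rs.
rewrite (rotation_length Px xox).
by have [] := segment_length c's.
Qed.

(** Midpoints of longer geodesics add nothing: the equation they satisfy already makes them
    midpoints of rotation paths. *)
Lemma centrosomeE :
  centrosome P o (- o) = [set x | P x /\ x *m adjmx o *m x = - o].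
Proof.
apply/seteqP; split=> x; last first.
  move=> [Px xox]; exists (rotation_path x); first exact: rotation_segment.
  exact: midpoint_rotation.
move=> [c cs <-]; have [V [th [Vu cE thE]]] := segment_expcurve cs.
have mE : midpoint c = o *m expcurve V th 2^-1.
  by rewrite /midpoint (@extendE _ (fun s => o *m expcurve V th s)) ?half01.
split; last by rewrite mE; exact: expcurve_half.
case: cs => _ _ [g [_ gP] cE']; rewrite /midpoint (extendE cE') ?half01 //.
by have [] := gP 2^-1; rewrite //= in_itv /= half01.
Qed.

(** Every midpoint is the midpoint of a shortest segment, so no component of the centrosome is
    excluded by minimality. *)
Lemma s_centriole_cliff Q : pole P o (- o) ->
  s_centriole P o (- o) Q <-> is_component (centrosome P o (- o)) Q.
Proof.
move=> po; split=> [[[]]//|[x Cx ->]]; split; first by split=> //; exists x.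
have := Cx; rewrite centrosomeE => -[Px xox].
have [_ /(_ erefl) [ss mx]] := shortest_rotationP (rotation_path x) Px xox.
by exists (rotation_path x) => //; rewrite mx; exact: connected_component_refl.
Qed.

End Pole.

End Segments.

(** * Traces of Clifford products and of averaging operators *)

Section CliffordTraces.
Variables (F : numFieldType) (r : nat).
Local Notation M := ('M[F]_r).
Implicit Types (e l s : seq M) (z w y j Pi Q : M).

Definition clifford e : Prop := [/\ uniq e,
  {in e, forall a, a *m a = - 1%:M} &
  {in e &, forall a b, a != b -> a *m b = - (b *m a)}].

Definition mprod l : M := foldr mulmx 1%:M l.

Lemma mprod_cat l1 l2 : mprod (l1 ++ l2) = mprod l1 *m mprod l2.
Proof. by elim: l1 => [|a l1 IH] /=; rewrite ?mul1mx // IH mulmxA. Qed.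

Lemma mprod_commr w l : {in l, forall a, w *m a = a *m w} ->
  w *m mprod l = mprod l *m w.
Proof.
elim: l => [|a l IH] wl /=; first by rewrite mulmx1 mul1mx.
rewrite mulmxA (wl a (mem_head _ _)) -mulmxA IH ?mulmxA // => b bl.
by apply: wl; rewrite inE bl orbT.
Qed.

Lemma mprod_comm e l j : clifford e -> {subset l <= e} -> j \in e ->
  mprod l *m j = (-1) ^+ count (predC1 j) l *: (j *m mprod l).
Proof.
move=> [_ _ an] le je; elim: l le => [|a l IH] le /=.
  by rewrite mul1mx mulmx1 expr0 scale1r.
rewrite -mulmxA IH => [|b bl]; last by apply: le; rewrite inE bl orbT.
rewrite -scalemxAr !mulmxA; have [->|aj] /= := eqVneq a j;
  first by rewrite add0n.
have ae : a \in e by apply: le; rewrite mem_head.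
rewrite (an a j ae je aj).
by rewrite mulNmx scalerN addnC addn1 exprSr mulrN1 scaleNr.
Qed.

(** Some generator [j] anticommutes with the product: any factor if the number of factors is even, a
    generator outside [l] if it is odd. Such an outsider exists unless [l] exhausts [e], which an
    odd [l] cannot do when [e] is even. Moving [j] around the trace flips its sign. *)
Lemma trace_mprod0 e l Pi : clifford e -> uniq l -> {subset l <= e} ->
  {in e, forall a, Pi *m a = a *m Pi} ->
  (0 < size l)%N -> (size l < size e)%N || ~~ odd (size e) ->
  \tr (mprod l *m Pi) = 0.
Proof.
move=> ce ul le Pe l0 sz.
have [j [je jo]] : exists j, j \in e /\ odd (count (predC1 j) l).
  have cnt j : (count (predC1 j) l + (j \in l) = size l)%N.
    rewrite -(count_predC (pred1 j) l) addnC -(count_uniq_mem _ ul).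
    by congr addn; apply: eq_count.
  have [ol|el] := boolP (odd (size l)); last first.
    case: l l0 ul le cnt el {sz} => // a l _ _ le cnt el; exists a.
    split; first by apply: le; rewrite mem_head.
    by move: el; rewrite -(cnt a) mem_head addn1 /= negbK.
  have /allPn [j je jl] : ~~ all (mem l) e.
    apply/negP => /allP el; have [ue _ _] := ce.
    have E : size e = size l.
      by apply/eqP; rewrite eqn_leq !uniq_leq_size.
    by move: sz; rewrite E ltnn ol.
  have {}jl : j \notin l by [].
  by exists j; split=> //; move: ol; rewrite -(cnt j) (negPf jl) addn0.
have [_ sq _] := ce.
set A := mprod l *m Pi.
have Aj : A *m j = - (j *m A).
  rewrite /A -mulmxA Pe // mulmxA (mprod_comm ce le je) -signr_odd jo expr1.
  by rewrite scaleN1r mulNmx mulmxA.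
clearbody A.
have E : \tr (A *m j *m j) = - \tr (A *m j *m j).
  rewrite [in LHS]Aj mulNmx (raddfN (@mxtrace _ _)) /=; congr (- _).
  by rewrite -[in LHS]mulmxA [LHS]mxtrace_mulC.
move: E; rewrite -mulmxA (sq j je) mulmxN mulmx1 (raddfN (@mxtrace _ _)) /=.
rewrite opprK => /eqP; rewrite eq_sym -addr_eq0 -mulr2n.
by rewrite mulrn_eq0 /= => /eqP.
Qed.

(* For [clifford s], [cavg s / 2 ^ size s] projects onto the commutant of [s]. *)
Fixpoint cavg s z : M :=
  if s is j :: s' then cavg s' z - j *m cavg s' z *m j else z.

(** The trace of [f] as a linear operator on matrices, in the basis of matrix units. *)
Definition optrace (f : M -> M) : F := \sum_i \sum_j f (delta_mx i j) i j.

Lemma cavg_sandwich s j z : {in s, forall a, j *m a = - (a *m j)} ->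
  j *m cavg s z *m j = cavg s (j *m z *m j).
Proof.
elim: s => [//|a s IH] an /=.
have ja : j *m a = - (a *m j) by apply: an; rewrite mem_head.
rewrite -IH => [|b bs]; last by apply: an; rewrite inE bs orbT.
rewrite mulmxBr mulmxBl; congr (_ - _).
rewrite !mulmxA ja !mulNmx -!mulmxA; apply/eqP.
have aj : a *m j = - (j *m a) by rewrite ja opprK.
by rewrite {1}aj !mulmxN opprK.
Qed.

Lemma cavg_comm s z : clifford s ->
  {in s, forall a, a *m cavg s z = cavg s z *m a}.
Proof.
elim: s => [//|j s IH] [/= /andP[js us] sq an] a.
have cs : clifford s.
  split=> // [b bs|b c bs cs']; first by apply: sq; rewrite inE bs orbT.
  by apply: an; rewrite inE (bs, cs') orbT.
rewrite inE => /predU1P[->|as_].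
  have jj : j *m j = - 1%:M by apply: sq; rewrite mem_head.
  rewrite mulmxBr mulmxBl -!mulmxA jj !mulmxN mulmx1 !mulmxA jj.
  by rewrite !mulNmx mul1mx !opprK addrC.
have aj : a *m j = - (j *m a).
  apply: an; rewrite ?mem_head // ?inE ?as_ ?orbT //.
  by apply: contraNneq js => <-.
rewrite mulmxBr mulmxBl (IH cs a as_); congr (_ - _).
rewrite !mulmxA aj !mulNmx -!mulmxA (mulmxA a) (IH cs a as_) -!mulmxA aj.
by rewrite !mulmxN opprK.
Qed.

Lemma cavg_anti s z y : {in s, forall a, y *m a = - (a *m y)} ->
  clifford s -> {in s, forall a, a *m (y *m cavg s z *m y) =
                              (y *m cavg s z *m y) *m a}.
Proof.
move=> an cs a as_; have ya := an a as_.
have ay : a *m y = - (y *m a) by rewrite ya opprK.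
rewrite !mulmxA ay !mulNmx -!mulmxA (mulmxA a) (cavg_comm z cs as_) -!mulmxA ay.
by rewrite !mulmxN opprK.
Qed.

Lemma cavg_commr s z w : {in s, forall a, w *m a = a *m w} ->
  cavg s (w *m z) = w *m cavg s z /\ cavg s (z *m w) = cavg s z *m w.
Proof.
elim: s => [//|j s IH] cw /=.
have wj : w *m j = j *m w by apply: cw; rewrite mem_head.
have [|-> ->] := IH; first by move=> a as_; apply: cw; rewrite inE as_ orbT.
split; first by rewrite mulmxBr !mulmxA wj.
by rewrite mulmxBl -!mulmxA wj.
Qed.

Lemma cavg_id s z : clifford s -> {in s, forall a, a *m z = z *m a} ->
  cavg s z = 2 ^+ size s *: z.
Proof.
elim: s => [|j s IH] /=; first by rewrite expr0 scale1r.
move=> [/andP[js us] sq an] cz.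
have cs : clifford s.
  split=> // [b bs|b c bs cs']; first by apply: sq; rewrite inE bs orbT.
  by apply: an; rewrite inE (bs, cs') orbT.
rewrite IH // => [|a as_]; last by apply: cz; rewrite inE as_ orbT.
rewrite -scalemxAr -scalemxAl cz ?mem_head // -mulmxA sq ?mem_head //.
rewrite mulmxN mulmx1 scalerN opprK exprSr mulr_natr mulr2n scalerDl //.
Qed.

Lemma cavg_lin s (I : finType) (c : I -> F) (z : I -> M) :
  cavg s (\sum_i c i *: z i) = \sum_i c i *: cavg s (z i).
Proof.
elim: s => [//|j s IH] /=; rewrite IH mulmx_sumr mulmx_suml -sumrB.
by apply: eq_bigr => i _; rewrite scalerBr -scalemxAr -scalemxAl.
Qed.

(** Without averaging, [z |-> Q z w] has trace [tr Q * tr w]; averaging over [s] turns this into a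
    signed sum over the subsets of [s]. *)
Definition sandwich_trace s Q w : F := optrace (fun z => cavg s (Q *m z *m w)).

Lemma sandwich_trace_nil Q w : sandwich_trace [::] Q w = \tr Q * \tr w.
Proof.
rewrite /mxtrace mulr_suml; apply: eq_bigr => i _; rewrite mulr_sumr.
apply: eq_bigr => j _ /=; rewrite -mulmxA mxE (bigD1 i) //= big1 => [|k ki].
  rewrite addr0 mxE (bigD1 j) //= big1 => [|k kj].
    by rewrite addr0 mxE !eqxx mul1r.
  by rewrite mxE (negPf kj) andbF mul0r.
by rewrite mxE big1 ?mulr0 // => q _; rewrite mxE (negPf ki) mul0r.
Qed.

Lemma sandwich_trace_cons s j Q w : {in s, forall a, j *m a = - (a *m j)} ->
  sandwich_trace (j :: s) Q w =
  sandwich_trace s Q w - sandwich_trace s (j *m Q) (w *m j).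
Proof.
move=> an; rewrite /sandwich_trace /optrace -sumrB; apply: eq_bigr => i _.
rewrite -sumrB; apply: eq_bigr => k _ /=.
by rewrite mxE [X in _ + X]mxE cavg_sandwich // !mulmxA.
Qed.

Section Family.
Variables (e : seq M) (Pi : M).
Hypothesis ce : clifford e.
Hypothesis Pe : {in e, forall a, Pi *m a = a *m Pi}.

Lemma clifford_anti j s : uniq (j :: s) -> {subset j :: s <= e} ->
  {in s, forall a, j *m a = - (a *m j)}.
Proof.
have [_ _ an] := ce; move=> /= /andP[js _] se a as_.
apply: an;
  [by apply: se; rewrite mem_head | by apply: se; rewrite inE as_ orbT|].
by apply: contraNneq js => ->.
Qed.

(** Every term of the expanded average has on its left a nonempty product of generators from [s] and
    [l] times [Pi], and [trace_mprod0] kills each of them. *)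
Lemma sandwich_trace0 s l w : uniq (s ++ l) -> {subset s ++ l <= e} ->
  (0 < size l)%N -> (size s + size l < size e)%N || ~~ odd (size e) ->
  sandwich_trace s (mprod l *m Pi) w = 0.
Proof.
elim: s l w => [|j s IH] l w us se l0 sz.
  by rewrite sandwich_trace_nil (@trace_mprod0 e) ?mul0r.
have us' : uniq (s ++ j :: l).
  by rewrite -cat_rcons (perm_uniq (_ : perm_eq _ (j :: s ++ l))) //
     cat_rcons -cat_cons perm_catC perm_cons /= perm_catC.
have se' : {subset s ++ j :: l <= e}.
  by move=> a; rewrite mem_cat inE orbCA -mem_cat -in_cons; exact: se.
rewrite sandwich_trace_cons; last first.
  apply: clifford_anti => [|a aI]; last by apply: se; rewrite mem_cat aI.
  by move: us; rewrite cat_uniq => /andP[].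
rewrite (mulmxA j) -[j *m mprod l]/(mprod (j :: l)) !IH ?subr0 //.
- by rewrite addnS.
- by case/andP: us.
- by move=> a aI; apply: se; rewrite /= inE aI orbT.
- by case/orP: sz => [sz|->]; rewrite ?orbT // (ltn_trans _ sz) // ltnS.
Qed.

(** Only the term with all of [s] moved to the left can survive, since there alone the product
    exhausts [e]; each moved generator contributes the minus sign of [cavg]. *)
Lemma sandwich_trace_full s l w : uniq (s ++ l) -> {subset s ++ l <= e} ->
  (0 < size l)%N -> (size s + size l = size e)%N ->
  sandwich_trace s (mprod l *m Pi) w =
  (-1) ^+ size s * \tr (mprod (catrev s l) *m Pi) * \tr (w *m mprod s).
Proof.
elim: s l w => [|j s IH] l w us se l0 sz.
  by rewrite sandwich_trace_nil expr0 mul1r mulmx1.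
have us' : uniq (s ++ j :: l).
  by rewrite -cat_rcons (perm_uniq (_ : perm_eq _ (j :: s ++ l))) //
     cat_rcons -cat_cons perm_catC perm_cons /= perm_catC.
have se' : {subset s ++ j :: l <= e}.
  by move=> a; rewrite mem_cat inE orbCA -mem_cat -in_cons; exact: se.
rewrite sandwich_trace_cons; last first.
  apply: clifford_anti => [|a aI]; last by apply: se; rewrite mem_cat aI.
  by move: us; rewrite cat_uniq => /andP[].
rewrite (mulmxA j) -[j *m mprod l]/(mprod (j :: l)).
rewrite (IH (j :: l) _ us' se') //; last by rewrite -sz addnS.
rewrite sandwich_trace0 //; last by rewrite -sz /= addSn ltnSn.
- by rewrite sub0r /= exprS mulN1r !mulNr -mulmxA.
- by case/andP: us.
- by move=> a aI; apply: se; rewrite /= inE aI orbT.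
Qed.

Lemma sandwich_trace_id s w : uniq s -> {subset s <= e} ->
  (size s < size e)%N -> sandwich_trace s Pi w = \tr Pi * \tr w.
Proof.
elim: s w => [|j s IH] w us se sz; first by rewrite sandwich_trace_nil.
rewrite sandwich_trace_cons; last exact: clifford_anti.
rewrite IH; last exact: ltnW.
- rewrite (_ : j *m Pi = mprod [:: j] *m Pi); last by rewrite /= mulmx1.
  rewrite sandwich_trace0 ?subr0 //.
  + by rewrite cats1 rcons_uniq -[_ && _]/(uniq (j :: s)).
  + by move=> a; rewrite cats1 mem_rcons; exact: se.
  + by rewrite addn1 sz.
- by case/andP: us.
- by move=> a aI; apply: se; rewrite inE aI orbT.
Qed.

End Family.

(* Up to the factor [2 ^ (size s).+1], a projection onto the matrices that are
   supported on [Pi], commute with [s] and anticommute with [y]; its trace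
   therefore counts dimensions. *)
Definition csplit s y Pi z : M :=
  let w := cavg s (Pi *m z *m Pi) in w + y *m w *m y.

Section Split.
Variables (s : seq M) (y Pi : M).
Hypothesis ce : clifford (y :: s).
Hypothesis Pe : {in y :: s, forall a, Pi *m a = a *m Pi}.

Let cs : clifford s.
Proof.
have [/andP[_ us] sq an] := ce; split=> // [b bs|b c bs cs'].
  by apply: sq; rewrite inE bs orbT.
by apply: an; rewrite inE (bs, cs') orbT.
Qed.

Let ys : {in s, forall a, y *m a = - (a *m y)}.
Proof. by apply: (clifford_anti ce) => //; case: ce. Qed.

Let yy : y *m y = - 1%:M.
Proof. by have [_ sq _] := ce; apply: sq; rewrite mem_head. Qed.

(** Of all products of generators only two contribute: the empty one, from the plain half, and the
    full one, from the half sandwiched by [y]. *)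
Lemma csplit_trace : optrace (csplit s y Pi) = \tr Pi ^+ 2 +
  (-1) ^+ size s * \tr (mprod (catrev s [:: y]) *m Pi) *
    \tr (Pi *m y *m mprod s).
Proof.
have -> : optrace (csplit s y Pi) =
    sandwich_trace s Pi Pi + sandwich_trace s (y *m Pi) (Pi *m y).
  rewrite /sandwich_trace /optrace -big_split; apply: eq_bigr => i _ /=.
  rewrite -big_split; apply: eq_bigr => k _ /=.
  by rewrite /csplit mxE cavg_sandwich // !mulmxA.
have [us _ _] := ce.
rewrite (sandwich_trace_id ce) //; last 2 first.
- by case/andP: us.
- by move=> a aI; rewrite inE aI orbT.
rewrite -expr2 (_ : y *m Pi = mprod [:: y] *m Pi); last by rewrite /= mulmx1.
rewrite (sandwich_trace_full ce) //; last by rewrite addn1.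
- by rewrite cats1 rcons_uniq -[_ && _]/(uniq (y :: s)).
- by move=> a; rewrite cats1 mem_rcons.
Qed.

Lemma csplit_comm z :
  {in s, forall a, a *m csplit s y Pi z = csplit s y Pi z *m a}.
Proof.
move=> a as_; rewrite /csplit /= mulmxDr mulmxDl (cavg_comm _ cs as_).
by rewrite (cavg_anti _ ys cs as_).
Qed.

Lemma csplit_anti z : csplit s y Pi z *m y = - (y *m csplit s y Pi z).
Proof.
rewrite /csplit /=; set w := cavg _ _; clearbody w.
rewrite mulmxDr mulmxDl !mulmxA yy -!mulmxA yy !mulmxN !mulmx1 !mulNmx !mul1mx.
by rewrite opprB addrC.
Qed.

Lemma csplit_supp z : Pi *m Pi = Pi ->
  Pi *m csplit s y Pi z *m Pi = csplit s y Pi z.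
Proof.
move=> PP; rewrite /csplit /=.
have Ps : {in s, forall a, Pi *m a = a *m Pi}.
  by move=> a aI; apply: Pe; rewrite inE aI orbT.
have Py : Pi *m y = y *m Pi by apply: Pe; rewrite mem_head.
set w := cavg _ _; have wE : Pi *m w *m Pi = w.
  rewrite /w -(cavg_commr _ Ps).1 -(cavg_commr _ Ps).2.
  by rewrite !mulmxA PP -!mulmxA PP.
clearbody w; rewrite mulmxDr mulmxDl wE; congr (_ + _).
by rewrite !mulmxA Py -!mulmxA -Py !mulmxA -(mulmxA y) -(mulmxA y) wE.
Qed.

Lemma csplit_id z : {in s, forall a, a *m z = z *m a} -> z *m y = - (y *m z) ->
  csplit s y 1%:M z = 2 ^+ (size s).+1 *: z.
Proof.
move=> cz zy; rewrite /csplit mul1mx mulmx1 cavg_id // -scalemxAr -scalemxAl.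
rewrite -mulmxA zy mulmxN mulmxA yy mulNmx mul1mx opprK -scalerDl.
by rewrite exprSr mulr_natr mulr2n.
Qed.

Lemma csplit_lin (I : finType) (c : I -> F) (z : I -> M) :
  csplit s y Pi (\sum_i c i *: z i) = \sum_i c i *: csplit s y Pi (z i).
Proof.
have E : Pi *m (\sum_i c i *: z i) *m Pi = \sum_i c i *: (Pi *m z i *m Pi).
  rewrite mulmx_sumr mulmx_suml; apply: eq_bigr => i _.
  by rewrite -scalemxAr -scalemxAl.
rewrite /csplit /= E cavg_lin mulmx_sumr mulmx_suml -big_split /=.
by apply: eq_bigr => i _; rewrite scalerDr -scalemxAr -scalemxAl.
Qed.

End Split.

(** In a rank factorization [Pi = A B] idempotency cancels to [B A = 1], an identity matrix of size
    the rank. *)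
Lemma trace_idempotent Pi : Pi *m Pi = Pi -> \tr Pi = (\rank Pi)%:R.
Proof.
move: (col_base Pi) (row_base Pi) (mulmx_base Pi) (row_base_free Pi)
  (col_base_full Pi) => A B AB Bf Af PP.
rewrite -{1}AB mxtrace_mulC.
suff -> : B *m A = 1%:M by rewrite mxtrace1.
apply: (row_free_inj Bf); apply: (row_full_inj Af).
by rewrite mul1mx !mulmxA AB -mulmxA AB.
Qed.

End CliffordTraces.

(** * Dimension as an operator trace *)

Section Dimension.
Variables (F : numFieldType) (r : nat).
Local Notation M := ('M[F]_r).

Definition lin_indep d (b : 'I_d -> M) : Prop :=
  forall c : 'I_d -> F, \sum_k c k *: b k = 0 -> forall k, c k = 0.

(** By independence, the coefficients of [f] on the matrix units, paired with the entries of [b l],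
    give [lam]; the trace is the sum of these pairings over [l]. *)
Lemma dim_optrace d (b : 'I_d -> M) (f : M -> M) (lam : F) :
  (forall (c : 'I_r * 'I_r -> F) (z : 'I_r * 'I_r -> M),
     f (\sum_p c p *: z p) = \sum_p c p *: f (z p)) ->
  lin_indep b -> (forall z, exists c, f z = \sum_k c k *: b k) ->
  (forall k, f (b k) = lam *: b k) -> optrace f = lam * d%:R.
Proof.
move=> flin bi fspan fb.
have /choice [c cE] : forall p : 'I_r * 'I_r, exists c : 'I_d -> F,
    f (delta_mx p.1 p.2) = \sum_k c k *: b k by move=> p; exact: fspan.
have key l : \sum_p b l p.1 p.2 * c p l = lam.
  have bE : b l = \sum_(p : 'I_r * 'I_r) b l p.1 p.2 *: delta_mx p.1 p.2.
    by rewrite {1}[b l]matrix_sum_delta pair_bigA.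
  have := fb l; rewrite {1}bE flin.
  under eq_bigr do rewrite cE scaler_sumr.
  rewrite exchange_big /= => E.
  have /bi /(_ l) : \sum_k (\sum_p b l p.1 p.2 * c p k - (k == l)%:R * lam)
      *: b k = 0.
    under eq_bigr do rewrite scalerBl scaler_suml.
    rewrite sumrB; under eq_bigr do under eq_bigr do rewrite -scalerA.
    rewrite E (bigD1 l) //= eqxx mul1r big1 ?addr0 ?subrr // => k kl.
    by rewrite (negPf kl) mul0r scale0r.
  by rewrite eqxx mul1r => /eqP; rewrite subr_eq0 => /eqP.
rewrite /optrace pair_bigA /=.
under eq_bigr do rewrite cE summxE.
rewrite exchange_big /= -[X in _ = _ * X%:R]card_ord -sumr_const mulr_sumr.
apply: eq_bigr => k _; rewrite mulr1 -(key k).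
by apply: eq_bigr => p _; rewrite mxE mulrC.
Qed.

Lemma lin_indep_free d (b : 'I_d -> M) :
  lin_indep b <-> free [seq b k | k <- enum 'I_d].
Proof.
set X := [seq _ | _ <- _];
  have sX : size X == d by rewrite size_map size_enum_ord.
have nX (k : 'I_d) : (Tuple sX)`_k = b k.
  by rewrite /= (nth_map k) ?size_enum_ord // nth_ord_enum.
have -> : free X = free (Tuple sX) by [].
split=> [bi|/freeP fX c].
  by apply/freeP => c E; apply: bi; rewrite -[RHS]E; apply: eq_bigr => k _;
     rewrite nX.
by move=> E; apply: fX; rewrite -[RHS]E; apply: eq_bigr => k _; rewrite nX.
Qed.

(** The family is chosen inside [S], which need not be a subspace: applied to a set of
    skew-Hermitian matrices it is independent over the complex numbers and still skew-Hermitian. *)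
Lemma maximal_indep (S : set M) : exists d (b : 'I_d -> M),
  [/\ forall k, S (b k), lin_indep b &
      forall a, S a -> exists c, a = \sum_k c k *: b k].
Proof.
pose Q d := `[< exists X : seq M, [/\ size X = d, free X &
                 forall a, a \in X -> S a] >].
have Q0 : exists d, Q d.
  by exists 0%N; apply/asboolP; exists [::]; split=> //; exact: nil_free.
have Qb d : Q d -> (d <= \dim {:M})%N.
  move=> /asboolP [X [<- fX _]].
  by move: fX; rewrite /free => /eqP <-; apply: dimvS; exact: subvf.
case: (ex_maxnP Q0 Qb) => d /asboolP [X [sX fX XS]] dmax.
exists d, (fun k : 'I_d => X`_k); split.
- by move=> k; apply: XS; rewrite mem_nth // sX.
- apply/lin_indep_free;
  suff -> : [seq X`_(nat_of_ord k) | k <- enum 'I_d] = X by [].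
  apply: (@eq_from_nth _ 0); rewrite size_map size_enum_ord // => i id.
  by rewrite (nth_map (Ordinal id)) ?size_enum_ord // nth_enum_ord.
- move=> a Sa; have aX : a \in <<X>>%VS.
    apply: contraT => aX; have /dmax : Q d.+1; last by rewrite ltnn.
    apply/asboolP; exists (a :: X); split; rewrite /= ?sX //.
      by rewrite free_cons aX fX.
    by move=> b; rewrite inE => /predU1P[->|/XS].
  have /eqP sX' := sX; exists (fun k => coord (Tuple sX') k a).
  by rewrite {1}(@coord_span _ _ _ (Tuple sX') a).
Qed.

End Dimension.

(** * Skew-Hermitian solutions as a real form *)

Section SkewFamilies.
Variables (C : numClosedFieldType) (r : nat).
Local Notation M := ('M[C]_r).
Implicit Types (s : seq M) (y a : M).

(** The second clause writes [b] and [c] through [a] and its adjoint, so both stay in any complex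
    subspace closed under adjoints. *)
Lemma skew_decomp (a : M) : exists b c,
  [/\ adjmx b = - b, adjmx c = - c & a = b + 'i *: c] /\
  (b = 2^-1 *: (a - adjmx a) /\ c = - ('i / 2) *: (a + adjmx a)).
Proof.
exists (2^-1 *: (a - adjmx a)), (- ('i / 2) *: (a + adjmx a)).
have c2 : Num.conj (2^-1 : C) = 2^-1 by rewrite fmorphV rmorph_nat.
have ci : Num.conj (- ('i / 2) : C) = 'i / 2.
  by rewrite rmorphN rmorphM /= c2 conjCi mulNr opprK.
split=> //; split.
- by rewrite adjmxZ adjmxD adjmxN adjmxK c2 -scalerN opprB.
- by rewrite adjmxZ adjmxD adjmxK ci scaleNr opprK addrC.
- rewrite scalerA mulrN mulrA -expr2 sqrCi mulN1r opprK -scalerDr.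
  rewrite addrACA addNr addr0 -mulr2n -(scaler_nat 2 a) scalerA mulVf ?scale1r //.
Qed.

Lemma adj_mprod s : {in s, forall a, adjmx a = - a} ->
  adjmx (mprod s) = (-1) ^+ size s *: mprod (rev s).
Proof.
elim: s => [|a s IH] sk /=; first by rewrite adjmx1 expr0 scale1r.
rewrite adjmxM (sk a (mem_head _ _)) IH => [|b bs]; last by apply: sk;
  rewrite inE bs orbT.
rewrite rev_cons -cats1 mprod_cat /= mulmx1 mulmxN -scalemxAl exprS -scalerA.
by rewrite scaleN1r.
Qed.

(** Adjoints reverse products at the cost of one sign per factor, so for skew-Hermitian generators
    the full-product term of [csplit_trace] is minus an absolute square. *)
Lemma csplit_trace1 s y : clifford (y :: s) ->
  {in y :: s, forall a, adjmx a = - a} ->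
  optrace (csplit s y 1%:M) =
  r%:R ^+ 2 - \tr (mprod (rev s) *m y) * Num.conj (\tr (mprod (rev s) *m y)).
Proof.
move=> ce sk; rewrite csplit_trace // => [|a _]; last by rewrite mul1mx mulmx1.
rewrite mxtrace1 mulmx1 mul1mx catrevE.
have E : mprod (rev s ++ [:: y]) = mprod (rev s) *m y.
  by rewrite mprod_cat /= mulmx1.
rewrite E; congr (_ + _); rewrite -mxtrace_adj adjmxM (sk y (mem_head _ _)).
rewrite adj_mprod => [|a]; last first.
  by rewrite mem_rev => aI; apply: sk; rewrite inE aI orbT.
rewrite revK size_rev mulNmx -scalemxAr (raddfN (@mxtrace _ _)) /= mxtraceZ.
by rewrite mulrN opprK mulrCA mulrA.
Qed.

Definition csplit_space s y : set M :=
  [set a | (forall b, b \in s -> a *m b = b *m a) /\ a *m y = - (y *m a)].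

Lemma csplit_space_adj s y a : {in y :: s, forall b, adjmx b = - b} ->
  csplit_space s y a -> csplit_space s y (adjmx a).
Proof.
move=> sk [ac aa]; split.
  move=> b bs; have := congr1 (@adjmx _ _ _) (ac b bs).
  have bN : adjmx b = - b by apply: sk; rewrite inE bs orbT.
  by rewrite !adjmxM bN mulNmx mulmxN => /oppr_inj.
have := congr1 (@adjmx _ _ _) aa.
have yN : adjmx y = - y by apply: sk; rewrite mem_head.
rewrite adjmxN !adjmxM yN mulNmx mulmxN opprK => E.
by rewrite -E.
Qed.

Lemma csplit_spaceD s y a b : csplit_space s y a -> csplit_space s y b ->
  csplit_space s y (a + b).
Proof.
move=> [ac aa] [bc ba]; split=> [c cs|].
  by rewrite mulmxDl mulmxDr ac // bc.
by rewrite mulmxDl mulmxDr aa ba opprD.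
Qed.

Lemma csplit_spaceZ s y c a : csplit_space s y a -> csplit_space s y (c *: a).
Proof.
move=> [ac aa]; split=> [b bs|].
  by rewrite -scalemxAl -scalemxAr ac.
by rewrite -scalemxAl -scalemxAr aa scalerN.
Qed.

Lemma csplit_space_sum s y d (c : 'I_d -> C) (b : 'I_d -> M) :
  (forall k, csplit_space s y (b k)) -> csplit_space s y (\sum_k c k *: b k).
Proof.
move=> H; apply: big_ind => [|x z|k _]; [|exact: csplit_spaceD|].
  by split=> [q _|]; rewrite ?mul0mx ?mulmx0 ?oppr0.
exact: csplit_spaceZ.
Qed.

(** [csplit s y 1%:M] is [2 ^+ (size s).+1] times a projection onto [csplit_space s y]. Splitting
    values into skew-Hermitian parts shows that [b] spans this space over the complex numbers, so
    the trace counts [b]. *)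
Lemma csplit_dim s y d (b : 'I_d -> M) : clifford (y :: s) ->
  {in y :: s, forall a, adjmx a = - a} ->
  (forall k, csplit_space s y (b k)) -> lin_indep b ->
  (forall a, csplit_space s y a -> adjmx a = - a ->
     exists c, a = \sum_k c k *: b k) ->
  2 ^+ (size s).+1 * d%:R = r%:R ^+ 2 -
    \tr (mprod (rev s) *m y) * Num.conj (\tr (mprod (rev s) *m y)).
Proof.
move=> ce sk bV bi bspan; rewrite -csplit_trace1 //; symmetry.
apply: (dim_optrace (b := b)) => //.
- by move=> c z; exact: csplit_lin.
- move=> z; set a := csplit s y 1%:M z.
  have aV : csplit_space s y a.
    by split=> [q qs|]; [rewrite (csplit_comm _ ce _ qs) | exact: csplit_anti].
  have [u [v [[us vs aE] [uE vE]]]] := skew_decomp a.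
  have aV' := csplit_space_adj sk aV.
  have uV : csplit_space s y u.
    rewrite uE -scaleN1r; apply: csplit_spaceZ; apply: csplit_spaceD => //.
    exact: csplit_spaceZ.
  have vV : csplit_space s y v.
    by rewrite vE; apply: csplit_spaceZ; exact: csplit_spaceD.
  have [c1 E1] := bspan u uV us; have [c2 E2] := bspan v vV vs.
  exists (fun k => c1 k + 'i * c2 k); rewrite aE E1 E2 scaler_sumr -big_split.
  by apply: eq_bigr => k _; rewrite scalerDl scalerA.
- move=> k; have [bc ba] := bV k.
  by apply: (csplit_id ce) => // a aI; rewrite bc.
Qed.

End SkewFamilies.

(** * Contracting a spectrum to that of a reflection *)

Section Connectivity.
Variables (R : realType) (r : nat).
Local Notation C := (Cplx R).
Local Notation M := ('M[C]_r).
Implicit Types (s : seq M) (x y J D a Pi : M).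

(** With [K = 0] and [Cs] empty the conjugation and commutation conditions are vacuous: this is the
    [r] by [r] model of the [U] side. *)
Definition cliffs s : set M := cliffset 0 set0 [set a | a \in s] true.

Lemma cliffsP s x : cliffs s x <-> [/\ x \is unitarymx,
  {in s, forall a, x *m a = - (a *m x)} & x *m x = - 1%:M].
Proof.
split=> [[xu _ _ xs xx]|[xu xs xx]]; first by split=> //; exact: xx.
by split=> //; rewrite mulmx0 mul0mx.
Qed.

Lemma unitary_sqN1_adj n (x : 'M[C]_n) : x \is unitarymx -> x *m x = - 1%:M ->
  adjmx x = - x.
Proof.
move=> xu xx; have := congr1 (mulmx (adjmx x)) xx.
by rewrite mulmxadjA // mulmxN mulmx1 => {2}->; rewrite opprK.
Qed.

Lemma curve_component n (N : set 'M[C]_n) (g : R -> 'M[C]_n) :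
  (forall t, exists V, mderiv g t V) -> (forall t, N (g t)) ->
  forall u v, connected_component N (g u) (g v).
Proof.
move=> gd gN u v.
apply: (@connected_component_max _ _ (range g)); last by exists v.
- by exists u.
- by move=> _ [w _ <-].
- exact: curve_connected.
Qed.

Lemma cliffs_mul s J D : cliffs s J -> D \is unitarymx ->
  {in s, forall a, D *m a = a *m D} -> D *m J = J *m adjmx D ->
  cliffs s (J *m D).
Proof.
move=> /cliffsP [Ju Js JJ] Du Ds DJ; apply/cliffsP; split.
- exact: mul_unitarymx.
- by move=> a as_; rewrite -mulmxA Ds // mulmxA Js // mulNmx mulmxA.
- rewrite mulmxA -(mulmxA J) DJ -!mulmxA (unitaryP' D).1 // mulmx1.
  exact: JJ.
Qed.

(* The eigenvalues of [J^-1 x] other than [-1] are contracted to [1] along the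
   unit circle. *)
Lemma eigen_retract s x J : cliffs s x -> cliffs s J ->
  exists Pi, [/\ Pi *m Pi = Pi, adjmx Pi = Pi,
    {in s, forall a, Pi *m a = a *m Pi}, Pi *m J = J *m Pi &
    connected_component (cliffs s) (J *m (1%:M - 2 *: Pi)) x].
Proof.
move=> /cliffsP [xu xs xx] Jc; have /cliffsP [Ju Js JJ] := Jc.
pose u := adjmx J *m x; have xE : x = J *m u by rewrite mulmxAadj.
have uu : u \is unitarymx by exact: mul_unitarymx (unitary_adj Ju) xu.
clearbody u.
have us : {in s, forall a, u *m a = a *m u}.
  move=> a as_; have := xs a as_; rewrite xE -mulmxA mulmxA.
  rewrite [a *m (J *m u)]mulmxA -[a *m J]opprK -(Js a as_) mulNmx opprK.
  rewrite -!mulmxA => /(congr1 (mulmx (adjmx J))).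
  by rewrite !mulmxadjA.
have uJ : u *m J = J *m adjmx u.
  have := xx; rewrite xE -JJ -!mulmxA => /(congr1 (mulmx (adjmx J))).
  rewrite !mulmxadjA // => /(congr1 (fun X => X *m adjmx u)).
  by rewrite -!mulmxA (unitaryP u).1 // mulmx1.
have conjM (z w : C) : Num.conj (z * w) = Num.conj z * Num.conj w.
  exact: rmorphM.
have [V [l [Vu uE l1]]] := unitary_spectral uu.
(* Each eigenvalue is [ep k * expi (th k)]. Conjugate eigenvalues must move conjugately for [J] to
   keep inverting the path; as [arg] does not respect conjugation at -1, that eigenvalue is held
   fixed by the sign. *)
pose ep k : C := if l k == -1 then -1 else 1.
pose th k : R := if l k == -1 then 0 else arg (l k).
have epth k : ep k * expi (th k * 1) = l k.
  rewrite /ep /th mulr1; case: eqP => [->|_]; first by rewrite expi0 mulr1.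
  by rewrite mul1r expi_arg.
have epJ k : Num.conj (ep k) = ep k.
  by rewrite /ep; case: ifP => _; rewrite ?rmorphN rmorph1.
have ep2 k : ep k * ep k = 1.
  by rewrite /ep; case: ifP => _; rewrite ?mulrNN mulr1.
pose D t := dgmx V (fun k => ep k * expi (th k * t)).
have lJ k j : l k = Num.conj (l j) -> forall t,
    ep k * expi (th k * t) = Num.conj (ep j * expi (th j * t)).
  move=> lE t; rewrite conjM epJ conj_expi.
  have jN : (l k == -1) = (l j == -1).
    by rewrite lE -(inj_eq (can_inj (@conjCK C))) conjCK rmorphN rmorph1.
  rewrite /ep /th jN; case: ifPn => [_|lj]; first by rewrite mul0r oppr0.
  by rewrite lE arg_conj // mulNr.
have DN t : cliffs s (J *m D t).
  apply: (cliffs_mul Jc).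
  - apply: dgmx_unitary => // k.
    by rewrite conjM epJ mulrACA ep2 mul1r expi_norm.
  - move=> a as_; have := us a as_; rewrite uE => E.
    by apply: (dgmx_intertwine Vu Vu E) => k j; rewrite /ep /th => ->.
  - rewrite /D adj_dgmx; move: uJ; rewrite uE adj_dgmx => E.
    by apply: (dgmx_intertwine Vu Vu E) => k j /lJ.
pose Pi := dgmx V (fun k => (l k == -1)%:R).
have PiD : 1%:M - 2 *: Pi = D 0.
  rewrite /Pi /D -(dgmx1 Vu) dgmxZ dgmxN dgmxD; apply: (f_equal (dgmx V)).
  apply/funext => k; rewrite mulr0 expi0 mulr1 /ep.
  by case: ifP => _; rewrite ?mulr1 ?mulr0 ?subr0 //; ring.
exists Pi; split.
- rewrite /Pi (dgmxM _ _ Vu); apply: (f_equal (dgmx V)).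
  by apply/funext => k; case: (l k == -1); rewrite ?mulr1 ?mulr0.
- rewrite /Pi adj_dgmx; apply: (f_equal (dgmx V)).
  by apply/funext => k; rewrite rmorph_nat.
- move=> a as_; have := us a as_; rewrite uE => E.
  by apply: (dgmx_intertwine Vu Vu E) => k j ->.
- move: uJ; rewrite uE adj_dgmx => E.
  apply: (dgmx_intertwine Vu Vu E) => k j lE.
  by rewrite lE -(inj_eq (can_inj (@conjCK C))) conjCK rmorphN rmorph1.
have -> : x = J *m D 1.
  rewrite xE uE /D; congr (_ *m _); apply: (f_equal (dgmx V)).
  by apply/funext => k; rewrite epth.
have E : (fun q => J *m D q) = fun q => (J *m dgmx V ep) *m expcurve V th q.
  by apply/funext => q; rewrite /D /expcurve -mulmxA (dgmxM _ _ Vu).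
rewrite PiD; apply: (curve_component (g := fun t => J *m D t) _ DN).
by move=> t; rewrite E; eexists; exact: mderiv_expcurve.
Qed.

End Connectivity.

(** * Removing a reflection by rotations *)

Section Descent.
Variables (R : realType) (r : nat).
Local Notation C := (Cplx R).
Local Notation M := ('M[C]_r).
Implicit Types (s : seq M) (x y J D a Pi : M).

(** The trace hypothesis reduces the trace of [csplit s J Pi] to the squared rank of [Pi]. So the
    operator has a nonzero value, and one of the two skew-Hermitian parts of that value is
    nonzero. *)
Lemma csplit_support_skew s J Pi : clifford (J :: s) ->
  {in J :: s, forall a, adjmx a = - a} ->
  {in J :: s, forall a, Pi *m a = a *m Pi} ->
  Pi *m Pi = Pi -> adjmx Pi = Pi -> \tr (mprod (rev s) *m J *m Pi) = 0 ->
  Pi != 0 ->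
  exists a, [/\ a != 0, adjmx a = - a, csplit_space s J a & Pi *m a = a].
Proof.
move=> ce sk Pe PP Pa tr0 Pn0.
have tn0 : optrace (csplit s J Pi) != 0.
  rewrite csplit_trace // catrevE mprod_cat /= mulmx1 tr0 mulr0 mul0r addr0.
  by rewrite trace_idempotent // expf_neq0 // pnatr_eq0 mxrank_eq0.
have [z zn0] : exists z, csplit s J Pi z != 0.
  apply: contrapT => H; case/eqP: tn0; rewrite /optrace big1 // => i _.
  rewrite big1 // => j _;
    have [->|n0] := eqVneq (csplit s J Pi (delta_mx i j)) 0.
    by rewrite mxE.
  by case: H; exists (delta_mx i j).
set a := csplit s J Pi z in zn0.
have aV : csplit_space s J a.
  by split=> [q qs|]; [rewrite (csplit_comm _ ce _ qs) | exact: csplit_anti].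
have Psupp : Pi *m a = a /\ a *m Pi = a.
  have E := csplit_supp Pe z PP; rewrite -/a in E.
  split; first by rewrite -E !mulmxA PP.
  by rewrite -E -!mulmxA PP.
clearbody a.
have aV' := csplit_space_adj sk aV.
have P2 : Pi *m adjmx a = adjmx a by rewrite -{1}Pa -adjmxM Psupp.2.
have [u [v [[us vs aE] [uE vE]]]] := skew_decomp a.
have [u0|un0] := eqVneq u 0.
  exists v; split; [|exact: vs| |].
  - by apply: contraNneq zn0 => v0; rewrite aE u0 v0 scaler0 addr0.
  - by rewrite vE; apply: csplit_spaceZ; exact: csplit_spaceD.
  - by rewrite vE -scalemxAr mulmxDr Psupp.1 P2.
exists u; split; [exact: un0|exact: us| |].
  rewrite uE -scaleN1r; apply: csplit_spaceZ; apply: csplit_spaceD aV _.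
  exact: csplit_spaceZ.
by rewrite uE -scalemxAr mulmxDr mulmxN Psupp.1 P2.
Qed.

(* [Pi] projects onto the support of [a], [b] is the phase of [a], and
   [E t = exp (t b)]. *)
Lemma skew_phase a : adjmx a = - a -> exists (E : R -> M) (Pi b c : M),
  [/\ [/\ forall t, E t \is unitarymx, forall t, exists V, mderiv E t V,
          E 0 = 1%:M & E pi = 1%:M - 2 *: Pi],
      [/\ Pi *m Pi = Pi, adjmx Pi = Pi, b *m b = - Pi, Pi = a *m c &
          a *m Pi = a],
      forall x, a *m x = x *m a ->
        [/\ forall t, E t *m x = x *m E t, Pi *m x = x *m Pi &
          b *m x = x *m b] &
      forall x, a *m x = - (x *m a) ->
        [/\ forall t, E t *m x = x *m adjmx (E t), Pi *m x = x *m Pi &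
            b *m x = - (x *m b)]].
Proof.
move=> ask; have [V [th [Vu aE]]] := skew_spectral ask.
pose sg k : R := Num.sg (th k).
pose Pi := dgmx V (fun k => (th k != 0)%:R).
pose b := dgmx V (fun k => imag (sg k)).
have sgcase (Q : R -> Prop) : Q 0 -> Q 1 -> Q (-1) -> forall k, Q (sg k).
  by move=> Q0 Q1 QN1 k; rewrite /sg; case: sgrP.
have comm x : a *m x = x *m a -> forall f : R -> C,
    dgmx V (fun k => f (th k)) *m x = x *m dgmx V (fun k => f (th k)).
  move=> Eq f; move: Eq; rewrite aE => Eq.
  by apply: (dgmx_intertwine Vu Vu Eq) => k l /imag_inj ->.
have anti x f f' : a *m x = - (x *m a) ->
    (forall w : R, f (- w) = f' w :> C) ->
    dgmx V (fun k => f (th k)) *m x = x *m dgmx V (fun k => f' (th k)).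
  move=> aJ ff'; move: aJ; rewrite -mulmxN aE dgmxN => Eq.
  apply: (dgmx_intertwine Vu Vu Eq) => k l; rewrite -imagN => /imag_inj ->.
  exact: ff'.
(* The last witness is a pseudo-inverse of [a]; on the kernel the inverse of zero gets multiplied by
   zero. *)
exists (expcurve V sg), Pi, b, (dgmx V (fun k => (imag (th k))^-1)).
split; first split.
- by move=> t; exact: expcurve_unitary.
- by move=> t; eexists; exact: expcurve_deriv.
- exact: expcurve0.
- rewrite /Pi /expcurve -(dgmx1 Vu) dgmxZ dgmxN dgmxD.
  apply: (f_equal (dgmx V)); apply/funext => k; rewrite /sg.
  have e1 : expi pi = -1 :> C.
    by apply: complexP; rewrite ?ReN ?ImN /= ?cospi ?sinpi ?oppr0.
  have eN1 : expi (- pi) = -1 :> C by rewrite -conj_expi e1 rmorphN rmorph1.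
  have two : 1 - 2 * 1 = -1 :> C by ring.
  case: (sgrP (th k)) => _.
  + by rewrite mul0r expi0 mulr0 subr0.
  + by rewrite mul1r e1 two.
  + by rewrite mulN1r eN1 two.
- split.
  + rewrite /Pi (dgmxM _ _ Vu); apply: (f_equal (dgmx V)); apply/funext => k.
    by case: (th k != 0); rewrite ?mulr1 ?mulr0.
  + rewrite /Pi adj_dgmx; apply: (f_equal (dgmx V)).
    by apply/funext => k; rewrite rmorph_nat.
  + rewrite /b /Pi (dgmxM _ _ Vu) dgmxN; apply: (f_equal (dgmx V)).
    apply/funext => k; rewrite /sg.
    have i2 : imag 1 * imag 1 = -1 :> C.
      by apply: complexP; rewrite ?ReM ?ImM ?ReN ?ImN /=; ring.
    case: (sgrP (th k)) => _.
    * by rewrite mulr0n oppr0; apply: complexP; rewrite ?ReM ?ImM /=; ring.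
    * by rewrite i2.
    * by rewrite imagN mulrNN i2.
  + rewrite aE (dgmxM _ _ Vu); apply: (f_equal (dgmx V)); apply/funext => k.
    have [->|tn0] := eqVneq (th k) 0; first by rewrite mul0r.
    by rewrite mulfV //; apply: contra tn0 => /eqP [->].
  + rewrite aE (dgmxM _ _ Vu); apply: (f_equal (dgmx V)); apply/funext => k.
    have [->|_] := eqVneq (th k) 0; last by rewrite mulr1.
    by rewrite mulr0; apply: complexP.
- move=> x ax; split.
  + by move=> t; apply: (comm x ax (fun w => expi (Num.sg w * t))).
  + by apply: (comm x ax (fun w => (w != 0)%:R)).
  + by apply: (comm x ax (fun w => imag (Num.sg w))).
- move=> x ax; split.
  + move=> t; rewrite /expcurve adj_dgmx.
    apply: (anti x (fun w => expi (Num.sg w * t))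
                   (fun w => Num.conj (expi (Num.sg w * t))) ax) => w.
    by rewrite sgrN mulNr conj_expi.
  + apply: (anti x (fun w => (w != 0)%:R) (fun w => (w != 0)%:R) ax) => w.
    by rewrite oppr_eq0.
  + rewrite -mulmxN {2}/b dgmxN.
    apply: (anti x (fun w => imag (Num.sg w)) (fun w => - imag (Num.sg w)) ax).
    by move=> w; rewrite sgrN imagN.
Qed.

Lemma reflection_sq Pi : Pi *m Pi = Pi ->
  (1%:M - 2 *: Pi) *m (1%:M - 2 *: Pi) = 1%:M.
Proof.
move=> PP; rewrite mulmxBl mul1mx mulmxBr mulmx1.
rewrite -scalemxAl -scalemxAr PP scalerA -scalerBl.
have -> : 2 - 2 * 2 = - 2 :> C by ring.
by rewrite scaleNr opprK subrK.
Qed.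

Lemma reflection_comm Pi x : Pi *m x = x *m Pi ->
  (1%:M - 2 *: Pi) *m x = x *m (1%:M - 2 *: Pi).
Proof.
by move=> Px; rewrite mulmxBl mulmxBr mulmx1 mul1mx -scalemxAl -scalemxAr Px.
Qed.

(** Induction on the rank of [Pi]: a generator [a] supported on [Pi] rotates its own support [Pi1]
    away, and the trace condition passes to [Pi - Pi1]. *)
Lemma connect_reflection s J Pi : clifford (J :: s) -> cliffs s J ->
  {in J :: s, forall a, adjmx a = - a} ->
  {in J :: s, forall a, Pi *m a = a *m Pi} ->
  Pi *m Pi = Pi -> adjmx Pi = Pi -> \tr (mprod (rev s) *m J *m Pi) = 0 ->
  connected_component (cliffs s) J (J *m (1%:M - 2 *: Pi)).
Proof.
move=> ce Jc sk.
have [n le_n] := ubnP (\rank Pi); elim: n => // n IH in Pi le_n *.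
move=> Pe PP Pa tr0; have [->|Pn0] := eqVneq Pi 0.
  by rewrite scaler0 subr0 mulmx1; exact: connected_component_refl.
have [a [an0 ask [ac aJ] Pia]] :=
  csplit_support_skew ce sk Pe PP Pa tr0 Pn0.
have aPi : a *m Pi = a.
  have := congr1 (@adjmx _ _ _) Pia; rewrite adjmxM Pa ask mulNmx.
  by move/oppr_inj.
have PJ : Pi *m J = J *m Pi by apply: Pe; rewrite mem_head.
have Ps b : b \in s -> Pi *m b = b *m Pi by move=> bs; apply: Pe;
  rewrite inE bs orbT.
have [E [Pi1 [b [c [[Eu Ed E0 Epi] [Pi1Pi1 Pi1a bb Pi1E aPi1] comm anti]]]]] :=
  skew_phase ask.
have [EJ Pi1J bJ] := anti J aJ.
have PPi1 : Pi *m Pi1 = Pi1 by rewrite Pi1E mulmxA Pia.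
have Pi1P : Pi1 *m Pi = Pi1.
  by have := congr1 (@adjmx _ _ _) PPi1; rewrite adjmxM Pa Pi1a.
(* [Pi1] is [- b^2], and [b] commutes with [s] but anticommutes with [J], hence anticommutes with
   their product; cyclicity of the trace gives zero. *)
have trPi1 : \tr (mprod (rev s) *m J *m Pi1) = 0.
  have bw : b *m (mprod (rev s) *m J) = - (mprod (rev s) *m J *m b).
    have bm : b *m mprod (rev s) = mprod (rev s) *m b.
      by apply: mprod_commr => q; rewrite mem_rev => /ac /comm [].
    by rewrite mulmxA bm -[in LHS]mulmxA bJ mulmxN mulmxA.
  move: bw; move: (mprod (rev s) *m J) => w bw.
  rewrite -[Pi1]opprK -bb mulmxN (raddfN (@mxtrace _ _)) /= mulmxA.
  have E1 : \tr (w *m b *m b) = - \tr (w *m b *m b).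
    rewrite [LHS]mxtrace_mulC mulmxA bw mulNmx.
    by rewrite (raddfN (@mxtrace _ _)).
  move/eqP: E1; rewrite -addr_eq0 -mulr2n mulrn_eq0 /= => /eqP ->.
  by rewrite oppr0.
have Pi1n0 : Pi1 != 0.
  by apply: contraNneq an0 => Pi10; rewrite -aPi1 Pi10 mulmx0.
have Pi'P : (Pi - Pi1) *m (Pi - Pi1) = Pi - Pi1.
  by rewrite mulmxBl !mulmxBr PP PPi1 Pi1P Pi1Pi1 subrr subr0.
have rk : \rank Pi = (\rank (Pi - Pi1)%R + \rank Pi1)%N.
  apply/eqP; rewrite -(eqr_nat C) natrD -!trace_idempotent //.
  by rewrite (raddfB (@mxtrace _ _)) /= subrK.
have conn' : connected_component (cliffs s) J (J *m (1%:M - 2 *: (Pi - Pi1))).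
  apply: (IH (Pi - Pi1) _ _ Pi'P).
  - move: le_n; rewrite rk ltnS; apply: leq_trans.
    by rewrite -addn1 leq_add2l lt0n mxrank_eq0.
  - move=> q; rewrite inE mulmxBl mulmxBr => /predU1P[->|qs].
      by rewrite PJ Pi1J.
    by have [_ -> _] := comm q (ac q qs); rewrite (Ps q qs).
  - by rewrite adjmxD adjmxN Pa Pi1a.
  - by rewrite mulmxBr (raddfB (@mxtrace _ _)) /= tr0 trPi1 subrr.
have D0J := reflection_comm PJ.
have D0s q (qs : q \in s) := reflection_comm (Ps q qs).
have D0E t : (1%:M - 2 *: Pi) *m E t = E t *m (1%:M - 2 *: Pi).
  have aP : a *m Pi = Pi *m a by rewrite aPi Pia.
  by have [EPi _ _] := comm Pi aP; apply: reflection_comm; rewrite EPi.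
have D0D0 := reflection_sq PP.
have D0a : adjmx (1%:M - 2 *: Pi) = 1%:M - 2 *: Pi.
  by rewrite adjmxD adjmxN adjmx1 adjmxZ Pa rmorph_nat.
have DE : (1%:M - 2 *: Pi) *m (1%:M - 2 *: Pi1) = 1%:M - 2 *: (Pi - Pi1).
  have aux (W : zmodType) (x y z : W) : x - z - (y - (z + z)) = x - (y - z).
    by rewrite !opprB -addrA (addrA (- z)) addKr.
  rewrite mulmxBl mul1mx mulmxBr mulmx1 -scalemxAl -scalemxAr PPi1.
  by rewrite (scaler_nat 2 (2 *: Pi1)) mulr2n scalerBr aux.
move: D0J D0s D0E D0D0 D0a DE.
move: (1%:M - 2 *: Pi) => D0 D0J D0s D0E D0D0 D0a DE.
have D0u : D0 \is unitarymx by apply/unitaryP; rewrite D0a.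
(* The path starts at [J] times the reflection in [Pi]; at time [pi] the factor [E] has become the
   reflection in [Pi1], which leaves that in [Pi - Pi1]. *)
have gN t : cliffs s (J *m (D0 *m E t)).
  apply: (cliffs_mul Jc).
  - exact: mul_unitarymx D0u (Eu t).
  - move=> q qs; have [Eq _ _] := comm q (ac q qs).
    by rewrite -mulmxA Eq !mulmxA D0s.
  - by rewrite -mulmxA EJ mulmxA D0J D0E adjmxM D0a mulmxA.
have gd t : exists V, mderiv (fun q => J *m (D0 *m E q)) t V.
  by have [V Ev] := Ed t; eexists; apply: mderivMl; apply: mderivMl; exact: Ev.
have := curve_component gd gN 0 pi; rewrite Epi E0 mulmx1 DE => H.
apply: connected_component_trans conn' _; exact: connected_component_sym.
Qed.

End Descent.

(** * Continuity of linear maps on matrices *)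

Section ContinuousLinearMaps.
Variable K : numFieldType.

Lemma continuous_ord_sum (T : topologicalType) n (f : 'I_n -> T -> K) :
  (forall i, continuous (f i)) -> continuous (fun x => \sum_i f i x).
Proof.
elim: n f => [|n IH] f cf x.
  under eq_fun do rewrite big_ord0; exact: cvg_cst.
under eq_fun do rewrite big_ord_recl.
apply: cvgD; first exact: cf.
by apply: (IH (fun i => f (lift ord0 i))) => i; exact: cf.
Qed.

Lemma continuousMcr (T : topologicalType) (f : T -> K) c :
  continuous f -> continuous (fun x => f x * c).
Proof. by move=> cf x; apply: (cvgM (cf x) (cvg_cst c)). Qed.

Lemma continuousMcl (T : topologicalType) (f : T -> K) c :
  continuous f -> continuous (fun x => c * f x).
Proof. by move=> cf x; apply: (cvgM (cvg_cst c) (cf x)). Qed.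

Lemma continuous_mulmxlr m n p q (A : 'M[K]_(m, n)) (B : 'M[K]_(p, q)) :
  continuous (fun X : 'M[K]_(n, p) => A *m X *m B).
Proof.
apply: continuous_mx => i j; under eq_fun do rewrite mxE.
apply: continuous_ord_sum => k; apply: continuousMcr.
under eq_fun do rewrite mxE.
apply: continuous_ord_sum => l; apply: continuousMcl.
exact: coord_continuous.
Qed.

Lemma continuous_trace n (A : 'M[K]_n) :
  continuous (fun X : 'M[K]_n => \tr (A *m X)).
Proof.
apply: continuous_ord_sum => i; under eq_fun do rewrite mxE.
apply: continuous_ord_sum => l; apply: continuousMcl.
exact: coord_continuous.
Qed.

End ContinuousLinearMaps.

(** * Integrality of traces of Clifford products *)

Section TraceOfInvolution.
Variables (C : numClosedFieldType) (r : nat).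
Local Notation M := ('M[C]_r).

(** Equals [(-1) ^ (n (n + 1) / 2)], the square of a product of [n] anticommuting generators of
    square -1. *)
Fixpoint sqsign n : C := if n is n'.+1 then - ((-1) ^+ n' * sqsign n') else 1.

Lemma mprod_sq (l : seq M) : clifford l ->
  mprod l *m mprod l = (sqsign (size l))%:M.
Proof.
elim: l => [|a l IH] ce; first by rewrite mul1mx.
have [/= /andP[al ul] sq an] := ce.
have cl : clifford l.
  split=> // [b bs|b c bs cs]; first by apply: sq; rewrite inE bs orbT.
  by apply: an; rewrite inE (bs, cs) orbT.
have ae : a \in a :: l by rewrite mem_head.
have le : {subset l <= a :: l} by move=> b bl; rewrite inE bl orbT.
have cnt : count (predC1 a) l = size l.
  by apply/eqP; rewrite -all_count; apply/allP => b bl /=;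
     apply: contraNneq al => <-.
rewrite -mulmxA (mulmxA (mprod l)) (mprod_comm ce le ae) cnt -scalemxAl.
rewrite -mulmxA (IH cl) -scalemxAr !mulmxA (sq a ae) mulNmx mul1mx scalerN.
by rewrite scale_scalar_mx raddfN.
Qed.

Lemma sqsignP n : sqsign n = 1 \/ sqsign n = -1.
Proof.
elim: n => [|n IH] /=; first by left.
rewrite -signr_odd; case: (odd n) IH => -[->|->]; rewrite ?expr0 ?expr1;
  by [left; ring | right; ring].
Qed.

Lemma sqsign_root n : exists k : C, k * k * sqsign n = 1 /\ k != 0.
Proof.
have [->|->] := sqsignP n; first by exists 1; rewrite !mulr1 oner_neq0.
by exists 'i; rewrite -expr2 sqrCi mulrNN mulr1 neq0Ci.
Qed.

(* [k * mprod l] is an involution; so the trace of [mprod l] takes discrete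
   values. *)
Lemma trace_mprod_int (l : seq M) k : clifford l ->
  k * k * sqsign (size l) = 1 ->
  exists p : nat, k * \tr (mprod l) = p.*2%:R - r%:R.
Proof.
move=> ce kk; pose Q := 2^-1 *: (1%:M + k *: mprod l).
have two0 : 2 != 0 :> C by rewrite pnatr_eq0.
have QQ : Q *m Q = Q.
  have kLkL : (k *: mprod l) *m (k *: mprod l) = 1%:M.
    by rewrite -scalemxAl -scalemxAr (mprod_sq ce) scalerA scale_scalar_mx kk.
  rewrite /Q; move: (k *: mprod l) kLkL => L LL.
  rewrite -scalemxAl -scalemxAr mulmxDl mul1mx mulmxDr mulmx1 LL.
  rewrite (addrC L) -mulr2n -(scaler_nat 2 (1%:M + L)).
  by congr (_ *: _); rewrite scalerA mulVf // scale1r.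
exists (\rank Q);
  rewrite -muln2 natrM -trace_idempotent // /Q mxtraceZ mxtraceD.
by rewrite mxtraceZ mxtrace1 mulrAC mulVf // mul1r addrC addKr.
Qed.

End TraceOfInvolution.

(** * Components classified by a trace *)

Section Components.
Variables (R : realType) (r : nat).
Local Notation C := (Cplx R).
Local Notation M := ('M[C]_r).
Implicit Types (s : seq M) (x y J D a Pi : M).
Hypothesis r_gt0 : (0 < r)%N.

Lemma cliffs_clifford s x : clifford s -> cliffs s x -> clifford (x :: s).
Proof.
move=> [us sq an] /cliffsP [_ xs xx].
(* A member of [s] would anticommute with itself, although its square is -1. *)
have xns : x \notin s.
  apply/negP => xI; have := xs x xI; rewrite xx opprK => /eqP.
  rewrite eq_sym -addr_eq0 -mulr2n -scaler_nat scalemx1 => /eqP/matrixP.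
  move=> /(_ (Ordinal r_gt0) (Ordinal r_gt0)); rewrite !mxE eqxx mulr1n.
  by move/eqP; rewrite pnatr_eq0.
split; first by rewrite /= xns.
- by move=> a; rewrite inE => /predU1P[->|/sq].
- move=> a b; rewrite !inE => /predU1P[->|as_] /predU1P[->|bs].
  + by rewrite eqxx.
  + by move=> _; exact: xs.
  + by move=> _; rewrite xs // opprK.
  + exact: an.
Qed.

Lemma clifford_rcons s x : clifford (x :: s) -> clifford (rev s ++ [:: x]).
Proof.
have mE b : (b \in rev s ++ [:: x]) = (b \in x :: s).
  by rewrite mem_cat mem_rev inE orbC inE.
move=> [us sq an]; split.
- by rewrite cats1 rcons_uniq mem_rev rev_uniq.
- by move=> a; rewrite mE; exact: sq.
- by move=> a b; rewrite !mE; exact: an.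
Qed.

(** Up to a fixed factor the trace is an integer with the parity of [r], while the image of a
    connected set is an interval: if two values occurred, so would one of the wrong parity, just
    above the smaller. *)
Lemma trace_const s (B : set M) x y : clifford s -> connected B ->
  B `<=` cliffs s -> B x -> B y ->
  \tr (mprod (rev s) *m x) = \tr (mprod (rev s) *m y).
Proof.
move=> cs cB Bs Bx By.
have [k [kk k0]] := @sqsign_root C (size s).+1.
pose h z := k * \tr (mprod (rev s) *m z).
have hint z : B z -> exists p : nat, h z = p.*2%:R - r%:R.
  move=> /Bs /(cliffs_clifford cs) /clifford_rcons ce.
  have := trace_mprod_int (k := k) ce; rewrite size_cat size_rev addn1.
  by rewrite mprod_cat /= mulmx1; exact.
have hE z : B z -> h z = real_complex R (complex.Re (h z)).
  move=> /hint [p ->]; apply: complexP => //=.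
  have -> : (p.*2%:R - r%:R : C) = real_complex R (p.*2%:R - r%:R).
    by rewrite rmorphB !rmorph_nat.
  by [].
pose f z := complex.Re (h z).
have fc : continuous f.
  move=> z; apply: (continuous_comp (f := h) (g := @complex.Re R)).
    by apply: continuousMcl; exact: continuous_trace.
  exact: continuous_Re.
have fint z : B z -> exists p : nat, f z = p.*2%:R - r%:R.
  move=> /hint [p E]; exists p; rewrite /f E.
  have -> : (p.*2%:R - r%:R : C) = real_complex R (p.*2%:R - r%:R).
    by rewrite rmorphB !rmorph_nat.
  by [].
have /connected_intervalP If : connected (f @` B).
  by apply: connected_continuous_connected => //; exact: continuous_subspaceT.
have key u v : B u -> B v -> f v <= f u.
  move=> Bu Bv; rewrite leNgt; apply/negP => fuv.
  have [p Ep] := fint u Bu; have [q Eq] := fint v Bv.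
  have lpq : p.*2.+2%:R <= q.*2%:R :> R.
    have : p.*2%:R < q.*2%:R :> R by move: fuv; rewrite Ep Eq ltrD2r.
    by rewrite ltr_nat ler_nat ltn_double -doubleS leq_double.
  have : (f @` B) (f u + 1).
    apply: (If (f u) (f v)); [by exists u | by exists v |].
    rewrite lerDl ler01 /= Ep Eq addrAC lerD2r.
    by move: lpq; rewrite -addn2 natrD; lra.
  move=> [w Bw]; have [p' ->] := fint w Bw; rewrite Ep addrAC => /addIr.
  rewrite natr1 => /eqP; rewrite eqr_nat => /eqP /(congr1 odd).
  by rewrite /= !odd_double.
have E : f x = f y by apply/eqP; rewrite eq_le !key.
by apply: (mulfI k0); rewrite -/(h x) -/(h y) hE // [RHS]hE // -/(f x) E.
Qed.

(** [J (1 - 2 Pi)] lies in the component of [x], so the product has the same trace there as at [J].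
    The two differ by twice the trace of the product on [Pi], which must therefore vanish, as
    [connect_reflection] requires. *)
Lemma cliffs_connected s x J : clifford s ->
  {in s, forall a, adjmx a = - a} -> cliffs s x -> cliffs s J ->
  \tr (mprod (rev s) *m x) = \tr (mprod (rev s) *m J) ->
  connected_component (cliffs s) J x.
Proof.
move=> cs sk xc Jc trE.
have [Pi [PP Pa Ps PJ conn]] := eigen_retract xc Jc.
have /cliffsP [Ju _ JJ] := Jc.
have sk' : {in J :: s, forall a, adjmx a = - a}.
  move=> a; rewrite inE => /predU1P[->|/sk //]; exact: unitary_sqN1_adj.
have Pe : {in J :: s, forall a, Pi *m a = a *m Pi}.
  by move=> a; rewrite inE => /predU1P[->|/Ps].
apply: (connected_component_trans _ conn).
apply: connect_reflection => //; first exact: cliffs_clifford.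
have yc : cliffs s (J *m (1%:M - 2 *: Pi)).
  apply: contrapT => H; move: conn.
  by rewrite connected_component_out.
have := @trace_const s _ _ _ cs (@component_connected _ (cliffs s) _)
  (@connected_component_sub _ _ _) (connected_component_refl yc) conn.
rewrite trE mulmxA mulmxBr mulmx1 (raddfB (@mxtrace _ _)) /= -scalemxAr mxtraceZ.
move=> /eqP; rewrite subr_eq -[X in X == _]addr0 (inj_eq (addrI _)).
by rewrite eq_sym mulf_eq0 pnatr_eq0 /= => /eqP.
Qed.

End Components.

(** * Components under continuous maps *)

Lemma continuous_entry (T : topologicalType) m n (i : 'I_m) (j : 'I_n) :
  continuous (fun X : 'M[T]_(m, n) => X i j).
Proof.
move=> X A XA.
exists (fun i' j' => [set z | (i', j') = (i, j) -> A z]) => [i' j'|Y YA].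
  have [[-> ->]|ne] := pselect ((i', j') = (i, j)).
    by apply: filterS XA => z Az.
  by apply: filterS (@filterT _ (nbhs (X i' j')) _) => z _ /ne.
exact: (YA i j erefl).
Qed.

Lemma component_image (T U : topologicalType) (f : T -> U) (A : set T)
  (B : set U) x y : continuous f -> (forall z, A z -> B (f z)) ->
  connected_component A x y -> connected_component B (f x) (f y).
Proof.
move=> cf AB xy.
have Ax : A x.
  by apply: contrapT => H; move: xy; rewrite connected_component_out.
apply: (@connected_component_max _ _ (f @` connected_component A x)).
- by exists x => //; exact: connected_component_refl.
- by move=> _ [z /connected_component_sub /AB ? <-].
- apply: connected_continuous_connected; first exact: component_connected.
  exact: continuous_subspaceT.
- by exists y.
Qed.

Lemma saturated_component (R : realType) m (K : 'M[Cplx R]_m) Cs As fl x :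
  cliffset K Cs As fl x ->
  saturated K Cs As fl (connected_component (cliffset K Cs As fl) x).
Proof.
move=> Zx; split=> [|y A xy cA Ay AZ]; first exact: connected_component_sub.
move=> z Az; apply: connected_component_trans xy _.
exact: (connected_component_max Ay AZ cA Az).
Qed.

(** * The inclusion of [U_r] in [Sp_r] *)

Section Embedding.
Variables (R : realType) (r : nat).
Local Notation C := (Cplx R).
Local Notation M := ('M[C]_r).
Local Notation MM := ('M[C]_(r + r)).
Implicit Types (s : seq M) (x y j a b : M) (X Y : MM).

Definition emb (B : M) : MM := block_mx B 0 0 (map_mx Num.conj B).

(** The quaternionic structure: [X K = K conj(X)] says that [X] commutes with the antilinear map
    [v |-> K conj(v)]. *)
Definition K_mx : MM := block_mx 0 (- 1%:M) 1%:M 0.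

Lemma emb_ul B : ulsubmx (emb B) = B.
Proof. exact: block_mxKul. Qed.

Lemma emb_inj : injective emb.
Proof. exact: can_inj emb_ul. Qed.

Lemma conj_mx0 n p : map_mx Num.conj (0 : 'M[C]_(n, p)) = 0.
Proof. exact: map_mx0. Qed.

Lemma embM a b : emb a *m emb b = emb (a *m b).
Proof.
by rewrite /emb mulmx_block !mul0mx !mulmx0 !addr0 !add0r conj_mxM.
Qed.

Lemma embD a b : emb a + emb b = emb (a + b).
Proof. by rewrite /emb add_block_mx !addr0 conj_mxD. Qed.

Lemma emb0 : emb 0 = 0.
Proof. by rewrite /emb conj_mx0 block_mx_const. Qed.

Lemma embN a : - emb a = emb (- a).
Proof.
by apply/eqP; rewrite eq_sym -addr_eq0 embD addNr emb0.
Qed.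

Lemma embZ (c : R) a : real_complex R c *: emb a = emb (real_complex R c *: a).
Proof.
rewrite /emb scale_block_mx !scaler0 conj_mxZ.
by have -> : Num.conj (real_complex R c : C) = real_complex R c by
  apply: complexP; rewrite ?ReJ ?ImJ /= ?oppr0.
Qed.

Lemma emb1 : emb 1%:M = 1%:M.
Proof.
rewrite /emb; have -> : map_mx Num.conj (1%:M : M) = 1%:M.
  exact: map_mx1.
by rewrite -scalar_mx_block.
Qed.

Lemma emb_adj a : adjmx (emb a) = emb (adjmx a).
Proof.
rewrite /adjmx /emb map_block_mx tr_block_mx !conj_mx0 !trmx0.
by congr block_mx; rewrite map_trmx.
Qed.

Lemma emb_unitary a : emb a \is unitarymx <-> a \is unitarymx.
Proof.
rewrite !unitaryP emb_adj embM -emb1; split=> [/emb_inj //|->//].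
Qed.

Lemma emb_sum d (c : 'I_d -> R) (b : 'I_d -> M) :
  \sum_k real_complex R (c k) *: emb (b k) =
  emb (\sum_k real_complex R (c k) *: b k).
Proof.
elim: d c b => [|d IH] c b; first by rewrite !big_ord0 emb0.
by rewrite !big_ord_recl embZ -embD -IH.
Qed.

Lemma emb_K a : emb a *m K_mx = K_mx *m map_mx Num.conj (emb a).
Proof.
rewrite /emb map_block_mx !conj_mx0 conj_mxK /K_mx !mulmx_block.
rewrite !(mulmx0, mul0mx, mulmx1, mul1mx, addr0, add0r).
by rewrite mulmxN mulNmx mulmx1 mul1mx.
Qed.

Lemma A_mx_mul (a b c d : M) :
  A_mx R r *m block_mx a b c d =
    block_mx ('i *: a) ('i *: b) (- ('i *: c)) (- ('i *: d)) /\
  block_mx a b c d *m A_mx R r =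
    block_mx ('i *: a) (- ('i *: b)) ('i *: c) (- ('i *: d)).
Proof.
have iE (X : M) : 'i%:M *m X = 'i *: X by rewrite mul_scalar_mx.
have iE' (X : M) : X *m 'i%:M = 'i *: X by rewrite scalar_mxC mul_scalar_mx.
rewrite /A_mx; move: ('i%:M) iE iE' => I iE iE'.
by rewrite !mulmx_block !mul0mx !mulmx0 !mulmxN !mulNmx !iE !iE' !addr0 !add0r.
Qed.

Lemma emb_A a : emb a *m A_mx R r = A_mx R r *m emb a.
Proof.
by rewrite /emb (A_mx_mul _ _ _ _).1 (A_mx_mul _ _ _ _).2 scaler0 oppr0.
Qed.

(** Commuting with [A_mx] kills the off-diagonal blocks, which join its distinct eigenspaces; the
    [K_mx] relation makes the diagonal blocks conjugate. *)
Lemma embP X : X *m K_mx = K_mx *m map_mx Num.conj X ->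
  X *m A_mx R r = A_mx R r *m X -> X = emb (ulsubmx X).
Proof.
have XE := submxK X; set x := ulsubmx X in XE *; clearbody x.
move: (ursubmx X) (dlsubmx X) (drsubmx X) XE => b c d <- {X}.
rewrite (A_mx_mul _ _ _ _).1 (A_mx_mul _ _ _ _).2.
rewrite /K_mx map_block_mx !mulmx_block.
rewrite !mul0mx !mulmx0 !add0r !addr0 => /eq_block_mx [_ _ dE _].
move=> /eq_block_mx [_ bE cE _].
have half (Y : M) : - ('i *: Y) = 'i *: Y -> Y = 0.
  move/eqP; rewrite eq_sym -addr_eq0 -scalerDl scaler_eq0 -mulr2n mulrn_eq0.
  by rewrite (negPf (neq0Ci C)) /= => /eqP.
rewrite (half b bE) (half c (esym cE)) /emb; congr block_mx.
by rewrite -[LHS]mulmx1 dE mul1mx.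
Qed.

Lemma continuous_conj : continuous (Num.conj : C -> C).
Proof.
move=> z A /nbhs_ballP [e /= e0 HA]; apply/nbhs_ballP; exists e => // w zw.
by apply: HA; rewrite /ball /= -rmorphB norm_conjC.
Qed.

Lemma continuous_emb : continuous emb.
Proof.
apply: continuous_mx => i j.
case: (split_ordP i) => k ->; case: (split_ordP j) => l ->.
- have -> : (fun B => emb B (lshift r k) (lshift r l)) = fun B => B k l.
    by apply/funext => B; rewrite block_mxEul.
  exact: continuous_entry.
- have -> : (fun B => emb B (lshift r k) (rshift r l)) = fun=> 0.
    by apply/funext => B; rewrite block_mxEur mxE.
  exact: cst_continuous.
- have -> : (fun B => emb B (rshift r k) (lshift r l)) = fun=> 0.
    by apply/funext => B; rewrite block_mxEdl mxE.
  exact: cst_continuous.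
- have -> : (fun B => emb B (rshift r k) (rshift r l)) =
      Num.conj \o (fun B => B k l).
    by apply/funext => B; rewrite block_mxEdr mxE.
  move=> X; apply: continuous_comp; first exact: continuous_entry.
  exact: continuous_conj.
Qed.

Lemma continuous_ulsubmx : continuous (@ulsubmx C r r r r).
Proof.
apply: continuous_mx => i j.
have -> : (fun X : MM => ulsubmx X i j) = fun X => X (lshift r i) (lshift r j).
  by apply/funext => X; rewrite !mxE.
exact: continuous_entry.
Qed.

Definition embset s : set MM := [set X | exists2 a, a \in s & X = emb a].

Definition cliffU s : set MM := cliffset K_mx [set A_mx R r] (embset s) true.

Lemma cliffUP s X : cliffU s X <-> exists2 x, cliffs s x & X = emb x.
Proof.
split=> [[Xu XK XA Xs XX]|[x /cliffsP [xu xs xx] ->]].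
  have E := embP XK (XA _ erefl); exists (ulsubmx X) => //.
  move: (ulsubmx X) E => x xE; rewrite xE in Xu Xs XX; apply/cliffsP; split.
  - exact/emb_unitary.
  - move=> a as_; have := Xs (emb a); rewrite !embM embN => H.
    by apply: emb_inj; apply: H; exists a.
  - by apply: emb_inj; rewrite -embM XX // -embN emb1.
split.
- exact/emb_unitary.
- exact: emb_K.
- by move=> c ->; exact: emb_A.
- by move=> _ [a as_ ->]; rewrite !embM embN xs.
- by rewrite embM xx -embN emb1.
Qed.

Lemma clifftan_emb s x (A : MM) :
  clifftan K_mx [set A_mx R r] (embset s) true (emb x) A <->
  exists2 a, adjmx a = - a /\ csplit_space s x a & A = emb a.
Proof.
split=> [[Au AK AA As AX]|[a [au [as_ ax]] ->]].
  have E := embP AK (AA _ erefl); exists (ulsubmx A) => //.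
  move: (ulsubmx A) E => a aE; rewrite aE in Au As AX; split.
    by apply: emb_inj; rewrite -emb_adj Au embN.
  split; last by apply: emb_inj; rewrite -embM AX // embM embN.
  move=> b bs; apply: emb_inj; rewrite -!embM; apply: As; by exists b.
split.
- by rewrite emb_adj au embN.
- exact: emb_K.
- by move=> c ->; exact: emb_A.
- by move=> _ [b bs ->]; rewrite !embM as_.
- by rewrite !embM embN ax.
Qed.

End Embedding.

(** * Identification of the top-dimensional component *)

Section TopComponent.
Variables (R : realType) (r : nat).
Local Notation C := (Cplx R).
Local Notation M := ('M[C]_r).
Local Notation MM := ('M[C]_(r + r)).
Implicit Types (s : seq M) (x y j a b : M) (X Y : MM) (Q : set MM).

Lemma emb_mulVl x (X Y : MM) : x \is unitarymx ->
  emb x *m X = emb x *m Y -> X = Y.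
Proof.
move=> /emb_unitary xu /(congr1 (mulmx (adjmx (emb x)))).
by rewrite !mulmxadjA.
Qed.

(** Spanning is stated with complex coefficients, so that one family serves the complex trace count
    and, through [real_coef], the real tangent space. *)
Definition skew_basis s x d (b : 'I_d -> M) : Prop :=
  [/\ forall k, adjmx (b k) = - b k /\ csplit_space s x (b k), lin_indep b &
      forall a, csplit_space s x a -> adjmx a = - a ->
        exists c, a = \sum_k c k *: b k].

Lemma adj_sum_skew d (b : 'I_d -> M) (c : 'I_d -> C) :
  (forall k, adjmx (b k) = - b k) ->
  adjmx (\sum_k c k *: b k) = - \sum_k Num.conj (c k) *: b k.
Proof.
move=> bs; elim: d b c bs => [|d IH] b c bs.
  by rewrite !big_ord0 oppr0 /adjmx conj_mx0 trmx0.
rewrite !big_ord_recl adjmxD adjmxZ bs IH => [|k]; last exact: bs.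
by rewrite scalerN opprD.
Qed.

Lemma real_coef d (b : 'I_d -> M) (c : 'I_d -> C) : lin_indep b ->
  (forall k, adjmx (b k) = - b k) ->
  adjmx (\sum_k c k *: b k) = - (\sum_k c k *: b k) ->
  forall k, c k = real_complex R (complex.Re (c k)).
Proof.
move=> bi bs; rewrite adj_sum_skew // => /oppr_inj E k.
have : Num.conj (c k) - c k = 0.
  apply: (bi (fun k => Num.conj (c k) - c k)).
  by under eq_bigr do rewrite scalerBl; rewrite sumrB E subrr.
move=> /(congr1 (@complex.Im R)); rewrite ImD ImN ImJ /= => I0.
by apply: complexP => //=; lra.
Qed.

(** Taking the adjoint of a complex relation conjugates its coefficients; the sum and, up to a
    factor ['i], the difference of the two are real relations. *)
Lemma lin_indep_skew d (b : 'I_d -> M) : (forall k, adjmx (b k) = - b k) ->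
  (forall c : 'I_d -> R, \sum_k real_complex R (c k) *: b k = 0 ->
     forall k, c k = 0) -> lin_indep b.
Proof.
move=> bs bi c E.
have E' : \sum_k Num.conj (c k) *: b k = 0.
  have := congr1 (@adjmx _ _ _) E; rewrite adj_sum_skew // => /eqP.
  by rewrite /adjmx conj_mx0 trmx0 oppr_eq0 => /eqP.
have Re0 k : complex.Re (c k) = 0.
  have -> : complex.Re (c k) = complex.Re (c k + Num.conj (c k)) / 2.
    by rewrite ReD ReJ; lra.
  apply/eqP; rewrite mulf_eq0 invr_eq0 pnatr_eq0 orbF; apply/eqP.
  apply: (bi (fun k => complex.Re (c k + Num.conj (c k)))).
  transitivity (\sum_k c k *: b k + \sum_k Num.conj (c k) *: b k);
    last by rewrite E E' addr0.
  rewrite -big_split /=; apply: eq_bigr => l _.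
  rewrite -scalerDl; congr (_ *: _).
  by apply: complexP; rewrite //= ImD ImJ subrr.
have Im0 k : complex.Im (c k) = 0.
  have -> : complex.Im (c k) = complex.Im (c k - Num.conj (c k)) / 2.
    by rewrite ImD ImN ImJ; lra.
  apply/eqP; rewrite mulf_eq0 invr_eq0 pnatr_eq0 orbF; apply/eqP.
  apply: (bi (fun k => complex.Im (c k - Num.conj (c k)))).
  apply: (scalerI (neq0Ci C)); rewrite scaler0 scaler_sumr.
  have iE (w : R) : 'i * real_complex R w = Complex 0 w :> C.
    rewrite -complexiE; apply: complexP; rewrite ?ReM ?ImM /=; ring.
  under eq_bigr do rewrite scalerA iE.
  transitivity (\sum_k (c k - Num.conj (c k)) *: b k).
    apply: eq_bigr => l _; congr (_ *: _).
    by apply: complexP; rewrite //= ReD ReN ReJ subrr.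
  by under eq_bigr do rewrite scalerBl; rewrite sumrB E E' subrr.
by move=> k; apply: complexP; rewrite ?Re0 ?Im0.
Qed.

(** Left translation reduces tangent vectors at [emb x] to skew-Hermitian members of
    [csplit_space s x]; skewness then lets real and complex coefficients be exchanged. *)
Lemma tangent_dim_emb s x Q d :
  saturated (K_mx R r) [set A_mx R r] (embset s) true Q -> Q (emb x) ->
  tangent_dim Q (emb x) d <-> exists b : 'I_d -> M, skew_basis s x b.
Proof.
move=> sQ Qx.
have xu : x \is unitarymx by apply/emb_unitary; have [] := sQ.1 _ Qx.
have tE v : tangent Q (emb x) v <->
    exists2 a, adjmx a = - a /\ csplit_space s x a & v = emb x *m emb a.
  split=> [/(tangentP sQ _ Qx) [A /clifftan_emb [a aP ->] ->]|[a aP ->]].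
    by exists a.
  by apply/(tangentP sQ _ Qx); exists (emb a) => //; apply/clifftan_emb;
    exists a.
have sumE (c : 'I_d -> R) (b : 'I_d -> M) :
    \sum_k real_complex R (c k) *: (emb x *m emb (b k)) =
    emb x *m emb (\sum_k real_complex R (c k) *: b k).
  by rewrite -emb_sum mulmx_sumr; apply: eq_bigr => k _; rewrite scalemxAr.
split.
- move=> [B [Bi Bs]].
  have /choice [b bP] : forall k : 'I_d, exists a,
      (adjmx a = - a /\ csplit_space s x a) /\ B k = emb x *m emb a.
    move=> k; have : tangent Q (emb x) (B k).
      rewrite Bs; exists (fun l => (l == k)%:R).
      rewrite (bigD1 k) //= eqxx rmorph1 scale1r big1 ?addr0 // => l lk.
      by rewrite (negPf lk) rmorph0 scale0r.
    by move=> /tE [a aP aE]; exists a.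
  have BE : B = fun k => emb x *m emb (b k).
    by apply/funext => k; have [_ ->] := bP k.
  rewrite BE in Bi Bs.
  have bs k : adjmx (b k) = - b k by have [[]] := bP k.
  exists b; split; first by move=> k; have [] := bP k.
    apply: lin_indep_skew => // c E; apply: Bi.
    by rewrite sumE E emb0 mulmx0.
  move=> a aV ask; have : tangent Q (emb x) (emb x *m emb a).
    by apply/tE; exists a.
  rewrite Bs => -[c]; rewrite sumE => /(emb_mulVl xu) /emb_inj ->.
  by exists (fun k => real_complex R (c k)).
- move=> [b [bP bi bspan]]; exists (fun k => emb x *m emb (b k)).
  have bs k : adjmx (b k) = - b k by have [] := bP k.
  split=> [c|].
    rewrite sumE -(mulmx0 _ (emb x)) => /(emb_mulVl xu).
    rewrite -(emb0 R r) => /emb_inj /bi H k.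
    by have := H k; move=> /(congr1 (@complex.Re R)).
  apply/seteqP; split=> v; first move=> /tE [a [ask aV] ->].
    have [c aE] := bspan a aV ask.
    exists (fun k => complex.Re (c k)); rewrite sumE aE; congr (_ *m emb _).
    rewrite aE in ask; apply: eq_bigr => k _.
    by rewrite -(real_coef bi bs ask).
  move=> [c ->]; rewrite sumE; apply/tE.
  exists (\sum_k real_complex R (c k) *: b k) => //; split.
    rewrite adj_sum_skew //; congr (- _); apply: eq_bigr => k _.
    by congr (_ *: _); apply: complexP; rewrite ?ReJ ?ImJ /= ?oppr0.
  by apply: csplit_space_sum => k; have [] := bP k.
Qed.

Hypothesis r_gt0 : (0 < r)%N.

Lemma skew_basis_dim s x d (b : 'I_d -> M) : clifford s ->
  {in s, forall a, adjmx a = - a} -> cliffs s x -> skew_basis s x b ->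
  2 ^+ (size s).+1 * d%:R = r%:R ^+ 2 -
    \tr (mprod (rev s) *m x) * Num.conj (\tr (mprod (rev s) *m x)).
Proof.
move=> cs sk xc [bP bi bspan]; apply: (csplit_dim (b := b)) => //.
- exact: cliffs_clifford.
- move=> a; rewrite inE => /predU1P[->|/sk //].
  by have /cliffsP [xu _ xx] := xc; exact: unitary_sqN1_adj.
- by move=> k; have [] := bP k.
Qed.

Lemma skew_basis_exists s x : exists d (b : 'I_d -> M), skew_basis s x b.
Proof.
have [d [b [bS bi bspan]]] :=
  maximal_indep [set a | adjmx a = - a /\ csplit_space s x a].
by exists d, b; split=> // a aV ask; exact: bspan.
Qed.

Lemma cliffU_trace_const s (B : set MM) X Y : clifford s -> connected B ->
  B `<=` cliffU s -> B X -> B Y ->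
  \tr (mprod (rev s) *m ulsubmx X) = \tr (mprod (rev s) *m ulsubmx Y).
Proof.
move=> cs cB Bs BX BY.
apply: (trace_const r_gt0 (B := @ulsubmx C r r r r @` B) cs).
- apply: connected_continuous_connected => //.
  by apply: continuous_subspaceT; exact: continuous_ulsubmx.
- by move=> _ [Z /Bs /cliffUP [z zc ->] <-]; rewrite emb_ul.
- by exists X.
- by exists Y.
Qed.

Lemma cliffU_connected s x j : clifford s -> {in s, forall a, adjmx a = - a} ->
  cliffs s x -> cliffs s j ->
  \tr (mprod (rev s) *m x) = \tr (mprod (rev s) *m j) ->
  connected_component (cliffU s) (emb j) (emb x).
Proof.
move=> cs sk xc jc trE; apply: (component_image (A := cliffs s)).
- exact: continuous_emb.
- by move=> z zc; apply/cliffUP; exists z.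
- exact: cliffs_connected.
Qed.

(** Maximality is tested against the component of [j], where the trace vanishes identically; the
    inequality of dimensions then bounds the squared modulus of the trace at [x] by zero. *)
Lemma top_component s j Q : clifford s -> {in s, forall a, adjmx a = - a} ->
  cliffs s j -> \tr (mprod (rev s) *m j) = 0 ->
  top_dim (is_component (cliffU s)) Q ->
  Q = connected_component (cliffU s) (emb j).
Proof.
move=> cs sk jc trj [[X /cliffUP [x xc ->] QE] [d Qd dmax]].
have Zx : cliffU s (emb x) by apply/cliffUP; exists x.
have Zj : cliffU s (emb j) by apply/cliffUP; exists j.
suff trx : \tr (mprod (rev s) *m x) = 0.
  rewrite QE; symmetry; apply: same_connected_component.
  by apply: cliffU_connected => //; rewrite trx trj.
have sQ : saturated (K_mx R r) [set A_mx R r] (embset s) true Q.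
  by rewrite QE; exact: saturated_component.
have Qx : Q (emb x) by rewrite QE; exact: connected_component_refl.
have /(tangent_dim_emb _ sQ Qx) [b bb] := Qd _ Qx.
have dE := skew_basis_dim cs sk xc bb.
pose Q' := connected_component (cliffU s) (emb j).
have Q'j : Q' (emb j) by exact: connected_component_refl.
have sQ' : saturated (K_mx R r) [set A_mx R r] (embset s) true Q'.
  exact: saturated_component.
have Q'tr y : Q' (emb y) -> \tr (mprod (rev s) *m y) = 0.
  move=> Q'y; rewrite -[y]emb_ul -trj -{1}[j]emb_ul.
  apply: (cliffU_trace_const (B := Q')) => //.
    exact: component_connected.
  exact: connected_component_sub.
have [d' [b' bb']] := skew_basis_exists s j.
have d'E := skew_basis_dim cs sk jc bb'; rewrite trj mul0r subr0 in d'E.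
have two0 : 2 ^+ (size s).+1 != 0 :> C by rewrite expf_neq0 // pnatr_eq0.
(* [has_dim] demands one dimension at all points; constancy of the trace on the component provides
   it. *)
have Q'd : has_dim Q' d'.
  move=> Y Q'Y; have /cliffUP [y yc YE] := sQ'.1 _ Q'Y; rewrite YE in Q'Y *.
  apply/(tangent_dim_emb _ sQ' Q'Y).
  have [e [f ff]] := skew_basis_exists s y.
  suff -> : d' = e by exists f.
  have eE := skew_basis_dim cs sk yc ff.
  rewrite (Q'tr y Q'Y) mul0r subr0 -d'E in eE.
  by have /(mulfI two0) /eqP := eE; rewrite eqr_nat => /eqP ->.
have /(dmax _ _) : is_component (cliffU s) Q' by exists (emb j).
move=> /(_ _ Q'd) d'd.
apply/eqP; rewrite -normr_eq0 -sqrf_eq0 normCK eq_le; apply/andP; split;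
  last first.
  by rewrite mul_conjC_ge0.
have := dE; rewrite -d'E => /eqP;
  rewrite eq_sym subr_eq addrC -subr_eq => /eqP <-.
by rewrite subr_le0 ler_wpM2l ?ler_nat // exprn_ge0.
Qed.

End TopComponent.

(** * Connectedness of the unitary group *)

Section UnitaryConnected.
Variables (R : realType) (r : nat).
Local Notation C := (Cplx R).

Lemma unitary_connected (x : 'M[C]_r) : x \is unitarymx ->
  connected_component [set u : 'M[C]_r | u \is unitarymx] 1%:M x.
Proof.
move=> /unitary_spectral [V [l [Vu -> l1]]].
have E0 := expcurve0 (fun k => arg (l k)) Vu.
have E1 : expcurve V (fun k => arg (l k)) 1 = dgmx V l.
  apply: (f_equal (dgmx V)); apply/funext => k.
  by rewrite mulr1 expi_arg.
rewrite -E0 -E1; apply: (curve_component (g := expcurve V _)) => t.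
  by eexists; exact: expcurve_deriv.
exact: expcurve_unitary.
Qed.

End UnitaryConnected.

(** * [Sp], [U] and the involution in terms of Clifford sets *)

Section GroupsAsCliffordSets.
Variables (R : realType) (r : nat).
Local Notation C := (Cplx R).
Local Notation MM := ('M[C]_(r + r)).
Implicit Types (X : MM).

Lemma Sp_K X : (exists A B : 'M[C]_r,
    X = block_mx A (- map_mx Num.conj B) B (map_mx Num.conj A)) <->
  X *m K_mx R r = K_mx R r *m map_mx Num.conj X.
Proof.
split=> [[A [B ->]]|].
  rewrite /K_mx map_block_mx conj_mxK !mulmx_block.
  rewrite !mul0mx !mulmx0 !add0r !addr0 !mulmx1 !mul1mx !mulNmx !mul1mx.
  rewrite !mulmxN !mulmx1; congr block_mx.
  by rewrite -[RHS]/(map_mx Num.conj (- map_mx Num.conj B));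
    apply/matrixP => i j;
     rewrite !mxE rmorphN /= conjCK.
have XE := submxK X.
move: (ulsubmx X) (ursubmx X) (dlsubmx X) (drsubmx X) XE => a b c d <- {X}.
rewrite /K_mx map_block_mx !mulmx_block.
rewrite !mul0mx !mulmx0 !add0r !addr0 => /eq_block_mx [bE _ dE _].
exists a, c; congr block_mx.
- by rewrite -[LHS]mulmx1 bE mulNmx mul1mx.
- by rewrite -[LHS]mulmx1 dE mul1mx.
Qed.

Lemma Sp_setE : @Sp_set R r = cliffset (K_mx R r) set0 set0 false.
Proof.
by apply/seteqP; split=> X; [move=> [Xu /Sp_K XK] | move=> [Xu XK _ _ _]];
  split=> //; apply/Sp_K.
Qed.

Lemma U_setP X : @U_set R r X <-> exists2 x, x \is unitarymx & X = emb x.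
Proof.
split=> [[_ [x [xu ->]]]|[x xu ->]]; first by exists x.
split; last by exists x.
rewrite Sp_setE; split=> //; first exact/emb_unitary.
exact: emb_K.
Qed.

Lemma U_setE : @U_set R r = cliffset (K_mx R r) [set A_mx R r] set0 false.
Proof.
apply/seteqP; split=> X.
  move=> /U_setP [x xu ->]; split=> //; first exact/emb_unitary.
  - exact: emb_K.
  - by move=> _ ->; exact: emb_A.
move=> [Xu XK XA _ _]; have E := embP XK (XA _ erefl).
by apply/U_setP; exists (ulsubmx X) => //; apply/emb_unitary; rewrite -E.
Qed.

Lemma U_set_connected :
  @U_set R r = connected_component (@U_set R r) 1%:M.
Proof.
apply/seteqP; split; last exact: connected_component_sub.
move=> X /U_setP [x xu ->]; rewrite -(emb1 R r).
apply: (component_image (A := [set u : 'M[C]_r | u \is unitarymx])).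
- exact: continuous_emb.
- by move=> z zu; apply/U_setP; exists z.
- exact: unitary_connected.
Qed.

Lemma SO_emb X : @SO_set R r X ->
  X = emb (ulsubmx X) /\ ulsubmx X \is unitarymx.
Proof.
move=> [A [AA _ ->]]; rewrite block_mxKul.
set B := map_mx _ A.
have BJ : map_mx Num.conj B = B.
  apply/matrixP => i j; rewrite !mxE; apply: complexP; rewrite ?ReJ ?ImJ //=.
  by rewrite oppr0.
split; first by rewrite /emb BJ.
by apply/unitaryP; rewrite /adjmx BJ /B map_trmx -map_mxM AA map_mx1.
Qed.

Lemma A_mx_sq : A_mx R r *m A_mx R r = - 1%:M.
Proof.
have AE : A_mx R r = emb ('i%:M).
  rewrite /A_mx /emb; congr block_mx.
  by apply/matrixP => i j; rewrite !mxE rmorphMn /= conjCi mulNrn.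
have i2 : 'i%:M *m 'i%:M = - 1%:M :> 'M[C]_r.
  by rewrite mul_scalar_mx scale_scalar_mx -expr2 sqrCi raddfN.
by rewrite AE embM i2 -embN emb1.
Qed.

Lemma tauE X : @tau R r X = A_mx R r *m X *m - A_mx R r.
Proof.
have E : A_mx R r *m - A_mx R r = 1%:M by rewrite mulmxN A_mx_sq opprK.
have [Au _] := mulmx1_unit E.
by rewrite /tau; congr (_ *m _); rewrite -[RHS](mulKmx Au) E mulmx1.
Qed.

Lemma tauK X : tau (tau X) = X.
Proof.
rewrite !tauE; move: (A_mx R r) A_mx_sq => A AA.
have NN : (- A) *m (- A) = - 1%:M by rewrite mulmxN mulNmx opprK.
by rewrite -!mulmxA NN mulmxN mulmx1 mulmxA AA mulNmx mul1mx opprK.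
Qed.

Lemma tau_fixP X : tau X = X <-> X *m A_mx R r = A_mx R r *m X.
Proof.
rewrite tauE; split=> [E|E].
  by rewrite -[in LHS]E -mulmxA mulNmx A_mx_sq opprK mulmx1.
by rewrite -E -mulmxA mulmxN A_mx_sq opprK mulmx1.
Qed.

(** [A_mx] itself satisfies the [Sp] relations and commutes with [As], so conjugation by it
    preserves every condition. *)
Lemma tau_cliffset As fl X :
  (forall b, As b -> b *m A_mx R r = A_mx R r *m b) ->
  cliffset (K_mx R r) set0 As fl X -> cliffset (K_mx R r) set0 As fl (tau X).
Proof.
move=> AsA [Xu XK _ XAs XX]; rewrite tauE.
have AE : A_mx R r = emb ('i%:M).
  rewrite /A_mx /emb; congr block_mx.
  by apply/matrixP => i j; rewrite !mxE rmorphMn /= conjCi mulNrn.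
have AK := emb_K ('i%:M : 'M[C]_r); rewrite -AE in AK.
have Aa : adjmx (A_mx R r) = - A_mx R r.
  rewrite AE emb_adj embN; congr emb; apply/matrixP => i j.
  by rewrite !mxE rmorphMn /= conjCi mulNrn eq_sym.
have Au : A_mx R r \is unitarymx.
  by apply/unitaryP; rewrite Aa mulmxN A_mx_sq opprK.
have NAu : - A_mx R r \is unitarymx.
  by apply/unitaryP; rewrite adjmxN Aa mulNmx opprK A_mx_sq opprK.
have conjN (Y : MM) : map_mx Num.conj (- Y) = - map_mx Num.conj Y.
  by apply/matrixP => i j; rewrite !mxE rmorphN.
have AA := A_mx_sq.
move: (A_mx R r) AK Au NAu AA AsA {AE Aa} => A AK Au NAu AA AsA.
split.
- by exact: mul_unitarymx (mul_unitarymx Au Xu) NAu.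
- have NK : - A *m K_mx R r = K_mx R r *m - map_mx Num.conj A.
    by rewrite mulNmx AK mulmxN.
  rewrite !conj_mxM conjN -[LHS]mulmxA NK [LHS]mulmxA -(mulmxA A) XK.
  by rewrite (mulmxA A) AK !mulmxA.
- by move=> c [].
- move=> b bA; have Nb : - A *m b = b *m - A.
    by rewrite mulNmx -(AsA b bA) mulmxN.
  rewrite -[LHS]mulmxA Nb [LHS]mulmxA -(mulmxA A) (XAs b bA).
  by rewrite (mulmxN A (b *m X)) (mulmxA A) -(AsA b bA) mulNmx !mulmxA.
- move=> f; have NA : - A *m A = 1%:M by rewrite mulNmx AA opprK.
  rewrite -!mulmxA (mulmxA (- A)) NA mul1mx (mulmxA X) (XX f) mulNmx mul1mx.
  by rewrite opprK AA.
Qed.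

Lemma continuous_tau : continuous (@tau R r).
Proof.
have -> : @tau R r = fun X => A_mx R r *m X *m - A_mx R r.
  by apply/funext => X; exact: tauE.
exact: continuous_mulmxlr.
Qed.

End GroupsAsCliffordSets.

(** * The two Bott chains *)

Section Chains.
Variables (R : realType) (r : nat).
Local Notation C := (Cplx R).
Local Notation MM := ('M[C]_(r + r)).
Variables (J : nat -> MM) (j : nat -> 'M[C]_r).
Hypothesis r_gt0 : (0 < r)%N.
Hypothesis JE : forall k, (k <= 8)%N -> J k = emb (j k).
Hypothesis ju : forall k, (k <= 8)%N -> j k \is unitarymx.
Hypothesis j0 : j 0%N = 1%:M.
Hypothesis jj : forall k, (0 < k <= 8)%N -> j k *m j k = - 1%:M.
Hypothesis ja : forall i k, (0 < i)%N -> (i < k)%N -> (k <= 8)%N ->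
  j k *m j i = - (j i *m j k).

(** The generators constraining the [k]-th space stop at index [k - 1]; the list is empty for
    [k = 0] and for [k = 1]. *)
Definition jlist k : seq 'M[C]_r := [seq j i | i <- iota 1 k.-1].

Lemma jlistP k a : a \in jlist k <-> exists2 i, (0 < i < k)%N & a = j i.
Proof.
split=> [/mapP [i iI ->]|[i iI ->]].
  by exists i => //; move: iI; rewrite mem_iota; lia.
by apply/mapP; exists i => //; rewrite mem_iota; lia.
Qed.

Lemma j_anti i k : (0 < i <= 8)%N -> (0 < k <= 8)%N -> i != k ->
  j i *m j k = - (j k *m j i).
Proof.
move=> /andP[i0 i8] /andP[k0 k8]; case: (ltngtP i k) => // ik _.
  by rewrite (ja i0 ik k8) opprK.
exact: ja.
Qed.

Lemma j_neq i k : (0 < i <= 8)%N -> (0 < k <= 8)%N -> i != k -> j i != j k.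
Proof.
move=> iI kI ik; apply: contraNneq (ik) => E; exfalso.
have := j_anti iI kI ik; rewrite E jj // opprK => /eqP.
rewrite eq_sym -addr_eq0 -mulr2n -scaler_nat scalemx1 => /eqP/matrixP.
move=> /(_ (Ordinal r_gt0) (Ordinal r_gt0)); rewrite !mxE eqxx mulr1n.
by move/eqP; rewrite pnatr_eq0.
Qed.

Lemma jlist_clifford k : (k <= 9)%N -> clifford (jlist k).
Proof.
move=> k9.
have rng i : (0 < i < k)%N -> (0 < i <= 8)%N.
  by lia.
have rngI i : i \in iota 1 k.-1 -> (0 < i <= 8)%N.
  by rewrite mem_iota; lia.
split.
- rewrite map_inj_in_uniq ?iota_uniq // => i l /rngI iI /rngI lI E.
  by apply/eqP; apply: contraT => il; have := j_neq iI lI il; rewrite E eqxx.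
- by move=> a /jlistP [i /rng iI ->]; exact: jj.
- move=> a b /jlistP [i /rng iI ->] /jlistP [l /rng lI ->] ab.
  by apply: j_anti => //; apply: contraNneq ab => ->.
Qed.

Lemma jlist_skew k : (k <= 9)%N -> {in jlist k, forall a, adjmx a = - a}.
Proof.
move=> k9 a /jlistP [i /andP[i0 ik] ->].
have i8 : (i <= 8)%N by rewrite -ltnS; exact: leq_trans ik k9.
by apply: unitary_sqN1_adj; [exact: ju | apply: jj; rewrite i0].
Qed.

Lemma j_cliffs k : (0 < k <= 8)%N -> cliffs (jlist k) (j k).
Proof.
move=> /andP[k0 k8]; apply/cliffsP; split; first exact: ju.
- move=> a /jlistP [i /andP[i0 ik] ->]; exact: ja.
- by apply: jj; rewrite k0.
Qed.

(* For [k <= 7] the next generator anticommutes with the product, and for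
   [k = 8] the last factor does. *)
Lemma j_trace0 k : (0 < k <= 8)%N -> \tr (mprod (rev (jlist k)) *m j k) = 0.
Proof.
move=> /andP[k0 k8]; have kI : (0 < k <= 8)%N by rewrite k0.
have ck1 : clifford (j k :: jlist k).
  apply: cliffs_clifford => //; last exact: j_cliffs.
  by apply: jlist_clifford; exact: leqW.
have cl := clifford_rcons ck1; have [ul _ _] := cl.
have sz : size (rev (jlist k) ++ [:: j k]) = k.
  by rewrite size_cat size_rev size_map size_iota addn1 prednK.
have -> : mprod (rev (jlist k)) *m j k =
    mprod (rev (jlist k) ++ [:: j k]) *m 1%:M.
  by rewrite mprod_cat /= !mulmx1.
have lE a : a \in rev (jlist k) ++ [:: j k] <->
    exists2 i, (0 < i < k.+1)%N & a = j i.
  rewrite mem_cat mem_rev inE; split.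
    move=> /orP[/jlistP [i /andP[i0 ik] ->]|/eqP ->]; last first.
      by exists k => //; rewrite k0 ltnSn.
    by exists i => //; rewrite i0 (leq_trans ik).
  move=> [i /andP[i0 ik] ->]; move: ik; rewrite ltnS leq_eqVlt.
  move=> /predU1P[->|ik]; first by rewrite eqxx orbT.
  by apply/orP; left; apply/jlistP; exists i => //; rewrite i0.
have comm1 (e : seq 'M[C]_r) : {in e, forall a, 1%:M *m a = a *m 1%:M}.
  by move=> a _; rewrite mul1mx mulmx1.
have [k7|k7] := leqP k 7.
  apply: (@trace_mprod0 _ _ (jlist k.+2)) => //; rewrite ?sz ?k0 //.
  - exact: jlist_clifford.
  - move=> a /lE [i /andP[i0 ik] ->]; apply/jlistP; exists i => //.
    by rewrite i0 (leq_trans ik).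
  - by rewrite size_map size_iota ltnSn.
apply: (@trace_mprod0 _ _ (rev (jlist k) ++ [:: j k])) => //; rewrite ?sz //.
by rewrite (_ : k = 8%N) ?orbT //; lia.
Qed.

Local Notation Zset Cs k :=
  (cliffset (K_mx R r) Cs (embset (jlist k)) (0 < k)%N).

Lemma embset_jlist k X : (k <= 9)%N ->
  embset (jlist k) X <-> exists2 i, (0 < i < k)%N & X = J i.
Proof.
move=> k9; split=> [[a /jlistP [i ik ->] ->]|[i ik ->]].
  by exists i => //; rewrite JE //; lia.
by exists (j i); [apply/jlistP; exists i | rewrite JE //; lia].
Qed.

Lemma embset_jlist0 : embset (jlist 0) = set0.
Proof. by apply/seteqP; split=> X // [a]. Qed.

Lemma J_unitary k : (k <= 8)%N -> J k \is unitarymx.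
Proof. by move=> k8; rewrite JE //; apply/emb_unitary; exact: ju. Qed.

Lemma J_sq k : (0 < k <= 8)%N -> J k *m J k = - 1%:M.
Proof.
move=> kI; have k8 : (k <= 8)%N by case/andP: kI.
by rewrite JE // embM jj // -embN emb1.
Qed.

Lemma J0 : J 0%N = 1%:M.
Proof. by rewrite JE // j0 emb1. Qed.

Lemma saturated_Zset Cs k : saturated (K_mx R r) Cs (embset (jlist k)) (0 < k)%N
  (Zset Cs k).
Proof. by split. Qed.

Lemma J_pole_eq k x : (0 < k <= 8)%N -> x *m x = - 1%:M ->
  x *m adjmx (J k) *m x = - J k <-> x *m J k = - (J k *m x).
Proof.
move=> kI xx; have k8 : (k <= 8)%N by case/andP: kI.
rewrite (unitary_sqN1_adj (J_unitary k8) (J_sq kI)) mulmxN mulNmx.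
split=> [/oppr_inj E|E].
  have := congr1 (mulmx x) E; rewrite !mulmxA xx mulNmx mul1mx mulNmx.
  by move=> <-.
by rewrite E mulNmx -mulmxA xx mulmxN mulmx1 opprK.
Qed.

(** For [k = 0] the midpoint equation is the square relation, as [J 0] is the identity; for [k > 0]
    that relation already holds and the equation becomes anticommutation with [J k]. Conversely, the
    rotation from [J k] to [x] stays in the Clifford set, which puts [x] in [P]. *)
Lemma centrosome_Zset Cs P k : (k <= 7)%N ->
  saturated (K_mx R r) Cs (embset (jlist k)) (0 < k)%N P -> P (J k) ->
  centrosome P (J k) (- J k) = Zset Cs k.+1.
Proof.
move=> k7 sP PJ; rewrite (centrosomeE sP PJ).
have k9 : (k <= 9)%N by lia.
have k19 : (k.+1 <= 9)%N by lia.
have relE x : Zset Cs k x -> x *m adjmx (J k) *m x = - J k <->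
    x *m x = - 1%:M /\ ((0 < k)%N -> x *m J k = - (J k *m x)).
  move=> [_ _ _ _ xf]; have [->|k0] := posnP k.
    by rewrite J0 adjmx1 mulmx1; split=> [|[]].
  have kI : (0 < k <= 8)%N by lia.
  by rewrite (J_pole_eq kI (xf k0)); split=> [E|[_ E]]; [split=> //; exact: xf|
    exact: E].
apply/seteqP; split=> x.
  move=> [Px xJx]; have Zx := sP.1 _ Px.
  have [xx xJ] := (relE x Zx).1 xJx; have [xu xK xC xA _] := Zx.
  split=> // b /(embset_jlist _ k19) [i /andP[i0 ik] ->].
  move: ik; rewrite ltnS leq_eqVlt => /predU1P[ik|ik].
    by rewrite ik; apply: xJ; rewrite -ik.
  by apply: xA; apply/(embset_jlist _ k9); exists i => //; rewrite i0.
move=> [xu xK xC xA /(_ erefl) xx].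
have Zx : Zset Cs k x.
  split=> // b /(embset_jlist _ k9) [i ik ->].
  by apply: xA; apply/(embset_jlist _ k19); exists i => //; lia.
have xJx : x *m adjmx (J k) *m x = - J k.
  apply/(relE x Zx); split=> // k0; apply: xA.
  by apply/(embset_jlist _ k19); exists k => //; lia.
split=> //; rewrite -(rotation_half (J k) x).
apply: (saturated_curve sP (t0 := 0)) => [t|t|].
- by eexists; exact: rotation_deriv.
- exact: (rotation_cliffset sP PJ).
- by rewrite rotation0.
Qed.

Lemma is_component_id (T : topologicalType) (A Q : set T) x :
  is_component A Q -> Q x -> Q = connected_component A x.
Proof. by move=> [y _ ->] yx; exact: same_connected_component. Qed.

Lemma Zset_component Cs k Q : Q (J k) ->
  Q = connected_component (Zset Cs k) (J k) ->
  saturated (K_mx R r) Cs (embset (jlist k)) (0 < k)%N Q.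
Proof.
move=> QJ QE; rewrite {1}QE; apply: saturated_component.
by move: QJ; rewrite QE => /connected_component_sub.
Qed.

(** At [k = 0] the space is recorded as the whole Clifford set; each later component is singled out
    by the prescribed membership of [J k.+1]. *)
Lemma Sp_chain (Pb : nat -> set MM) : Sp_Bott_chain J Pb ->
  forall k, (k <= 8)%N ->
  [/\ saturated (K_mx R r) set0 (embset (jlist k)) (0 < k)%N (Pb k),
      Pb k (J k) &
      if k is 0 then Pb k = Zset set0 k
      else Pb k = connected_component (Zset set0 k) (J k)].
Proof.
move=> [P0 PS]; elim=> [_|k IH k8].
  have E : Pb 0%N = Zset set0 0 by rewrite P0 Sp_setE embset_jlist0.
  split=> //; first by rewrite E; exact: saturated_Zset.
  by rewrite P0 JE // Sp_setE; split=> //; [exact/emb_unitary/ju|exact: emb_K].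
have k7 : (k <= 7)%N by [].
have [sP PJ _] := IH (ltnW k8); have [[[_ cP] _] QJ] := PS k k7.
rewrite (centrosome_Zset k7 sP PJ) in cP.
have QE := is_component_id cP QJ.
by split=> //; exact: Zset_component.
Qed.

(** The s-centrioles of the [k]-th space are exactly the components of one Clifford set, so top
    dimension selects the component of [J k.+1], and only this places the base point in the next
    space. *)
Lemma U_chain (Pt : nat -> set MM) : U_Bott_chain J Pt ->
  forall k, (k <= 8)%N ->
  [/\ saturated (K_mx R r) [set A_mx R r] (embset (jlist k)) (0 < k)%N (Pt k),
      Pt k (J k) &
      Pt k = connected_component (Zset [set A_mx R r] k) (J k)].
Proof.
move=> [P0 PS]; elim=> [_|k IH k8].
  have E : Pt 0%N = Zset [set A_mx R r] 0 by rewrite P0 U_setE embset_jlist0.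
  split; first by rewrite E; exact: saturated_Zset.
    by rewrite P0 J0; apply/U_setP; exists 1%:M; rewrite ?emb1 //;
      exact: unitary1.
  by rewrite -E P0 J0; exact: U_set_connected.
have k7 : (k <= 7)%N by [].
have [sP PJ _] := IH (ltnW k8); have tP := PS k k7.
have pP : pole (Pt k) (J k) (- J k) by have [[[]]] := tP.
have FE : s_centriole (Pt k) (J k) (- J k) = is_component (cliffU (jlist k.+1)).
  apply/funext => Q; apply/propext; rewrite (s_centriole_cliff sP PJ _ pP).
  by rewrite (centrosome_Zset k7 sP PJ).
rewrite FE in tP.
have kI : (0 < k.+1 <= 8)%N by [].
have QE : Pt k.+1 = connected_component (Zset [set A_mx R r] k.+1) (J k.+1).
  rewrite JE //; apply: (top_component r_gt0) tP.
  - by apply: jlist_clifford; exact: leqW.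
  - by apply: jlist_skew; exact: leqW.
  - exact: j_cliffs.
  - exact: j_trace0.
have QJ : Pt k.+1 (J k.+1).
  rewrite QE; apply: connected_component_refl; rewrite JE //.
  by apply/cliffUP; exists (j k.+1) => //; exact: j_cliffs.
by split=> //; exact: Zset_component.
Qed.

End Chains.

(** * Canonical maps into path spaces *)

Section CanonicalMaps.
Variables (R : realType) (m : nat).
Local Notation C := (Cplx R).
Local Notation M := ('M[C]_m).

Lemma rotation_Omega (K : M) Cs As fl (P : set M) o x :
  saturated K Cs As fl P -> P o -> P x -> x *m adjmx o *m x = - o ->
  Omega P o (- o) (rotation_path o x).
Proof.
move=> sP Po Px xox; have [e0 e1 _] := rotation_segment sP Po Px xox.
split=> //; last by move=> t; exact: (rotation_sat sP Po).
exists [:: 1]; first by split; rewrite //= ltr01.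
move=> [|i] // _; exists (rotation o x); first exact: rotation_smooth.
by move=> t _.
Qed.

(** The underlying path depends on [o] and the midpoint only; the ambient space enters through the
    proof component, so the square commutes by comparing underlying paths. *)
Definition canonical_map (Q P : set M) (o p : M)
    (H : forall x, Q x -> Omega P o p (rotation_path o x)) (x : Q) :
  Omega P o p := SigSub (mem_set (H (\val x) (set_mem (valP x)))).

Lemma canonical_mapP (K : M) Cs As fl (Q P : set M) o
    (H : forall x, Q x -> Omega P o (- o) (rotation_path o x)) :
  saturated K Cs As fl P -> P o -> Q `<=` centrosome P o (- o) ->
  is_canonical_map (canonical_map H).
Proof.
move=> sP Po QP x c; have := QP _ (set_mem (valP x)).
rewrite (centrosomeE sP Po) => -[Px xox].
exact: (shortest_rotationP sP Po).
Qed.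

End CanonicalMaps.

(** * The commutative ladder *)

Theorem theorem3p5 (R : realType) (n : nat) (hn : (1 <= n)%N)
  (P : nat -> set 'M[Cplx R]_(16 * n + 16 * n))
  (J : nat -> 'M[Cplx R]_(16 * n + 16 * n))
  (hJ : base_points P J)
  (Pt Pb : nat -> set 'M[Cplx R]_(16 * n + 16 * n))
  (hPt : U_Bott_chain J Pt) (hPb : Sp_Bott_chain J Pb) :
  [/\ (forall k, (k <= 8)%N ->
         [/\ @tau R (16 * n) @` Pb k = Pb k,
             Pt k = connected_component
                      (fixed_set (@tau R (16 * n)) (Pb k)) (J k)
           & Pt k `<=` Pb k]),
      (forall k, (k <= 7)%N ->
         exists (ht : Pt k.+1 `<=` Pt k) (hb : Pb k.+1 `<=` Pb k)
                (v : Pt k `<=` Pb k) (v' : Pt k.+1 `<=` Pb k.+1),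
           set_incl v \o set_incl ht = set_incl hb \o set_incl v')
    & (forall l, (l <= 7)%N ->
         exists (jt : Pt l.+1 -> Omega (Pt l) (J l) (- J l))
                (jb : Pb l.+1 -> Omega (Pb l) (J l) (- J l))
                (v : Pt l.+1 `<=` Pb l.+1)
                (w : Omega (Pt l) (J l) (- J l) `<=`
                     Omega (Pb l) (J l) (- J l)),
           [/\ is_canonical_map jt, is_canonical_map jb
             & jb \o set_incl v = set_incl w \o jt])].
Proof.
have r_gt0 : (0 < 16 * n)%N by lia.
move: (16 * n)%N r_gt0 P J hJ Pt Pb hPt hPb => r r_gt0 P J hJ Pt Pb hPt hPb.
have [[P0 J0] P1 Pk P8 PJ] := hJ.
have Psub k : (0 < k <= 7)%N ->
    P k.+1 `<=` [set X | P k X /\ X *m J k = - (J k *m X)].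
  move=> kI; have [x _ ->] : is_component
      [set X | P k X /\ X *m J k = - (J k *m X)] (P k.+1).
    have [k6|k7] := leqP k 6.
      have k16 : (1 <= k <= 6)%N by lia.
      by have [] := Pk k k16.
    by have -> : k = 7%N by lia.
  exact: connected_component_sub.
(* Each step imposes one relation; monotonicity makes [J k] inherit those of all earlier steps. *)
have Pmono i k : (0 < i)%N -> (i <= k)%N -> (k <= 8)%N -> P k `<=` P i.
  move=> i0; elim: k => [|k IH]; first lia.
  rewrite leq_eqVlt => /predU1P[-> _ //|ik] k8 X.
  have kI : (0 < k <= 7)%N by lia.
  by move=> /(Psub k kI) [PX _]; apply: (IH _ _ _ PX); lia.
have P1sub : P 1%N `<=` [set X | @SO_set R r X /\ X *m X = - 1%:M].
  by have [x _ ->] := P1; exact: connected_component_sub.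
have JSO k : (k <= 8)%N ->
    @SO_set R r (J k) /\ ((0 < k)%N -> J k *m J k = - 1%:M).
  case: k => [_|k k8].
    split=> //; rewrite J0; exists 1%:M; split.
    - by rewrite trmx1 mulmx1.
    - exact: det1.
    - by rewrite map_mx1 -scalar_mx_block.
  have /(Pmono 1%N) : P k.+1 (J k.+1) by apply: PJ.
  by move=> /(_ isT isT k8) /P1sub [].
pose j k := ulsubmx (J k).
have JE k : (k <= 8)%N -> J k = emb (j k).
  by move=> /JSO [/SO_emb [E _] _].
have ju k : (k <= 8)%N -> j k \is unitarymx.
  by move=> /JSO [/SO_emb [_ E] _].
have j0 : j 0%N = 1%:M.
  by apply: (@emb_inj R r); rewrite -JE // J0 emb1.
have jj k : (0 < k <= 8)%N -> j k *m j k = - 1%:M.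
  move=> /andP[k0 k8]; apply: (@emb_inj R r); rewrite -embM -!JE //.
  by rewrite (JSO k k8).2 // -embN emb1.
have ja i k : (0 < i)%N -> (i < k)%N -> (k <= 8)%N ->
    j k *m j i = - (j i *m j k).
  move=> i0 ik k8; have i8 : (i <= 8)%N by lia.
  apply: (@emb_inj R r); rewrite -embN -!embM -!JE //.
  have /(Pmono i.+1) : P k (J k) by apply: PJ; lia.
  have iI : (0 < i <= 7)%N by lia.
  by move=> /(_ isT ik k8) /(Psub i iI) [].
clear hJ P0 P1 Pk P8 PJ Psub Pmono P1sub JSO.
have bC := Sp_chain r_gt0 JE ju j0 jj hPb.
have tC := U_chain r_gt0 JE ju j0 jj ja hPt.
clearbody j.
(* Being fixed by [tau] means commuting with [A_mx], the one condition that separates the [U] from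
   the [Sp] Clifford set. *)
have comE k X : (k <= 8)%N -> cliffset (K_mx R r) [set A_mx R r]
    (embset (jlist j k)) (0 < k)%N X <->
    cliffset (K_mx R r) set0 (embset (jlist j k)) (0 < k)%N X /\ tau X = X.
  move=> k8; split=> [[Xu XK XC XA Xf]|[[Xu XK _ XA Xf] /tau_fixP XC]].
    by split; [split=> // | apply/tau_fixP; exact: XC].
  by split=> // _ ->.
(* Saturation of [Pb k] absorbs the connected set [Pt k], as both contain [J k]; each inclusion is
   then maximality of a connected component. *)
have PtE k : (k <= 8)%N ->
    Pt k = connected_component (fixed_set (@tau R r) (Pb k)) (J k).
  move=> k8; have [[PbZ PbS] bJ _] := bC k k8; have [[PtZ _] tJ tE] := tC k k8.
  have fJ : fixed_set (@tau R r) (Pb k) (J k).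
    by split=> //; have [] := (comE k _ k8).1 (PtZ _ tJ).
  have cPt : connected (Pt k) by rewrite tE; exact: component_connected.
  have PtZb : Pt k `<=` Pb k.
    apply: (PbS _ _ bJ cPt tJ) => X /PtZ; by move=> /(comE k _ k8) [].
  apply/seteqP; split.
    apply: connected_component_max => // X tX; split; first exact: PtZb.
    by have [] := (comE k _ k8).1 (PtZ _ tX).
  rewrite tE; apply: connected_component_max.
  - exact: connected_component_refl.
  - move=> X /connected_component_sub [bX Xtau]; apply/(comE k _ k8).
    by split=> //; exact: PbZ.
  - exact: component_connected.
have Ptb k : (k <= 8)%N -> Pt k `<=` Pb k.
  by move=> k8; rewrite (PtE k k8) => X /connected_component_sub [].
(* For [k > 0] the component of [J k] is preserved because [tau] is continuous, preserves the
   Clifford set and fixes [J k]; for [k = 0] the space is the whole Clifford set. *)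
have tau_Pb k : (k <= 8)%N -> forall X, Pb k X -> Pb k (tau X).
  move=> k8 X bX; have [[PbZ PbS] bJ bE] := bC k k8.
  have tJ : tau (J k) = J k by apply/tau_fixP; rewrite JE //; exact: emb_A.
  have tauZ Y : cliffset (K_mx R r) set0 (embset (jlist j k)) (0 < k)%N Y ->
      cliffset (K_mx R r) set0 (embset (jlist j k)) (0 < k)%N (tau Y).
    by apply: tau_cliffset => b [a _ ->]; exact: emb_A.
  case: k k8 bX PbZ PbS bJ bE tJ tauZ => [|k] k8 bX PbZ PbS bJ bE tJ tauZ.
    by rewrite bE; apply: tauZ; rewrite -bE.
  rewrite bE in bX *; rewrite -tJ; apply: component_image bX => //.
  exact: continuous_tau.
have subP Q k (Cs : set 'M[Cplx R]_(r + r)) (k7 : (k <= 7)%N) :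
    saturated (K_mx R r) Cs (embset (jlist j k)) (0 < k)%N (Q k) -> Q k (J k) ->
    saturated (K_mx R r) Cs (embset (jlist j k.+1)) true (Q k.+1) ->
    Q k.+1 `<=` centrosome (Q k) (J k) (- J k).
  move=> sQ QJ [QZ _]; rewrite (centrosome_Zset r_gt0 JE ju j0 jj k7 sQ QJ).
  exact: QZ.
have bS k : (k <= 7)%N -> Pb k.+1 `<=` centrosome (Pb k) (J k) (- J k).
  move=> k7; have [s1 bJ _] := bC k (leqW k7); have [s2 _ _] := bC k.+1 k7.
  exact: subP s1 bJ s2.
have tS k : (k <= 7)%N -> Pt k.+1 `<=` centrosome (Pt k) (J k) (- J k).
  move=> k7; have [s1 bJ _] := tC k (leqW k7); have [s2 _ _] := tC k.+1 k7.
  exact: subP s1 bJ s2.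
split.
- move=> k k8; split; [|exact: PtE|exact: Ptb].
  apply/seteqP; split=> [_ [X bX <-]|X bX]; first exact: tau_Pb.
  by exists (tau X); [exact: tau_Pb | exact: tauK].
- move=> k k7.
  have ht : Pt k.+1 `<=` Pt k.
    have [s1 tJ _] := tC k (leqW k7).
    by move=> X /(tS k k7); rewrite (centrosomeE s1 tJ) => -[].
  have hb : Pb k.+1 `<=` Pb k.
    have [s1 bJ _] := bC k (leqW k7).
    by move=> X /(bS k k7); rewrite (centrosomeE s1 bJ) => -[].
  exists ht, hb, (Ptb k (leqW k7)), (Ptb k.+1 k7).
  by apply/funext => x; apply/val_inj.
- move=> l l7; have [st tJ _] := tC l (leqW l7);
  have [sb bJ _] := bC l (leqW l7).
  have Ht x : Pt l.+1 x -> Omega (Pt l) (J l) (- J l) (rotation_path (J l) x).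
    move=> /(tS l l7); rewrite (centrosomeE st tJ) => -[tx xJx].
    exact: rotation_Omega st tJ tx xJx.
  have Hb x : Pb l.+1 x -> Omega (Pb l) (J l) (- J l) (rotation_path (J l) x).
    move=> /(bS l l7); rewrite (centrosomeE sb bJ) => -[bx xJx].
    exact: rotation_Omega sb bJ bx xJx.
  have w : Omega (Pt l) (J l) (- J l) `<=` Omega (Pb l) (J l) (- J l).
    move=> c [cs cP c0 c1]; split=> // t; apply: Ptb (cP t); exact: leqW.
  exists (canonical_map Ht), (canonical_map Hb), (Ptb l.+1 l7), w; split.
  + exact: canonical_mapP st tJ (tS l l7).
  + exact: canonical_mapP sb bJ (bS l l7).
  + by apply/funext => x; apply/val_inj.
Qed.
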